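(* Let $v$ be a weight on $\mathbb{D}$ which satisfies condition $(B)$, and assume that there is some $\epsilon>0$ with $$\sup_{n=1,2,\ldots}\frac{\int_0^1 r^{n-n^{\epsilon}}v(r)\,dr}{\int_0^1 r^n v(r)\,dr}<\infty .$$ Let $a\in L^1$ be a (complex valued) radial symbol and assume that, for some $\delta\in\,]0,1[$, the restriction $a|_{[\delta,1[}$ is differentiable, that each of the two real functions $u=\operatorname{Re}a$ and $u=\operatorname{Im}a$ satisfies $$\limsup_{r\to1}u'(r)<\infty\quad\text{or}\quad\liminf_{r\to1}u'(r)>-\infty ,$$ and that for some constant $C>0$ $$|a'(r)|\le\frac{C}{(1-r)\big(\log(1-r)\big)^2}\quad\text{for } r\in\,]\delta,1[ .$$ Then $T_a$ is a bounded operator $H_v^\infty\to H_v^\infty$. Moreover, if $$\lim_{r\to1}|a'(r)|(1-r)\big(\log(1-r)\big)^2=0$$ holds, then $T_a$ is compact on $H_v^\infty$ if and only if $\lim_{r\to1}a(r)=0$.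
   Context: $\mathbb{D}$ is the open unit disc of $\mathbb{C}$. A weight $v$ on $\mathbb{D}$ is a continuous strictly positive function with $v(z)=v(|z|)$ for all $z\in\mathbb{D}$, $\lim_{|z|\to1}v(z)=0$ and $v(r)\ge v(s)$ if $0<r<s<1$. $H_v^\infty$ is the Banach space of holomorphic $h:\mathbb{D}\to\mathbb{C}$ with $\|h\|_v:=\sup_{z\in\mathbb{D}}|h(z)|v(|z|)<\infty$. $L^1$ is taken with respect to (unweighted) Lebesgue area measure on $\mathbb{D}$. A function $a\in L^1$ is radial if $a(z)=a(|z|)$ for almost all $z$; we then regard $a$ as a function of $r=|z|\in[0,1[$. Toeplitz operator: $T_ah=P_v(a\cdot h)$, where $P_v$ is the orthogonal projection of $L_v^2=L^2(\mathbb{D},v(r)\,r\,dr\,d\varphi)$ onto its subspace $A_v^2$ of holomorphic functions. For radial $a\in L^1$ it is the Taylor coefficient multiplier: for $h(z)=\sum_{n\ge0}h_nz^n$, $$T_ah(z)=\sum_{n=0}^\infty\gamma_nh_nz^n,\qquad \gamma_n=\frac{\int_0^1r^{2n+1}v(r)a(r)\,dr}{\int_0^1r^{2n+1}v(r)\,dr}.$$ Condition $(B)$: for each (real) $m>0$ let $r_m$ be a point where $r\mapsto r^mv(r)$ attains its absolute maximum on $[0,1]$ (with $v(1)=0$). The weight $v$ satisfies $(B)$ if $$\forall b_1>1\ \exists b_2>1\ \exists c>0\ \forall m,n>0:\quad \Big(\frac{r_m}{r_n}\Big)^m\frac{v(r_m)}{v(r_n)}\le b_1\ \text{ and }\ m,n,|m-n|\ge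 c\ \Rightarrow\ \Big(\frac{r_n}{r_m}\Big)^n\frac{v(r_n)}{v(r_m)}\le b_2 ,$$ where $m,n$ are real numbers, not necessarily integers. *)

(* Defs.v *)
From HB Require Import structures.
From mathcomp Require Import all_boot all_order all_algebra.
From mathcomp Require Import all_classical all_reals all_analysis.
From mathcomp Require Import complex.

Set Implicit Arguments.
Unset Strict Implicit.
Unset Printing Implicit Defensive.

Import Order.TTheory GRing.Theory Num.Theory.
Import numFieldNormedType.Exports.

Local Open Scope classical_set_scope.
Local Open Scope complex_scope.
Local Open Scope ring_scope.

(* The topology of the complex plane is carried by the regular module R[i]^o.
   The norm `|z| of z : R[i] is the modulus as an element of R[i];
   modulus z is the same number in R. *)
Definition modulus (R : realType) (z : R[i]) : R := complex.Re `|z|.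

Definition unit_disc (R : realType) : set (R[i]^o) := [set z | modulus z < 1].

Record weight (R : realType) := Weight {
  weight_fun :> R[i] -> R ;
  weight_continuous :
    {within @unit_disc R, continuous (weight_fun : R[i]^o -> R)} ;
  weight_gt0 : forall z, unit_disc z -> 0 < weight_fun z ;
  weight_radial :
    forall z, unit_disc z -> weight_fun z = weight_fun (modulus z)%:C ;
  weight_cvg0 : weight_fun r%:C @[r --> 1^'-] --> 0 ;
  weight_nonincreasing :
    forall r s : R, 0 < r -> r < s -> s < 1 ->
      weight_fun s%:C <= weight_fun r%:C }.

(* the convention v(1) = 0 *)
Definition profile (R : realType) (v : weight R) (r : R) : R :=
  if r < 1 then v r%:C else 0.

Definition holomorphic_disc (R : realType) (h : R[i]^o -> R[i]^o) :=
  forall z, unit_disc z -> derivable h z 1.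

Definition weighted_values (R : realType) (v : weight R)
    (h : R[i]^o -> R[i]^o) : set R :=
  [set modulus (h z) * v (modulus z)%:C | z in @unit_disc R].

(* A function on the disc is represented by its extension by 0 to R[i], so
   that equality of representatives is equality on the disc. *)
Definition Hinf_pred (R : realType) (v : weight R) :
    {pred (R[i]^o -> R[i]^o)} :=
  mem [set h | [/\ holomorphic_disc h,
                   has_ubound (weighted_values v h)
                 & forall z, ~ unit_disc z -> h z = 0]].

Record Hinf (R : realType) (v : weight R) := MkHinf {
  Hinf_fun :> R[i]^o -> R[i]^o ;
  Hinf_funP : Hinf_fun \in Hinf_pred v }.

HB.instance Definition _ (R : realType) (v : weight R) :=
  [isSub for @Hinf_fun R v].
HB.instance Definition _ (R : realType) (v : weight R) :=
  gen_eqMixin (Hinf v).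
HB.instance Definition _ (R : realType) (v : weight R) :=
  gen_choiceMixin (Hinf v).

Section Hinf_normed.
Variables (R : realType) (v : weight R).

Let modulus_ge0 (z : R[i]) : 0 <= modulus z.
Proof. by have := normr_ge0 z; rewrite lecE => /andP[]. Qed.

Let modulusE (z : R[i]) : `|z| = (modulus z)%:C.
Proof. by rewrite /modulus normc_def. Qed.

Let modulusD (x y : R[i]) : modulus (x + y) <= modulus x + modulus y.
Proof. by rewrite -lecR rmorphD /= -!modulusE ler_normD. Qed.

Let modulusM (x y : R[i]) : modulus (x * y) = modulus x * modulus y.
Proof.
by apply: (@complexI R); rewrite rmorphM/= -!modulusE normrM.
Qed.

Let modulus0 : modulus (0 : R[i]) = 0.
Proof. by rewrite /modulus normr0. Qed.

Let modulus_eq0 (x : R[i]) : modulus x = 0 -> x = 0.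
Proof. by move=> x0; apply/normr0_eq0; rewrite modulusE x0. Qed.

Let disc0 : unit_disc (0 : R[i]).
Proof. by rewrite /unit_disc/= modulus0 ltr01. Qed.

Let v_gt0 z : unit_disc z -> 0 < v (modulus z)%:C.
Proof. by move=> zD; rewrite -weight_radial//; exact: weight_gt0. Qed.

Let ubound_combo (c : R[i]) (f g : R[i]^o -> R[i]^o) B B' :
  ubound (weighted_values v f) B -> ubound (weighted_values v g) B' ->
  ubound (weighted_values v (c *: f + g)) (modulus c * B + B').
Proof.
move=> Bf Bg _ [z zD <-].
have /Bf fz : weighted_values v f (modulus (f z) * v (modulus z)%:C).
  by exists z.
have /Bg gz : weighted_values v g (modulus (g z) * v (modulus z)%:C).
  by exists z.
have -> : (c *: f + g) z = c * f z + g z by [].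
have := modulusD (c * f z) (g z); rewrite modulusM.
move=> /(ler_wpM2r (ltW (v_gt0 zD))) /le_trans; apply.
rewrite mulrDl -mulrA lerD//.
by rewrite ler_wpM2l.
Qed.

Lemma Hinf_submod_closed : submod_closed (Hinf_pred v).
Proof.
split.
  apply/mem_set; split => //.
  by exists (0 : R) => _ [z _ <-]; rewrite modulus0 mul0r.
move=> c f g /set_mem[hf [B Bf] f0] /set_mem[hg [B' Bg] g0].
apply/mem_set; split.
- move=> z zD; apply: derivableD; last exact: hg.
  by apply: derivableZ; exact: hf.
- by exists (modulus c * B + B'); exact: ubound_combo.
- move=> z zD.
  have -> : (c *: f + g) z = c * f z + g z by [].
  by rewrite f0// g0// mulr0 addr0.
Qed.

HB.instance Definition _ := GRing.isSubmodClosed.Build _ _ (Hinf_pred v)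
  Hinf_submod_closed.

HB.instance Definition _ := [SubChoice_isSubLmodule of Hinf v by <:].

(* the norm of a normed R[i]-module takes its values in R[i] *)
Definition Hinf_norm (h : Hinf v) : R[i] := (sup (weighted_values v h))%:C.

Let Hinf_ub (h : Hinf v) : has_ubound (weighted_values v h).
Proof. by case: h => h /= /set_mem[]. Qed.

Let Hinf_nonempty (h : R[i]^o -> R[i]^o) : weighted_values v h !=set0.
Proof. by exists (modulus (h 0) * v (modulus (0 : R[i]))%:C); exists 0. Qed.

Let Hinf_sup (h : Hinf v) : has_sup (weighted_values v h).
Proof. by split; [exact: Hinf_nonempty|exact: Hinf_ub]. Qed.

Let Hinf_ubound (h : Hinf v) :
  ubound (weighted_values v h) (sup (weighted_values v h)).
Proof. exact: (sup_upper_bound (Hinf_sup h)). Qed.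

Lemma Hinf_ler_normD (f g : Hinf v) :
  Hinf_norm (f + g) <= Hinf_norm f + Hinf_norm g.
Proof.
rewrite /Hinf_norm -rmorphD/= lecR; apply: ge_sup => //.
have := @ubound_combo 1 f g _ _ (@Hinf_ubound f) (@Hinf_ubound g).
by rewrite scale1r [modulus 1](_ : _ = 1) ?mul1r// /modulus normr1.
Qed.

Lemma Hinf_normrZ (c : R[i]) (f : Hinf v) :
  Hinf_norm (c *: f) = `|c| * Hinf_norm f.
Proof.
have le1 (d : R[i]) (g : Hinf v) : sup (weighted_values v (d *: g)) <=
    modulus d * sup (weighted_values v g).
  apply: ge_sup => //.
  have ub0 : ubound (weighted_values v (0 : R[i]^o -> R[i]^o)) 0.
    by move=> _ [z _ <-]; rewrite modulus0 mul0r.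
  have := @ubound_combo d g 0 _ _ (@Hinf_ubound g) ub0.
  by rewrite !addr0.
rewrite /Hinf_norm modulusE -rmorphM/=; congr (_ %:C).
apply/eqP; rewrite eq_le le1/=.
have [->|c0] := eqVneq c 0.
  rewrite modulus0 mul0r.
  apply: (le_trans _ (@Hinf_ubound (0 *: f)
    (modulus ((0 *: f : Hinf v) 0) * v (modulus (0 : R[i]))%:C) _)).
    by rewrite mulr_ge0// ltW// v_gt0.
  by exists 0.
have mc0 : 0 < modulus c.
  rewrite lt_neqAle modulus_ge0 andbT eq_sym.
  by apply/eqP => /modulus_eq0; apply/eqP.
have := le1 c^-1 (c *: f); rewrite scalerA mulVf// scale1r.
have -> : modulus c^-1 = (modulus c)^-1.
  apply: (@mulfI _ (modulus c)); first exact: lt0r_neq0.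
  by rewrite -modulusM (mulfV c0) (mulfV (lt0r_neq0 mc0)) /modulus normr1.
by rewrite -(ler_pM2l mc0) mulrA mulfV ?lt0r_neq0// mul1r.
Qed.

Lemma Hinf_normr0_eq0 (f : Hinf v) : Hinf_norm f = 0 -> f = 0.
Proof.
move=> /(congr1 (@complex.Re R))/= f0; apply: val_inj; apply/funext => z /=.
have [zD|zD] := pselect (unit_disc z); last first.
  by case: f f0 => f /= /set_mem[_ _] /(_ _ zD).
apply: modulus_eq0; apply/eqP; rewrite eq_le modulus_ge0 andbT.
rewrite -(pmulr_lle0 _ (v_gt0 zD)).
rewrite -f0; apply: Hinf_ubound.
by exists z.
Qed.

HB.instance Definition _ := Lmodule_isNormed.Build R[i] (Hinf v)
  Hinf_ler_normD Hinf_normrZ Hinf_normr0_eq0.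

End Hinf_normed.

Definition bounded_operator (K : numFieldType) (V W : normedModType K)
    (T : {linear V -> W}) :=
  exists M : K, forall x, `|T x| <= M * `|x|.

Definition compact_operator (K : numFieldType) (V W : normedModType K)
    (T : {linear V -> W}) :=
  precompact [set T x | x in [set x : V | `|x| <= 1]].

Definition area (R : realType) := (@lebesgue_measure R \x @lebesgue_measure R)%E.

Definition plane_disc (R : realType) : set (R * R) :=
  [set p | unit_disc (p.1 +i* p.2)].

Definition L1_disc (R : realType) (a : R[i] -> R[i]) :=
  (@area R).-integrable (@plane_disc R)
    (fun p => (complex.Re (a (p.1 +i* p.2)))%:E) /\
  (@area R).-integrable (@plane_disc R)
    (fun p => (complex.Im (a (p.1 +i* p.2)))%:E).

Definition radial_symbol (R : realType) (a : R[i] -> R[i]) :=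
  {ae @area R, forall p, plane_disc p ->
    a (p.1 +i* p.2) = a (modulus (p.1 +i* p.2))%:C}.

Definition re_symbol (R : realType) (a : R[i] -> R[i]) (r : R) : R :=
  complex.Re (a r%:C).

Definition im_symbol (R : realType) (a : R[i] -> R[i]) (r : R) : R :=
  complex.Im (a r%:C).

Definition moment (R : realType) (v : weight R) (u : R -> R) (n : nat) : R :=
  \int[@lebesgue_measure R]_(r in `[0, 1]) (r ^+ n * profile v r * u r).

Definition multiplier (R : realType) (v : weight R) (a : R[i] -> R[i])
    (n : nat) : R[i] :=
  (moment v (re_symbol a) (2 * n + 1) +i* moment v (im_symbol a) (2 * n + 1))
    / (moment v (fun=> 1) (2 * n + 1))%:C.

Definition taylor_coef (R : realType) (h : R[i]^o -> R[i]^o) (n : nat) : R[i] :=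
  (derive1n n h 0 : R[i]) / n`!%:R.

(* For radial a in L^1 the function a h need not lie in L_v^2, and the Toeplitz
   operator is the Taylor coefficient multiplier. *)
Definition is_toeplitz (R : realType) (v : weight R) (a : R[i] -> R[i])
    (T : Hinf v -> Hinf v) :=
  forall (h : Hinf v) z, unit_disc z ->
    series (fun n => multiplier v a n * taylor_coef h n * z ^+ n : R[i]^o) @ \oo
      --> T h z.

Definition peak_points (R : realType) (v : weight R) (rho : R -> R) :=
  forall m, 0 < m -> 0 <= rho m <= 1 /\
    forall s, 0 <= s <= 1 ->
      s `^ m * profile v s <= rho m `^ m * profile v (rho m).

(* The maximum points need not be unique: (B) is required for some choice. *)
Definition condition_B (R : realType) (v : weight R) :=
  exists2 rho : R -> R, peak_points v rho &
  forall b1 : R, 1 < b1 -> exists2 b2 : R, 1 < b2 & exists2 c : R, 0 < c &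
  forall m n : R, 0 < m -> 0 < n ->
    (rho m / rho n) `^ m * (profile v (rho m) / profile v (rho n)) <= b1 ->
    [/\ c <= m, c <= n & c <= `|m - n|] ->
    (rho n / rho m) `^ n * (profile v (rho n) / profile v (rho m)) <= b2.

(* The numerators may be infinite (when n ^ eps > n), hence the
   extended-real-valued integrals. *)
Definition moment_ratio_bounded (R : realType) (v : weight R) (eps : R) :=
  (ereal_sup
    [set (\int[@lebesgue_measure R]_(r in `[0%R, 1%R])
            (r `^ (n%:R - n%:R `^ eps) * profile v r)%R%:E) /
         (\int[@lebesgue_measure R]_(r in `[0%R, 1%R])
            (r ^+ n * profile v r)%R%:E)
      | n in [set n : nat | (1 <= n)%N]] < +oo)%E.

(* u restricted to [d, 1[: the derivative at d is one-sided *)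
Definition differentiable_co (R : realType) (u : R -> R) (d : R) :=
  (forall r, d < r < 1 -> derivable u r 1) /\
  cvg (h^-1 * (u (d + h) - u d) @[h --> 0^'+]).

Definition derivative_semibounded (R : realType) (u : R -> R) :=
  (limf_esup (fun r => (derive1 u r)%:E) (1 : R)^'- < +oo \/
   -oo < limf_einf (fun r => (derive1 u r)%:E) (1 : R)^'-)%E.

Definition symbol_derivative (R : realType) (a : R[i] -> R[i]) (r : R) : R[i] :=
  derive1 (re_symbol a) r +i* derive1 (im_symbol a) r.

(* Main.v *)
(* Write gamma_n = l + g_n with l = lim a(r). Up to an exponentially small term
   coming from the symbol on [0, r_1], each part of g_n is a linear combination of
   means of nonincreasing functions against r^(2n+1) v(r) dr, hence is monotone
   in n; as |a - l| <= C / |log(1 - r)| and the mass of r^n v concentrates on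
   [1 - n^(-eps/2), 1] by the moment condition, this gives a sequence tau_n
   dominating g_n and its variation with tau_n log n bounded, and tending to 0 in
   the little-o case.
   The partial sums of the Taylor series have norm O(log n) on each circle, so by
   Abel summation a block N_j <= k < N_(j+1) of sum g_k h_k z^k is bounded by
   tau_(N_j) log N_(j+1) sup |h|. Condition (B) makes the peaks of r^m v(r) separate
   geometrically: with N_j = N K^j the j-th block decays geometrically away from
   the peak of r^(N_j) v(r), and the blocks can be summed.
   In the little-o case T - l is a norm limit of finite rank operators, and
   the images of the normalized monomials are |l| / 4-separated if l <> 0. *)
Require Import Defs.
From HB Require Import structures.
From mathcomp Require Import all_boot all_order all_algebra.
From mathcomp Require Import all_classical all_reals all_analysis.
From mathcomp Require Import complex measurable_realfun.
From mathcomp Require Import ring lra.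

Set Implicit Arguments.
Unset Strict Implicit.
Unset Printing Implicit Defensive.

Import Order.TTheory GRing.Theory Num.Theory.
Import numFieldNormedType.Exports.

Local Open Scope classical_set_scope.
Local Open Scope complex_scope.
Local Open Scope ring_scope.

(** * Complex moduli and limits *)

(** Two obstacles shape the proof. The symbol is integrable over the disc, but its profile a(r) is
    read on the positive real axis, a null set of the plane. Fubini on vertical lines, with an
    expanding substitution in place of polar coordinates, shows that r a(r) agrees almost everywhere
    on ]0, 1[ with an integrable function; the factor r is supplied by the exponent 2n + 1, which is
    at least 1. The other obstacle is that the correction from [0, r_1] is small but has no sign, so
    it is dominated by a geometric sequence whose own decrements dominate its variation.
    Monotonicity of the means is proved from exponent p to p + 2, the very step from 2n + 1 to 2(n +
    1) + 1. The function theory only involves circles about 0. In the coordinate z = exp(x + i y)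
    they are vertical segments, and the horizontal sides of a rectangle of height 2 pi cancel by
    periodicity. Goursat's theorem on rectangles thus yields Cauchy's formula, Taylor series with
    geometric remainders and the integral formula for the coefficients. These geometric rates then
    replace most limit arguments. *)

Section modulus_theory.
Variable R : realType.
Implicit Types z w : R[i].

Lemma modulusE z : `|z| = (modulus z)%:C.
Proof. by rewrite /modulus normc_def. Qed.

Lemma modulus_ge0 z : 0 <= modulus z.
Proof. by have := normr_ge0 z; rewrite lecE => /andP[]. Qed.

Lemma modulusD z w : modulus (z + w) <= modulus z + modulus w.
Proof. by rewrite -lecR rmorphD /= -!modulusE ler_normD. Qed.

Lemma modulusM z w : modulus (z * w) = modulus z * modulus w.
Proof. by apply: (@complexI R); rewrite rmorphM/= -!modulusE normrM. Qed.

Lemma modulus0 : modulus (0 : R[i]) = 0.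
Proof. by rewrite /modulus normr0. Qed.

Lemma modulus1 : modulus (1 : R[i]) = 1.
Proof. by rewrite /modulus normr1. Qed.

Lemma modulusN z : modulus (- z) = modulus z.
Proof. by rewrite /modulus normrN. Qed.

Lemma modulusC z w : modulus (z - w) = modulus (w - z).
Proof. by rewrite /modulus distrC. Qed.

Lemma modulusB z w : modulus (z - w) <= modulus z + modulus w.
Proof. by rewrite (le_trans (modulusD _ _))// modulusN. Qed.

Lemma modulusX z n : modulus (z ^+ n) = modulus z ^+ n.
Proof.
by elim: n => [|n IH]; rewrite ?expr0 ?modulus1// !exprS modulusM IH.
Qed.

Lemma modulus_eq0 z : (modulus z == 0) = (z == 0).
Proof.
apply/eqP/eqP => [z0|->]; last exact: modulus0.
by apply/normr0_eq0; rewrite modulusE z0.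
Qed.

Lemma modulus_gt0 z : (0 < modulus z) = (z != 0).
Proof. by rewrite lt0r modulus_eq0 modulus_ge0 andbT. Qed.

Lemma modulusV z : modulus z^-1 = (modulus z)^-1.
Proof.
have [->|z0] := eqVneq z 0; first by rewrite invr0 modulus0 invr0.
have mz : modulus z != 0 by rewrite modulus_eq0.
by apply: (mulfI mz); rewrite -modulusM mulfV// mulfV// modulus1.
Qed.

Lemma modulus_real (r : R) : modulus r%:C = `|r|.
Proof. by rewrite /modulus normc_def/= expr0n/= addr0 sqrtr_sqr. Qed.

Lemma modulus_sqr z :
  modulus z ^+ 2 = complex.Re z ^+ 2 + complex.Im z ^+ 2.
Proof.
by case: z => x y; rewrite /modulus normc_def/= sqr_sqrtr// addr_ge0// sqr_ge0.
Qed.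

Lemma Re_le_modulus z : `|complex.Re z| <= modulus z.
Proof.
rewrite -(ler_pXn2r (ltn0Sn 1)) ?nnegrE ?modulus_ge0//.
by rewrite modulus_sqr real_normK ?num_real// lerDl sqr_ge0.
Qed.

Lemma Im_le_modulus z : `|complex.Im z| <= modulus z.
Proof.
rewrite -(ler_pXn2r (ltn0Sn 1)) ?nnegrE ?modulus_ge0//.
by rewrite modulus_sqr real_normK ?num_real// lerDr sqr_ge0.
Qed.

Lemma modulus_le_ReIm z :
  modulus z <= `|complex.Re z| + `|complex.Im z|.
Proof.
rewrite -(ler_pXn2r (ltn0Sn 1)) ?nnegrE ?modulus_ge0 ?addr_ge0//.
rewrite modulus_sqr sqrrD !real_normK ?num_real//.
by rewrite lerD2r lerDl mulrn_wge0// mulr_ge0.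
Qed.

Lemma modulus_sum (I : Type) (s : seq I) (P : pred I) (F : I -> R[i]) :
  modulus (\sum_(i <- s | P i) F i) <= \sum_(i <- s | P i) modulus (F i).
Proof.
apply: (big_ind2 (fun x y => modulus x <= y)) => //; first by rewrite modulus0.
by move=> a b c d ab cd; rewrite (le_trans (modulusD _ _))// lerD.
Qed.

Lemma ball_modulus (z w : R[i]^o) (e : R) :
  ball z (e%:C : R[i]) w <-> modulus (z - w) < e.
Proof. by rewrite -ball_normE /ball_/= modulusE ltcR. Qed.

(** The norm of [R[i]^o] takes values in [R[i]], so radii of balls are complex numbers; a positive
    one is real, which allows real radii throughout. *)
Lemma cvg_modulusP (T : Type) (F : set_system T) (FF : Filter F)
    (f : T -> R[i]^o) (l : R[i]^o) :
  f @ F --> l <-> forall e : R, 0 < e -> \forall x \near F, modulus (f x - l) < e.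
Proof.
split => [/cvgrPdist_lt fl e e0|fl].
  have e0' : (0 : R[i]) < e%:C by rewrite ltcR.
  apply: filterS (fl _ e0') => x /=.
  by rewrite modulusE ltcR modulusC.
apply/cvgrPdist_lt => e e0.
have eE : e = (complex.Re e)%:C.
  by case: e e0 => x y; rewrite ltcE/= => /andP[/eqP-> _].
have : 0 < complex.Re e by move: e0; rewrite {1}eE ltcR.
move=> /fl; apply: filterS => x.
by rewrite eE modulusE ltcR modulusC.
Qed.

(** The little-o form admits k = 0, so that an increment such as u k or exp(k) - 1 can be
    substituted without excluding its zeros. *)
Lemma derivable_modulusP (h : R[i]^o -> R[i]^o) (z : R[i]^o) (d : R[i]) :
  (derivable h z 1 /\ derive1 h z = d) <->
  forall e : R, 0 < e -> exists2 del : R, 0 < del &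
    forall k : R[i], modulus k < del ->
      modulus (h (z + k) - h z - d * k) <= e * modulus k.
Proof.
have cE : (derivable h z 1 /\ derive1 h z = d) <->
    (fun k : R[i]^o => k^-1 *: (h (k + z) - h z)) @ (0 : R[i]^o)^' --> (d : R[i]^o).
  split.
    move=> [hd <-]; rewrite /derive1.
    have : cvg ((fun k : R[i]^o => k^-1 *: ((h \o shift z) (k *: 1) - h z)) @ (0 : R[i]^o)^') by exact: hd.
    under eq_fun do rewrite /= /shift/= /GRing.scale/= mulr1.
    by [].
  move=> hd; split; last by apply: cvg_lim => //; exact: norm_hausdorff.
  rewrite /derivable; apply/cvg_ex; exists d.
  by under eq_fun do rewrite /= /shift/= [_ *: 1]mulr1.
rewrite cE (cvg_modulusP _ _ _); split => H e e0.
  have := H e e0 => /nbhs_ballP[r r0 Hr].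
  have rE : r = (complex.Re r)%:C.
    by case: r r0 {Hr} => x y; rewrite /= ltcE/= => /andP[/eqP-> _].
  exists (complex.Re r); first by move: r0; rewrite /= {1}rE ltcR.
  move=> k kr; have [->|k0] := eqVneq k 0.
    by rewrite addr0 subrr mulr0 subrr modulus0 mulr0.
  have := Hr k; rewrite rE => /(_ _ k0)/= Hk.
  have {Hk}: modulus (k^-1 * (h (k + z) - h z) - d) < e.
    by apply: Hk; apply/ball_modulus; rewrite modulusC subr0.
  move=> /ltW; rewrite -(ler_pM2r (_ : 0 < modulus k)) ?modulus_gt0//.
  rewrite -modulusM mulrBl mulrAC mulVf// mul1r [k + z]addrC.
  by rewrite addrC.
have e20 : 0 < e / 2 by rewrite divr_gt0.
have [del del0 Hd] := H _ e20.
apply/nbhs_ballP; exists (del%:C); first by rewrite /= ltcR.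
move=> k /ball_modulus; rewrite modulusC subr0 => kd k0.
have /(_ kd) := Hd k.
rewrite -(ler_pM2r (_ : 0 < (modulus k)^-1)) ?invr_gt0 ?modulus_gt0//.
rewrite mulfK ?modulus_eq0// -modulusV -modulusM => kl.
apply: (@le_lt_trans _ _ (e / 2)); last by lra.
apply: le_trans kl.
rewrite le_eqVlt; apply/orP; left; apply/eqP; congr modulus.
rewrite [in RHS]mulrBl mulfK// [k + z]addrC /GRing.scale/=.
by rewrite mulrC.
Qed.

Definition cderiv (f : R[i] -> R[i]) z (d : R[i]) :=
  forall e : R, 0 < e -> exists2 del : R, 0 < del &
    forall k : R[i], modulus k < del ->
      modulus (f (z + k) - f z - d * k) <= e * modulus k.

Definition cdiff (f : R[i] -> R[i]) z := exists d, cderiv f z d.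

Lemma cdiffP (f : R[i] -> R[i]) z :
  cdiff f z <-> derivable (f : R[i]^o -> R[i]^o) z 1.
Proof.
split=> [[d /derivable_modulusP[]]//|fz].
by exists (derive1 (f : R[i]^o -> R[i]^o) z); apply/derivable_modulusP.
Qed.

Lemma cderivP (f : R[i] -> R[i]) z d : cderiv f z d <->
  derivable (f : R[i]^o -> R[i]^o) z 1 /\
  derive1 (f : R[i]^o -> R[i]^o) z = d.
Proof. by split; move/derivable_modulusP. Qed.

Lemma cdiff_cst (c z : R[i]) : cdiff (fun=> c) z.
Proof. by apply/cdiffP; exact: (@derivable_cst _ R[i]^o R[i]^o). Qed.

Lemma cderiv_id z : cderiv id z 1.
Proof.
move=> e e0; exists 1 => // k _.
by rewrite mul1r [z + k]addrC addrK subrr modulus0 mulr_ge0 ?modulus_ge0 ?ltW.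
Qed.

Lemma cdiff_id z : cdiff id z.
Proof. by exists 1; exact: cderiv_id. Qed.

Lemma cdiffD (f g : R[i] -> R[i]) z :
  cdiff f z -> cdiff g z -> cdiff (fun w => f w + g w) z.
Proof.
move=> /cdiffP fz /cdiffP gz; apply/cdiffP.
exact: (@derivableD _ R[i]^o R[i]^o f g z 1 fz gz).
Qed.

Lemma cdiffB (f g : R[i] -> R[i]) z :
  cdiff f z -> cdiff g z -> cdiff (fun w => f w - g w) z.
Proof.
move=> /cdiffP fz /cdiffP gz; apply/cdiffP.
exact: (@derivableB _ R[i]^o R[i]^o f g z 1 fz gz).
Qed.

Lemma cdiffM (f g : R[i] -> R[i]) z :
  cdiff f z -> cdiff g z -> cdiff (fun w => f w * g w) z.
Proof.
move=> /cdiffP fz /cdiffP gz; apply/cdiffP.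
exact: (@derivableM _ R[i]^o f g z 1 fz gz).
Qed.

Lemma cdiffV (f : R[i] -> R[i]) z :
  f z != 0 -> cdiff f z -> cdiff (fun w => (f w)^-1) z.
Proof.
move=> f0 /cdiffP fz; apply/cdiffP.
exact: (@derivableV _ R[i]^o f z 1 f0 fz).
Qed.

Lemma cdiffX z k : cdiff (fun w => w ^+ k) z.
Proof.
elim: k => [|k IH].
  by rewrite (_ : (fun w => _) = (fun=> 1)); [exact: cdiff_cst|apply/funext => w; rewrite expr0].
rewrite (_ : (fun w => _) = (fun w => w * w ^+ k)); last first.
  by apply/funext => w; rewrite exprS.
by apply: cdiffM => //; exact: cdiff_id.
Qed.

Lemma cdiff_sum (F : nat -> R[i] -> R[i]) z (n : nat) :
  (forall k, (k < n)%N -> cdiff (F k) z) ->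
  cdiff (fun w => \sum_(k < n) F k w) z.
Proof.
elim: n => [|n IH] Fz.
  by under eq_fun do rewrite big_ord0; exact: cdiff_cst.
under eq_fun do rewrite big_ord_recr/=; apply: cdiffD; last exact: Fz.
by apply: IH => k kn; apply: Fz; rewrite ltnS ltnW.
Qed.

(** Serves both as continuity with a rate and as the boundedness of the difference quotient near a
    removable singularity. *)
Lemma cdiff_bound (f : R[i] -> R[i]) z : cdiff f z -> exists2 C : R, 0 < C &
  exists2 del : R, 0 < del & forall w, modulus (w - z) < del ->
    modulus (f w - f z) <= C * modulus (w - z).
Proof.
move=> [d /(_ 1 ltr01)[del del0 H]].
exists (modulus d + 1); first by rewrite ltr_wpDl// modulus_ge0.
exists del => // w wd; have := H _ wd; rewrite subrKC => {}H.
have -> : f w - f z = (f w - f z - d * (w - z)) + d * (w - z) by rewrite subrK.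
apply: le_trans (modulusD _ _) _; rewrite mulrDl addrC (modulusM d).
by rewrite lerD2l.
Qed.

End modulus_theory.

(** * Goursat's theorem for differentiable closed 1-forms *)

Section real_integral.
Variable R : realType.
Notation mu := (@lebesgue_measure R).
Implicit Types (f g : R -> R) (a b c : R).

Definition continuous_on f a b := forall x, a <= x <= b -> {for x, continuous f}.

Lemma continuous_on_within f a b :
  continuous_on f a b -> {within `[a, b], continuous f}.
Proof.
move=> cf; apply: continuous_in_subspaceT => x /set_mem/=.
by rewrite in_itv/=; exact: cf.
Qed.

Lemma continuous_on_integrable f a b :
  continuous_on f a b -> mu.-integrable `[a, b] (EFin \o f).
Proof.
move=> cf; apply: continuous_compact_integrable; first exact: segment_compact.
exact: continuous_on_within.
Qed.

Lemma continuous_onB f g a b : continuous_on f a b -> continuous_on g a b ->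
  continuous_on (fun x => f x - g x) a b.
Proof.
by move=> cf cg x xab; apply: continuousB; [exact: cf|exact: cg].
Qed.

Lemma Rintegral_split f a b c : a <= b -> b <= c -> continuous_on f a c ->
  \int[mu]_(x in `[a, c]) f x =
  \int[mu]_(x in `[a, b]) f x + \int[mu]_(x in `[b, c]) f x.
Proof.
move=> ab bc cf.
have ic := continuous_on_integrable cf.
have /(_ _)/= := Rintegral_itvB ic _ _ => /(_ b).
rewrite !bnd_simp => /(_ ab bc).
rewrite (@Rintegral_itv_obnd_cbnd _ b (BRight c)).
  by move=> <-; rewrite addrC subrK.
apply: integrableS ic => //; apply: subset_itvr => /=.
by rewrite bnd_simp.
Qed.

Lemma Rintegral_near_cst f a b k e : a <= b -> continuous_on f a b ->
  (forall x, a <= x <= b -> `|f x - k| <= e) ->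
  `|\int[mu]_(x in `[a, b]) f x - k * (b - a)| <= e * (b - a).
Proof.
move=> ab cf fk.
have icst (r : R) : mu.-integrable `[a, b] (EFin \o fun=> r).
  by apply: continuous_on_integrable => x _; exact: cst_continuous.
have Icst (r : R) : \int[mu]_(x in `[a, b]) r = r * (b - a).
  by rewrite Rintegral_cst//= lebesgue_measure_itv/= lte_fin;
    case: ltgtP ab => //= ->; rewrite subrr mulr0.
rewrite -!Icst -RintegralB//; last exact: continuous_on_integrable.
have cfk : continuous_on (fun x => f x - k) a b.
  by apply: continuous_onB => // x _; exact: cst_continuous.
apply: le_trans (le_normr_Rintegral _ _) _ => //.
  exact: continuous_on_integrable.
apply: le_Rintegral => //.
  by apply: continuous_on_integrable => x xab; apply: continuous_comp;
   [exact: cfk|exact: norm_continuous].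
Qed.

Lemma Rintegral_norm_le f a b e : a <= b -> continuous_on f a b ->
  (forall x, a <= x <= b -> `|f x| <= e) ->
  `|\int[mu]_(x in `[a, b]) f x| <= e * (b - a).
Proof.
move=> ab cf fe; have := @Rintegral_near_cst f a b 0 e ab cf.
by rewrite mul0r subr0; apply => x xab; rewrite subr0 fe.
Qed.

Lemma nested_intervals (lo hi : nat -> R) :
  (forall n, lo n <= lo n.+1) -> (forall n, hi n.+1 <= hi n) ->
  (forall n, lo n <= hi n) -> exists x, forall n, lo n <= x <= hi n.
Proof.
move=> lon hin lohi.
have lom m n : (m <= n)%N -> lo m <= lo n.
  by move=> /subnK<-; elim: (n - m)%N => // i IH; rewrite addSn (le_trans IH).
have him m n : (m <= n)%N -> hi n <= hi m.
  move=> /subnK<-; elim: (n - m)%N => // i IH.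
  by rewrite addSn (le_trans _ IH).
have lh m n : lo m <= hi n.
  case: (leqP m n) => mn; first exact: (le_trans (lom _ _ mn)).
  exact: (le_trans (lohi m) (him _ _ (ltnW mn))).
exists (sup (range lo)) => n; apply/andP; split.
  apply: ub_le_sup; last by exists n.
  by exists (hi 0%N) => _ [m _ <-].
by apply: ge_sup; [exists (lo 0%N), 0%N|move=> _ [m _ <-]].
Qed.

Lemma div_expr2_small (s e : R) : 0 < e -> exists n, s / 2 ^+ n < e.
Proof.
move=> e0; exists (Num.bound (`|s| / e)).
rewrite ltr_pdivrMr ?exprn_gt0// -ltr_pdivrMl// mulrC.
apply: (@le_lt_trans _ _ (`|s| / e)); first by rewrite ler_pM2r ?invr_gt0 ?ler_norm.
apply: (@lt_trans _ _ (Num.bound (`|s| / e))%:R).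
  by rewrite archi_boundP// divr_ge0// ltW.
by rewrite -natrX ltr_nat ltn_expl.
Qed.

End real_integral.

Section goursat.
Variable R : realType.
Notation mu := (@lebesgue_measure R).
Variables P Q : R -> R -> R.
Implicit Types a b c d e m p q s x y M : R.

(** The integral of the 1-form P dx + Q dy along the boundary of [a, b] x [c, d],
    counterclockwise. *)
Definition rect_integral a b c d : R :=
  \int[mu]_(x in `[a, b]) (P x c - P x d) +
  \int[mu]_(y in `[c, d]) (Q b y - Q a y).

(** P and Q are differentiable at the point, and the shared coefficient B expresses closedness,
    dP/dy = dQ/dx. Partial derivatives need only exist, not be continuous. *)
Definition closed_form_at (x0 y0 : R) := exists A B D : R,
  forall e : R, 0 < e -> exists2 del : R, 0 < del &
  forall x y, `|x - x0| < del -> `|y - y0| < del ->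
    `|P x y - P x0 y0 - A * (x - x0) - B * (y - y0)| <=
      e * (`|x - x0| + `|y - y0|) /\
    `|Q x y - Q x0 y0 - B * (x - x0) - D * (y - y0)| <=
      e * (`|x - x0| + `|y - y0|).

Definition closed_form_on a b c d :=
  forall x y, a <= x <= b -> c <= y <= d -> closed_form_at x y.

Lemma affine_continuous (f : R -> R) (x0 A e del : R) : 0 < del ->
  (forall x, `|x - x0| < del -> `|f x - f x0 - A * (x - x0)| <= e * `|x - x0|) ->
  {for x0, continuous f}.
Proof.
move=> del0 fA; apply/cvgrPdist_le => /= eta eta0.
have K0 : 0 < `|A| + `|e| + 1 by rewrite ltr_wpDl// addr_ge0.
apply/nbhs_ballP; exists (Num.min del (eta / (`|A| + `|e| + 1))).
  by rewrite /= lt_min del0 divr_gt0.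
move=> x; rewrite /ball/= lt_min distrC => /andP[xd xe].
rewrite distrC.
have -> : f x - f x0 = (f x - f x0 - A * (x - x0)) + A * (x - x0) by ring.
apply: le_trans (ler_normD _ _) _; rewrite normrM.
have : `|x - x0| * (`|A| + `|e| + 1) <= eta.
  by rewrite -ler_pdivlMr// ltW.
have := ler_norm e; have := fA _ xd; have := normr_ge0 (x - x0).
move: `|x - x0| `|f x - f x0 - _| `|A| `|e| => X F A' E.
by nra.
Qed.

Lemma closed_form_continuous (x0 y0 : R) : closed_form_at x0 y0 ->
  [/\ {for x0, continuous (P^~ y0)} , {for x0, continuous (Q^~ y0)},
      {for y0, continuous (P x0)} & {for y0, continuous (Q x0)}].
Proof.
move=> [A [B [D H]]]; have [del del0 {}H] := H 1 ltr01.
have x0x0 : `|x0 - x0| < del by rewrite subrr normr0.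
have y0y0 : `|y0 - y0| < del by rewrite subrr normr0.
split.
- apply: (@affine_continuous _ _ A 1 del) => // x xd.
  have [+ _] := H x y0 xd y0y0.
  by rewrite subrr mulr0 normr0 addr0 subr0.
- apply: (@affine_continuous _ _ B 1 del) => // x xd.
  have [_] := H x y0 xd y0y0.
  by rewrite subrr mulr0 normr0 addr0 subr0.
- apply: (@affine_continuous _ _ B 1 del) => // y yd.
  have [+ _] := H x0 y x0x0 yd.
  by rewrite subrr mulr0 normr0 add0r subr0.
- apply: (@affine_continuous _ _ D 1 del) => // y yd.
  have [_] := H x0 y x0x0 yd.
  by rewrite subrr mulr0 normr0 add0r subr0.
Qed.

(** P is integrated along horizontal sides only and Q along vertical ones, hence continuity in one
    variable each. *)
Definition continuous_along a b c d :=
  forall x y, a <= x <= b -> c <= y <= d ->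
  {for x, continuous (P^~ y)} /\ {for y, continuous (Q x)}.

Lemma closed_form_on_along a b c d :
  closed_form_on a b c d -> continuous_along a b c d.
Proof.
by move=> H x y xab ycd; have [] := closed_form_continuous (H _ _ xab ycd).
Qed.

Lemma rect_integral_splitx a m b c d : a <= m -> m <= b -> c <= d ->
  continuous_on (P^~ c) a b -> continuous_on (P^~ d) a b ->
  continuous_on (Q a) c d -> continuous_on (Q m) c d -> continuous_on (Q b) c d ->
  rect_integral a b c d = rect_integral a m c d + rect_integral m b c d.
Proof.
move=> am mb cd cP dP aQ mQ bQ; rewrite /rect_integral.
rewrite (Rintegral_split am mb); last exact: continuous_onB.
rewrite (_ : \int[mu]_(y in `[c, d]) (Q b y - Q a y) =
  \int[mu]_(y in `[c, d]) (Q m y - Q a y) +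
  \int[mu]_(y in `[c, d]) (Q b y - Q m y)); first by ring.
by rewrite !RintegralB//; try exact: continuous_on_integrable; ring.
Qed.

Lemma rect_integral_splity a b c m d : c <= m -> m <= d -> a <= b ->
  continuous_on (Q a) c d -> continuous_on (Q b) c d ->
  continuous_on (P^~ c) a b -> continuous_on (P^~ m) a b ->
  continuous_on (P^~ d) a b ->
  rect_integral a b c d = rect_integral a b c m + rect_integral a b m d.
Proof.
move=> cm md ab aQ bQ cP mP dP; rewrite /rect_integral.
rewrite (Rintegral_split cm md); last exact: continuous_onB.
rewrite (_ : \int[mu]_(x in `[a, b]) (P x c - P x d) =
  \int[mu]_(x in `[a, b]) (P x c - P x m) +
  \int[mu]_(x in `[a, b]) (P x m - P x d)); first by ring.
by rewrite !RintegralB//; try exact: continuous_on_integrable; ring.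
Qed.

Lemma rect_integral_le a b c d M : a <= b -> c <= d ->
  continuous_on (P^~ c) a b -> continuous_on (P^~ d) a b ->
  continuous_on (Q a) c d -> continuous_on (Q b) c d ->
  (forall x y, a <= x <= b -> c <= y <= d ->
    x = a \/ x = b \/ y = c \/ y = d -> `|P x y| <= M /\ `|Q x y| <= M) ->
  `|rect_integral a b c d| <= 2 * M * ((b - a) + (d - c)).
Proof.
move=> ab cd cP dP aQ bQ H; rewrite /rect_integral mulrDr.
have aab : a <= a <= b by rewrite lexx ab.
have bab : a <= b <= b by rewrite lexx ab.
have ccd : c <= c <= d by rewrite lexx cd.
have dcd : c <= d <= d by rewrite lexx cd.
apply: le_trans (ler_normD _ _) _; apply: lerD.
  apply: Rintegral_norm_le => //; first exact: continuous_onB.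
  move=> x xab; apply: le_trans (ler_normB _ _) _.
  have [+ _] := H x c xab ccd (or_intror (or_intror (or_introl erefl))).
  have [+ _] := H x d xab dcd (or_intror (or_intror (or_intror erefl))).
  by lra.
apply: Rintegral_norm_le => //; first exact: continuous_onB.
move=> y ycd; apply: le_trans (ler_normB _ _) _.
have [_ +] := H a y aab ycd (or_introl erefl).
have [_ +] := H b y bab ycd (or_intror (or_introl erefl)).
by lra.
Qed.

(** The affine parts contribute B (c - d) (b - a) from P and B (b - a) (d - c) from Q, which cancel
    because the form is closed; only the little-o remainders are left. *)
Lemma rect_integral_local (x0 y0 e : R) : closed_form_at x0 y0 -> 0 < e ->
  exists2 del : R, 0 < del & forall a b c d s,
    a <= x0 <= b -> c <= y0 <= d -> b - a <= s -> d - c <= s -> s < del ->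
    continuous_along a b c d ->
    `|rect_integral a b c d| <= e * s ^+ 2.
Proof.
move=> [A [B [D H]]] e0.
(* The factor 8 pays for two coordinates, two opposite sides and two pairs of sides. *)
have e80 : 0 < e / 8 by lra.
have [del del0 {}H] := H _ e80.
exists del => // a b c d s /andP[ax xb] /andP[cy yd] bas dcs sdel cont.
have ab : a <= b by lra.
have cd : c <= d by lra.
have s0 : 0 <= s by lra.
have aab : a <= a <= b by rewrite lexx ab.
have bab : a <= b <= b by rewrite lexx ab.
have ccd : c <= c <= d by rewrite lexx cd.
have dcd : c <= d <= d by rewrite lexx cd.
have nx x : a <= x <= b -> `|x - x0| <= s by rewrite ler_norml => ?; lra.
have ny y : c <= y <= d -> `|y - y0| <= s by rewrite ler_norml => ?; lra.
have Hs x y : a <= x <= b -> c <= y <= d ->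
    `|P x y - P x0 y0 - A * (x - x0) - B * (y - y0)| <= e / 4 * s /\
    `|Q x y - Q x0 y0 - B * (x - x0) - D * (y - y0)| <= e / 4 * s.
  move=> xab ycd.
  have nxs := nx _ xab; have nys := ny _ ycd.
  have [H1 H2] := H x y (le_lt_trans nxs sdel) (le_lt_trans nys sdel).
  have : e / 8 * (`|x - x0| + `|y - y0|) <= e / 4 * s by nra.
  by move=> H3; split; [exact: le_trans H3|exact: le_trans H3].
have I1 := @Rintegral_near_cst R (fun x => P x c - P x d) a b (B * (c - d))
  (e / 2 * s) ab.
have I2 := @Rintegral_near_cst R (fun y => Q b y - Q a y) c d (B * (b - a))
  (e / 2 * s) cd.
have {}I1 := I1 (continuous_onB (fun x xab => proj1 (cont x c xab ccd))
                               (fun x xab => proj1 (cont x d xab dcd))).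
have {}I2 := I2 (continuous_onB (fun y ycd => proj2 (cont b y bab ycd))
                               (fun y ycd => proj2 (cont a y aab ycd))).
rewrite /rect_integral.
set X := Rintegral _ _ _ in I1 *; set Y := Rintegral _ _ _ in I2 *.
have -> : X + Y = (X - B * (c - d) * (b - a)) + (Y - B * (b - a) * (d - c)) by ring.
apply: le_trans (ler_normD _ _) _.
have {}I1 : `|X - B * (c - d) * (b - a)| <= e / 2 * s * (b - a).
  apply: I1 => x xab.
  have [K1 _] := Hs x c xab ccd; have [K2 _] := Hs x d xab dcd.
  move: K1 K2; rewrite !ler_norml => /andP[? ?] /andP[? ?]; lra.
have {}I2 : `|Y - B * (b - a) * (d - c)| <= e / 2 * s * (d - c).
  apply: I2 => y ycd.
  have [_ K1] := Hs a y aab ycd; have [_ K2] := Hs b y bab ycd.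
  move: K1 K2; rewrite !ler_norml => /andP[? ?] /andP[? ?]; lra.
have es : 0 <= e / 2 * s by rewrite mulr_ge0// divr_ge0// ltW.
have := ler_wpM2l es bas; have := ler_wpM2l es dcs.
by move: I1 I2; rewrite expr2; lra.
Qed.

Lemma sub_closed_form a b c d (a' b' c' d' : R) : closed_form_on a b c d ->
  a <= a' -> b' <= b -> c <= c' -> d' <= d -> closed_form_on a' b' c' d'.
Proof.
move=> H aa bb cc dd x y /andP[ax xb] /andP[cy yd].
by apply: H; rewrite ?(le_trans aa)//= ?(le_trans xb)//= ?(le_trans cc)//=
   (le_trans yd).
Qed.

(* Goursat's bisection: a rectangle whose boundary integral is too large for
   its size contains a quarter with the same property. *)
Lemma goursat a b c d : a <= b -> c <= d -> closed_form_on a b c d ->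
  rect_integral a b c d = 0.
Proof.
move=> ab cd H; apply/eqP; rewrite -normr_eq0; apply/negPn/negP => J0.
set l := b - a; set k := d - c.
have l0 : 0 <= l by rewrite subr_ge0.
have k0 : 0 <= k by rewrite subr_ge0.
set e : R := `|rect_integral a b c d| in J0.
have e0 : 0 < e by rewrite lt0r J0 /e normr_ge0.
(* Only the lower left corner p varies: at stage n the sides have lengths l / 2^n and k / 2^n. *)
pose rectn n (p : R * R) := rect_integral p.1 (p.1 + l / 2 ^+ n) p.2 (p.2 + k / 2 ^+ n).
pose inr n (p : R * R) := [/\ a <= p.1, p.1 + l / 2 ^+ n <= b,
   c <= p.2 & p.2 + k / 2 ^+ n <= d].
pose bad n (p : R * R) := inr n p /\ e / 4 ^+ n <= `|rectn n p|.
pose nextto n (p q : R * R) := [/\ p.1 <= q.1,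
   q.1 + l / 2 ^+ n.+1 <= p.1 + l / 2 ^+ n, p.2 <= q.2 &
   q.2 + k / 2 ^+ n.+1 <= p.2 + k / 2 ^+ n].
(* The implication stands under the existential, so that [choice] gives a total function on stages
   and corners. *)
have step (np : nat * (R * R)) : exists q : R * R,
    bad np.1 np.2 -> bad np.1.+1 q /\ nextto np.1 np.2 q.
  case: np => n [x y]; rewrite /bad /inr /nextto /rectn /=.
  have lh : l / 2 ^+ n = l / 2 ^+ n.+1 + l / 2 ^+ n.+1.
    by rewrite exprS; field; rewrite expf_neq0.
  have kh : k / 2 ^+ n = k / 2 ^+ n.+1 + k / 2 ^+ n.+1.
    by rewrite exprS; field; rewrite expf_neq0.
  have e4 : e / 4 ^+ n = 4 * (e / 4 ^+ n.+1).
    by rewrite exprS; field; rewrite expf_neq0.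
  have l'0 : 0 <= l / 2 ^+ n.+1 by rewrite divr_ge0// exprn_ge0.
  have k'0 : 0 <= k / 2 ^+ n.+1 by rewrite divr_ge0// exprn_ge0.
  rewrite lh kh e4; move: l'0 k'0; move: (l / 2 ^+ n.+1) (k / 2 ^+ n.+1).
  move: (e / 4 ^+ n.+1) => e' l' k' l'0 k'0 {lh kh e4}.
  have [[[ax xb cy yd] badn]|nb] := pselect ([/\ a <= x, x + (l' + l') <= b,
    c <= y & y + (k' + k') <= d] /\
    4 * e' <= `|rect_integral x (x + (l' + l')) y (y + (k' + k'))|);
    last by exists (x, y).
  have Hc : continuous_along x (x + (l' + l')) y (y + (k' + k')).
    by apply: closed_form_on_along; apply: sub_closed_form H _ _ _ _.
  have cP (y' x1 x2 : R) : x <= x1 -> x2 <= x + (l' + l') ->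
      y <= y' <= y + (k' + k') -> continuous_on (P^~ y') x1 x2.
    move=> h1 h2 yy' u /andP[u1 u2].
    by have [] := Hc u y'; rewrite ?(le_trans h1)//= (le_trans u2).
  have cQ (x' y1 y2 : R) : y <= y1 -> y2 <= y + (k' + k') ->
      x <= x' <= x + (l' + l') -> continuous_on (Q x') y1 y2.
    move=> h1 h2 yy' u /andP[u1 u2].
    by have [] := Hc x' u; rewrite ?(le_trans h1)//= (le_trans u2).
  have := badn.
  rewrite (@rect_integral_splitx x (x + l')); last 8 first.
  - by (clear -l'0 k'0; lra).
  - by (clear -l'0 k'0; lra).
  - by (clear -l'0 k'0; lra).
  - by apply: cP => //; (clear -l'0 k'0; lra).
  - by apply: cP => //; (clear -l'0 k'0; lra).
  - by apply: cQ => //; (clear -l'0 k'0; lra).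
  - by apply: cQ => //; (clear -l'0 k'0; lra).
  - by apply: cQ => //; (clear -l'0 k'0; lra).
  rewrite (@rect_integral_splity x _ y (y + k')); last 8 first.
  - by (clear -l'0 k'0; lra).
  - by (clear -l'0 k'0; lra).
  - by (clear -l'0 k'0; lra).
  - by apply: cQ => //; (clear -l'0 k'0; lra).
  - by apply: cQ => //; (clear -l'0 k'0; lra).
  - by apply: cP => //; (clear -l'0 k'0; lra).
  - by apply: cP => //; (clear -l'0 k'0; lra).
  - by apply: cP => //; (clear -l'0 k'0; lra).
  rewrite (@rect_integral_splity (x + l') _ y (y + k')); last 8 first.
  - by (clear -l'0 k'0; lra).
  - by (clear -l'0 k'0; lra).
  - by (clear -l'0 k'0; lra).
  - by apply: cQ => //; (clear -l'0 k'0; lra).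
  - by apply: cQ => //; (clear -l'0 k'0; lra).
  - by apply: cP => //; (clear -l'0 k'0; lra).
  - by apply: cP => //; (clear -l'0 k'0; lra).
  - by apply: cP => //; (clear -l'0 k'0; lra).
  have assoc (u w : R) : u + (w + w) = u + w + w by rewrite addrA.
  rewrite !assoc => big.
  have [b1|b1] := leP e' `|rect_integral x (x + l') y (y + k')|.
    by exists (x, y) => _; split; [split; [split => /=; clear -l'0 k'0 ax xb cy yd; lra|by []]|split => /=; clear -l'0 k'0; lra].
  have [b2|b2] := leP e' `|rect_integral x (x + l') (y + k') (y + k' + k')|.
    by exists (x, y + k') => _; split; [split; [split => /=; clear -l'0 k'0 ax xb cy yd; lra|by []]|split => /=; clear -l'0 k'0; lra].
  have [b3|b3] := leP e' `|rect_integral (x + l') (x + l' + l') y (y + k')|.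
    by exists (x + l', y) => _; split; [split; [split => /=; clear -l'0 k'0 ax xb cy yd; lra|by []]|split => /=; clear -l'0 k'0; lra].
  have [b4|b4] := leP e' `|rect_integral (x + l') (x + l' + l') (y + k') (y + k' + k')|.
    by exists (x + l', y + k') => _; split; [split; [split => /=; clear -l'0 k'0 ax xb cy yd; lra|by []]|split => /=; clear -l'0 k'0; lra].
  exfalso; move: big; apply/negP; rewrite -ltNge.
  apply: le_lt_trans (ler_normD _ _) _.
  have := ler_normD (rect_integral x (x + l') y (y + k'))
            (rect_integral x (x + l') (y + k') (y + k' + k')).
  have := ler_normD (rect_integral (x + l') (x + l' + l') y (y + k'))
            (rect_integral (x + l') (x + l' + l') (y + k') (y + k' + k')).
  by move=> s1 s2; clear -s1 s2 b1 b2 b3 b4; lra.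
have [F HF] := choice step.
pose p := fix p n := if n is n'.+1 then F (n', p n') else (a, c).
have badp n : bad n (p n).
  elim: n => [|n IH]; last by have [] := HF (n, p n) IH.
  split; first by split; rewrite /= ?expr0 ?divr1 /l /k ?lexx//; lra.
  rewrite /rectn/= !expr0 !divr1 /l /k /e.
  by have -> : a + (b - a) = b; [ring|have -> : c + (d - c) = d; [ring|]].
have nextp n : nextto n (p n) (p n.+1) by have [] := HF (n, p n) (badp n).
have lw n : 0 <= l / 2 ^+ n by rewrite divr_ge0// exprn_ge0.
have kw n : 0 <= k / 2 ^+ n by rewrite divr_ge0// exprn_ge0.
have [x0 Hx0] : exists x, forall n, (p n).1 <= x <= (p n).1 + l / 2 ^+ n.
  apply: nested_intervals => n; try by have [] := nextp n.
  by rewrite lerDl.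
have [y0 Hy0] : exists y, forall n, (p n).2 <= y <= (p n).2 + k / 2 ^+ n.
  apply: nested_intervals => n; try by have [] := nextp n.
  by rewrite lerDl.
have Hxy : closed_form_at x0 y0.
  have := Hx0 0%N; have := Hy0 0%N; rewrite /= !expr0 !divr1 /l /k => hy hx.
  by apply: H; lra.
(* The summand 1 keeps s positive for a degenerate rectangle. With e / s^2 / 2 the local estimate at
   side s / 2^n is e / 4^n / 2, half of what [bad] demands. *)
pose s := l + k + 1.
have s0 : 0 < s by rewrite /s; lra.
have es : 0 < e / s ^+ 2 / 2 by rewrite !divr_gt0// exprn_gt0.
have [del del0 Hdel] := rect_integral_local Hxy es.
have [n nsmall] := div_expr2_small s del0.
have [[/= pa pb pc pd] bn] := badp n.
have e2 : 0 < (2 : R) ^+ n by rewrite exprn_gt0.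
have := Hdel (p n).1 ((p n).1 + l / 2 ^+ n) (p n).2 ((p n).2 + k / 2 ^+ n) (s / 2 ^+ n)
  (Hx0 n) (Hy0 n).
have -> (u w : R) : u + w - u = w by ring.
rewrite !ler_pdivrMr// !mulfVK ?gt_eqF//.
have -> (u w : R) : u + w - u = w by ring.
rewrite !ler_pdivrMr// !mulfVK ?gt_eqF//.
have ls : l <= s by rewrite /s; lra.
have ks : k <= s by rewrite /s; lra.
move=> /(_ ls ks nsmall).
have Hc : closed_form_on (p n).1 ((p n).1 + l / 2 ^+ n) (p n).2 ((p n).2 + k / 2 ^+ n).
  exact: sub_closed_form H _ _ _ _.
move=> /(_ (closed_form_on_along Hc)) small.
have := le_trans bn small.
have -> : e / s ^+ 2 / 2 * (s / 2 ^+ n) ^+ 2 = e / 4 ^+ n / 2.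
  have -> : (4 : R) ^+ n = (2 ^+ n) ^+ 2 by rewrite expr2 -exprMn; congr (_ ^+ n); ring.
  by field; rewrite !gt_eqF.
have : 0 < e / 4 ^+ n by rewrite divr_gt0// exprn_gt0.
by lra.
Qed.

(** A square of half side eta about the puncture is cut out. The four surrounding rectangles
    contribute nothing by Goursat, and the square contributes O(eta) because the form is bounded
    near the puncture. *)
Lemma goursat_punctured a b c d p q M (eta0 : R) : a < p -> p < b -> c < q -> q < d ->
  (forall x y, a <= x <= b -> c <= y <= d -> (x, y) <> (p, q) ->
    closed_form_at x y) ->
  0 < eta0 -> (forall x y, `|x - p| <= eta0 -> `|y - q| <= eta0 ->
    (x, y) <> (p, q) -> `|P x y| <= M /\ `|Q x y| <= M) ->
  rect_integral a b c d = 0.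
Proof.
move=> ap pb cq qd H eta0_gt0 HM.
apply/eqP; rewrite -normr_eq0; apply/eqP/le_anti; rewrite normr_ge0 andbT.
apply/ler_addgt0Pr => /= e; rewrite add0r => e0.
have M0 : 0 <= M.
  have [|||+ _] := HM (p + eta0) q.
  - by rewrite [p + _]addrC addrK gtr0_norm.
  - by rewrite subrr normr0 ltW.
  - by move=> [] h; lra.
  - exact: le_trans.
(* The square has sides 2 eta, so [rect_integral_le] bounds its integral by 8 eta M. *)
pose eta := Num.min (Num.min eta0 (Num.min (p - a) (b - p)))
              (Num.min (Num.min (q - c) (d - q)) (e / (8 * (M + 1)))).
have eta_gt0 : 0 < eta by rewrite !lt_min !subr_gt0 ap pb cq qd eta0_gt0 divr_gt0//; lra.
have : eta <= eta by [].
rewrite {2}/eta !le_min => /andP[/andP[h1 /andP[h2 h3]] /andP[/andP[h4 h5] h6]].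
have {}h6 : 8 * eta * M <= e.
  by move: h6; rewrite ler_pdivlMr; nra.
move: eta eta_gt0 h1 h2 h3 h4 h5 h6 => eta eta_gt0 h1 h2 h3 h4 h5 h6.
have cP (y' x1 x2 : R) : a <= x1 -> x2 <= b -> c <= y' <= d -> y' <> q ->
    continuous_on (P^~ y') x1 x2.
  move=> ? ? ? yq u ?.
  by have [] := @closed_form_continuous u y'; [apply: H => //; [lra|case]|].
have cQ (x' y1 y2 : R) : c <= y1 -> y2 <= d -> a <= x' <= b -> x' <> p ->
    continuous_on (Q x') y1 y2.
  move=> ? ? ? xp u ?.
  by have [] := @closed_form_continuous x' u; [apply: H => //; [lra|case]|].
have G (a' b' c' d' : R) : a <= a' -> a' <= b' -> b' <= b -> c <= c' -> c' <= d' ->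
    d' <= d -> ~ (a' <= p <= b' /\ c' <= q <= d') -> rect_integral a' b' c' d' = 0.
  move=> ? ? ? ? ? ? np; apply: goursat => // x y xab ycd.
  by apply: H; [lra|lra|move=> [xp yq]; apply: np; rewrite -xp -yq].
rewrite (@rect_integral_splitx a (p - eta)); first last.
1-5: by (apply: cP || apply: cQ); clear -ap pb cq qd eta_gt0 h2 h3 h4 h5; lra.
1-3: by clear -ap pb cq qd eta_gt0 h2 h3 h4 h5; lra.
rewrite (@rect_integral_splitx (p - eta) (p + eta)); first last.
1-5: by (apply: cP || apply: cQ); clear -ap pb cq qd eta_gt0 h2 h3 h4 h5; lra.
1-3: by clear -ap pb cq qd eta_gt0 h2 h3 h4 h5; lra.
rewrite (@rect_integral_splity (p - eta) (p + eta) c (q - eta)); first last.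
1-5: by (apply: cP || apply: cQ); clear -ap pb cq qd eta_gt0 h2 h3 h4 h5; lra.
1-3: by clear -ap pb cq qd eta_gt0 h2 h3 h4 h5; lra.
rewrite (@rect_integral_splity (p - eta) (p + eta) (q - eta) (q + eta)); first last.
1-5: by (apply: cP || apply: cQ); clear -ap pb cq qd eta_gt0 h2 h3 h4 h5; lra.
1-3: by clear -ap pb cq qd eta_gt0 h2 h3 h4 h5; lra.
rewrite (G a (p - eta) c d); try by clear -ap pb cq qd eta_gt0 h2 h3 h4 h5; lra.
rewrite (G (p + eta) b c d); try by clear -ap pb cq qd eta_gt0 h2 h3 h4 h5; lra.
rewrite (G (p - eta) (p + eta) c (q - eta)); try by clear -ap pb cq qd eta_gt0 h2 h3 h4 h5; lra.
rewrite (G (p - eta) (p + eta) (q + eta) d); try by clear -ap pb cq qd eta_gt0 h2 h3 h4 h5; lra.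
rewrite !(add0r, addr0).
apply: le_trans (rect_integral_le (M := M) _ _ _ _ _ _ _) _.
1-2: by clear -ap pb cq qd eta_gt0 h2 h3 h4 h5; lra.
1-4: by (apply: cP || apply: cQ); clear -ap pb cq qd eta_gt0 h2 h3 h4 h5; lra.
- move=> x y xpe yqe bd.
  have xp : `|x - p| <= eta0 by rewrite ler_norml; clear -xpe h1; lra.
  have yq : `|y - q| <= eta0 by rewrite ler_norml; clear -yqe h1; lra.
  by apply: HM => // -[xE yE]; case: bd => [|[|[|]]] E; move: E; rewrite ?xE ?yE => E;
    clear -E eta_gt0; lra.
- by lra.
Qed.

End goursat.

(** * Cauchy's formula and Taylor coefficients *)

Section polar.
Variable R : realType.
Implicit Types (x y k l e t : R) (z w d : R[i]).

(** The complex exponential exp(x + i y). *)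
Definition polar x y : R[i] := (expR x * cos y) +i* (expR x * sin y).

Lemma ReM z w : complex.Re (z * w) =
  complex.Re z * complex.Re w - complex.Im z * complex.Im w.
Proof. by case: z => a b; case: w => c e. Qed.

Lemma ImM z w : complex.Im (z * w) =
  complex.Re z * complex.Im w + complex.Im z * complex.Re w.
Proof. by case: z => a b; case: w => c e. Qed.

Lemma ReB z w : complex.Re (z - w) = complex.Re z - complex.Re w.
Proof. by case: z => a b; case: w => c e. Qed.

Lemma ImB z w : complex.Im (z - w) = complex.Im z - complex.Im w.
Proof. by case: z => a b; case: w => c e. Qed.

Lemma polarD x y k l : polar (x + k) (y + l) = polar x y * polar k l.
Proof.
apply/eqP; rewrite eq_complex ReM ImM /= expRD cosD sinD.
by apply/andP; split; apply/eqP; ring.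
Qed.

Lemma modulus_polar x y : modulus (polar x y) = expR x.
Proof.
apply/eqP; rewrite -(@eqrXn2 _ 2)// ?modulus_ge0 ?expR_ge0//.
by rewrite modulus_sqr/= !exprMn -mulrDr cos2Dsin2 mulr1.
Qed.

Lemma polar_neq0 x y : polar x y != 0.
Proof. by rewrite -modulus_gt0 modulus_polar expR_gt0. Qed.

Lemma polarNpi x : polar x (- pi) = polar x pi.
Proof. by rewrite /polar cosN sinN sinpi oppr0. Qed.

Lemma is_derive_linear (f : R -> R) (x d : R) : is_derive x 1 f d ->
  forall e, 0 < e -> exists2 del : R, 0 < del & forall k, `|k| < del ->
    `|f (x + k) - f x - d * k| <= e * `|k|.
Proof.
move=> [fx fd] e e0.
have : (fun h : R => h^-1 *: (f (h + x) - f x)) @ 0^' --> d.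
  have -> : (fun h : R => h^-1 *: (f (h + x) - f x)) =
      (fun h => h^-1 *: ((f \o shift x) (h *: (1 : R)) - f x)).
    by apply/funext => h; rewrite /= /shift/= [_ *: 1]mulr1.
  by rewrite -fd; exact: fx.
move=> /cvgrPdist_le/(_ _ e0)/nbhs_ballP[del /= del0 H].
exists del => // k kdel; have [->|k0] := eqVneq k 0.
  by rewrite addr0 subrr mulr0 subrr normr0 mulr0.
have := H k; rewrite /ball/= sub0r normrN => /(_ kdel k0).
rewrite -(@ler_pM2r _ `|k|) ?normr_gt0// -normrM distrC mulrBl.
by rewrite /GRing.scale/= mulrAC mulVf// mul1r [k + x]addrC.
Qed.

Lemma polar_linear e : 0 < e -> exists2 del : R, 0 < del & forall k l : R,
  `|k| < del -> `|l| < del ->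
  modulus (polar k l - 1 - (k +i* l)) <= e * (`|k| + `|l|).
Proof.
move=> e0; pose e1 := Num.min 1 (e / 8).
have e10 : 0 < e1 by rewrite lt_min ltr01 divr_gt0.
have e11 : e1 <= 1 by rewrite ge_min lexx.
have e18 : 8 * e1 <= e.
  by rewrite mulrC -ler_pdivlMr// ge_min lexx orbT.
move: e1 e10 e11 e18 => e1 e10 e11 e18.
have [d1 d10 H1] := is_derive_linear (is_derive_expR (0 : R)) e10.
have [d2 d20 H2] := is_derive_linear (is_derive_cos (0 : R)) e10.
have [d3 d30 H3] := is_derive_linear (is_derive_sin (0 : R)) e10.
exists (Num.min (Num.min d1 d2) (Num.min d3 e1)); first by rewrite !lt_min d10 d20 d30 e10.
move=> k l; rewrite !lt_min => /andP[/andP[kd1 kd2] /andP[kd3 ke1]].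
move=> /andP[/andP[ld1 ld2] /andP[ld3 le1]].
have := H1 k kd1; have := H2 l ld2; have := H3 l ld3.
rewrite !add0r expR0 cos0 sin0 oppr0 mul0r !subr0 !mul1r => h3 h2 h1.
apply: le_trans (modulus_le_ReIm _) _; rewrite /polar/= subr0.
rewrite addr0 in h3.
set E := expR k in h1 *; set c := cos l in h2 *; set s := sin l in h3 *.
have c1 : `|c| <= 1 by rewrite /c cos_max.
have a1 : `|E * c - 1 - k| <= e1 * `|k| + 2 * e1 * `|l|.
  have -> : E * c - 1 - k = (E - 1 - k) * c + (1 + k) * (c - 1) by ring.
  apply: le_trans (ler_normD _ _) _; rewrite !normrM; apply: lerD.
    by rewrite (le_trans _ h1)// ler_piMr.
  apply: (@le_trans _ _ (2 * `|c - 1|)); last by rewrite -mulrA ler_wpM2l.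
  apply: ler_wpM2r => //; apply: le_trans (ler_normD _ _) _; rewrite normr1.
  by move: ke1 e11; clear; lra.
have a2 : `|E * s - l| <= 6 * e1 * `|l|.
  have -> : E * s - l = E * (s - l) + (E - 1) * l by ring.
  apply: le_trans (ler_normD _ _) _; rewrite !normrM.
  have E1 : `|E - 1| <= 2 * `|k|.
    have -> : E - 1 = (E - 1 - k) + k by ring.
    apply: le_trans (ler_normD _ _) _; have := normr_ge0 k.
    by move: h1 e11; move: `|k| => K; clear; nra.
  have E3 : `|E| <= 3.
    have -> : E = (E - 1) + 1 by ring.
    apply: le_trans (ler_normD _ _) _; rewrite normr1.
    by move: E1 ke1 e11; clear; lra.
  apply: (@le_trans _ _ (3 * (e1 * `|l|) + 2 * e1 * `|l|)).
    apply: lerD; first by apply: ler_pM.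
    by apply: ler_wpM2r => //; apply: le_trans E1 _; rewrite ler_wpM2l// ltW.
  have : 0 <= e1 * `|l| by rewrite mulr_ge0// ltW.
  by move: (e1 * `|l|) (mulrA 2 e1 `|l|) (mulrA 6 e1 `|l|) => X <- <-; clear; lra.
apply: le_trans (lerD a1 a2) _.
have := ler_wpM2r (normr_ge0 k) e18; have := ler_wpM2r (normr_ge0 l) e18.
have : 0 <= e1 * `|k| by rewrite mulr_ge0// ltW.
by clear; lra.
Qed.

Lemma cderiv_polar (f : R[i] -> R[i]) x0 y0 d : cderiv f (polar x0 y0) d ->
  forall e : R, 0 < e -> exists2 del : R, 0 < del & forall x y,
    `|x - x0| < del -> `|y - y0| < del ->
    modulus (f (polar x y) - f (polar x0 y0) -
       d * polar x0 y0 * ((x - x0) +i* (y - y0))) <= e * (`|x - x0| + `|y - y0|).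
Proof.
move=> H e e0; set E := polar x0 y0 in H *.
have E0 : 0 < modulus E by rewrite modulus_polar expR_gt0.
have [|del1 del10 {}H] := H (e / (4 * modulus E)).
  by rewrite divr_gt0// mulr_gt0.
pose e2 := Num.min 1 (e / (2 * (modulus d * modulus E + 1))).
have dE0 : 0 <= modulus d * modulus E by rewrite mulr_ge0// modulus_ge0.
have e20 : 0 < e2 by rewrite lt_min ltr01 divr_gt0// mulr_gt0// ltr_wpDl.
have [del2 del20 H2] := polar_linear e20.
exists (Num.min del2 (del1 / (4 * modulus E))).
  by rewrite lt_min del20 divr_gt0// mulr_gt0.
move=> x y; rewrite !lt_min => /andP[x2 x1] /andP[y2 y1].
have := H2 _ _ x2 y2.
have -> : polar x y = E * polar (x - x0) (y - y0).
  by rewrite -polarD !subrKC.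
set kap := (x - x0) +i* (y - y0); set W := polar (x - x0) (y - y0).
have kapS : modulus kap <= `|x - x0| + `|y - y0| by exact: modulus_le_ReIm.
move: kapS; set S := `|x - x0| + `|y - y0| => kapS Wk.
have S0 : 0 <= S by rewrite addr_ge0.
have SE : 4 * (modulus E * S) < 2 * del1.
  by move: x1 y1; rewrite !ltr_pdivlMr ?mulr_gt0// /S; clear; lra.
have WS : modulus (E * (W - 1)) <= 2 * (modulus E * S).
  rewrite modulusM [leRHS]mulrCA ler_wpM2l ?modulus_ge0//.
  have -> : W - 1 = (W - 1 - kap) + kap by ring.
  apply: le_trans (modulusD _ _) _.
  have e21 : e2 <= 1 by rewrite ge_min lexx.
  by have := ler_wpM2r S0 e21; move: Wk kapS; clear; lra.
have -> : E * W = E + E * (W - 1) by ring.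
have WSd : modulus (E * (W - 1)) < del1.
  by move: WS SE; clear; lra.
have := H _ WSd => {}H.
have -> : f (E + E * (W - 1)) - f E - d * E * kap =
  (f (E + E * (W - 1)) - f E - d * (E * (W - 1))) + d * E * (W - 1 - kap).
  by move: (f (E + E * (W - 1))) (f E) => A B; ring.
apply: le_trans (modulusD _ _) _; rewrite !(modulusM (d * E)) (modulusM d E).
have b1 : modulus (f (E + E * (W - 1)) - f E - d * (E * (W - 1))) <= e / 2 * S.
  apply: le_trans H _.
  have h : 0 <= e / (4 * modulus E) by rewrite ltW// divr_gt0// mulr_gt0.
  apply: le_trans (ler_wpM2l h WS) _.
  by rewrite le_eqVlt; apply/orP; left; apply/eqP; field; rewrite gt_eqF.
have b2 : modulus d * modulus E * modulus (W - 1 - kap) <= e / 2 * S.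
  apply: (@le_trans _ _ ((modulus d * modulus E) * e2 * S)).
    by rewrite -[leRHS]mulrA ler_wpM2l.
  apply: ler_wpM2r => //.
  have h : e2 <= e / (2 * (modulus d * modulus E + 1)).
    by rewrite ge_min lexx orbT.
  apply: le_trans (ler_wpM2l dE0 h) _.
  rewrite mulrA ler_pdivrMr; last by rewrite mulr_gt0// ltr_wpDl.
  have : 0 <= e by exact: ltW.
  move: (modulus d * modulus E) dE0 => X X0 ee.
  by have := mulr_ge0 ee X0; move: ee; clear; lra.
by apply: le_trans (lerD b1 b2) _; clear; lra.
Qed.

(** With w = x + i y, the form is the imaginary part of f(exp w) dw, and in [closed_form_ReImN] it
    is minus the real part. Complex differentiability of f(exp w) gives the Cauchy-Riemann
    equations, that is, closedness. *)
Lemma closed_form_ReIm (f : R[i] -> R[i]) x0 y0 :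
  cdiff f (polar x0 y0) ->
  closed_form_at (fun x y => complex.Im (f (polar x y)))
                 (fun x y => complex.Re (f (polar x y))) x0 y0.
Proof.
move=> [d /cderiv_polar]; set c : R[i] := d * _; move: c => c H.
exists (complex.Im c), (complex.Re c), (- complex.Im c) => e e0.
have [del del0 {}H] := H _ e0.
exists del => // x y xd yd; have := H _ _ xd yd => {}H.
move: H; set S := `|x - x0| + _ => H.
split.
  apply: le_trans (le_trans (Im_le_modulus _) H).
  rewrite ?ReB ?ImB le_eqVlt; apply/orP; left; apply/eqP; congr `| _ |.
  by rewrite ?ReM ?ImM/=; ring.
apply: le_trans (le_trans (Re_le_modulus _) H).
rewrite ?ReB ?ImB le_eqVlt; apply/orP; left; apply/eqP; congr `| _ |.
by rewrite ?ReM ?ImM/=; ring.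
Qed.

Lemma closed_form_ReImN (f : R[i] -> R[i]) x0 y0 :
  cdiff f (polar x0 y0) ->
  closed_form_at (fun x y => - complex.Re (f (polar x y)))
                 (fun x y => complex.Im (f (polar x y))) x0 y0.
Proof.
move=> [d /cderiv_polar]; set c : R[i] := d * _; move: c => c H.
exists (- complex.Re c), (complex.Im c), (complex.Re c) => e e0.
have [del del0 {}H] := H _ e0.
exists del => // x y xd yd; have := H _ _ xd yd => {}H.
move: H; set S := `|x - x0| + _ => H.
split.
  apply: le_trans (le_trans (Re_le_modulus _) H).
  rewrite -normrN ?ReB ?ImB le_eqVlt; apply/orP; left; apply/eqP; congr `| _ |.
  by rewrite ?ReM ?ImM/=; ring.
apply: le_trans (le_trans (Im_le_modulus _) H).
rewrite ?ReB ?ImB le_eqVlt; apply/orP; left; apply/eqP; congr `| _ |.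
by rewrite ?ReM ?ImM/=; ring.
Qed.

Lemma cdiff_polar_continuous (f : R[i] -> R[i]) x y :
  cdiff f (polar x y) ->
  {for y, continuous (fun t => complex.Re (f (polar x t)))} /\
  {for y, continuous (fun t => complex.Im (f (polar x t)))}.
Proof.
move=> fd; have [_ _ ? ?] := closed_form_continuous (closed_form_ReIm fd).
by split.
Qed.

End polar.

(** * Circle integrals and their independence of the radius *)

Section circle_integral.
Variable R : realType.
Notation mu := (@lebesgue_measure R).
Implicit Types (x y a b p q M : R) (f g : R[i] -> R[i]) (z c : R[i]).

(** The integral of f(w) dw / (i w) over the circle of radius exp(x): the measure is the angle, so
    Cauchy kernels below carry an extra factor w. *)
Definition circle_int f x : R[i] :=
  (\int[mu]_(y in `[- pi, pi]) complex.Re (f (polar x y))) +i*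
  (\int[mu]_(y in `[- pi, pi]) complex.Im (f (polar x y))).

Definition cdiff_circle f x := forall y, cdiff f (polar x y).

Let Npi_le : - pi <= pi :> R.
Proof. by rewrite (@le_trans _ _ 0) ?oppr_le0 ?pi_ge0. Qed.

Let integrableRe f x : cdiff_circle f x ->
  mu.-integrable `[- pi, pi] (EFin \o (fun y => complex.Re (f (polar x y)))).
Proof.
move=> fd; apply: continuous_on_integrable => y _.
by have [] := cdiff_polar_continuous (fd y).
Qed.

Let integrableIm f x : cdiff_circle f x ->
  mu.-integrable `[- pi, pi] (EFin \o (fun y => complex.Im (f (polar x y)))).
Proof.
move=> fd; apply: continuous_on_integrable => y _.
by have [] := cdiff_polar_continuous (fd y).
Qed.

Lemma circle_intD f g x : cdiff_circle f x -> cdiff_circle g x ->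
  circle_int (fun z => f z + g z) x = circle_int f x + circle_int g x.
Proof.
move=> fd gd; rewrite /circle_int [RHS]/GRing.add/=.
rewrite -RintegralD//; [|exact: integrableRe|exact: integrableRe].
rewrite -RintegralD//; [|exact: integrableIm|exact: integrableIm].
by congr (_ +i* _); apply: eq_Rintegral => y _; rewrite raddfD.
Qed.

Lemma circle_intZ f x c : cdiff_circle f x ->
  circle_int (fun z => c * f z) x = c * circle_int f x.
Proof.
move=> fd; rewrite /circle_int; case: c => cr ci; rewrite [RHS]/GRing.mul/=.
rewrite -!RintegralZl//; [|exact: integrableRe|exact: integrableIm|
  exact: integrableIm|exact: integrableRe].
have iZ (k : R) (F : R -> R) : mu.-integrable `[- pi, pi] (EFin \o F) ->
    mu.-integrable `[- pi, pi] (EFin \o (fun y => k * F y)).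
  move=> iF; rewrite (_ : _ \o _ = (fun y => k%:E * (EFin \o F) y)%E)//.
  exact: integrableZl.
rewrite -RintegralB//; [|exact/iZ/integrableRe|exact/iZ/integrableIm].
rewrite -RintegralD//; [|exact/iZ/integrableIm|exact/iZ/integrableRe].
by congr (_ +i* _); apply: eq_Rintegral => y _; rewrite ?ReM ?ImM.
Qed.

Lemma eq_circle_int f g x : (forall y, f (polar x y) = g (polar x y)) ->
  circle_int f x = circle_int g x.
Proof. by move=> fg; congr (_ +i* _); apply: eq_Rintegral => y _; rewrite fg. Qed.

Lemma circle_int_sum (n : nat) (F : nat -> R[i] -> R[i]) x :
  (forall k, (k < n)%N -> cdiff_circle (F k) x) ->
  circle_int (fun z => \sum_(k < n) F k z) x = \sum_(k < n) circle_int (F k) x /\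
  cdiff_circle (fun z => \sum_(k < n) F k z) x.
Proof.
elim: n => [|n IH] Fd.
  split.
    rewrite big_ord0 /circle_int; under eq_Rintegral do rewrite big_ord0.
    rewrite [X in _ +i* X](_ : _ = 0).
      by rewrite Rintegral_cst//= mul0r.
    under eq_Rintegral do rewrite big_ord0.
    by rewrite Rintegral_cst//= mul0r.
  by move=> y; under eq_fun do rewrite big_ord0; exact: cdiff_cst.
have [|IH1 IH2] := IH; first by move=> k kn; apply: Fd; rewrite ltnS ltnW.
split; last first.
  move=> y; under eq_fun do rewrite big_ord_recr/=.
  by apply: cdiffD; [exact: IH2|exact: Fd].
rewrite big_ord_recr/= -IH1 -(circle_intD IH2 (Fd n (ltnSn n))).
by apply: eq_circle_int => y; rewrite big_ord_recr.
Qed.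

Lemma circle_int_le f x M : cdiff_circle f x ->
  (forall y, modulus (f (polar x y)) <= M) ->
  modulus (circle_int f x) <= 4 * pi * M.
Proof.
move=> fd fM; apply: le_trans (modulus_le_ReIm _) _ => /=.
have hR : `|\int[mu]_(y in `[- pi, pi]) complex.Re (f (polar x y))| <= M * (pi - - pi).
  apply: Rintegral_norm_le => // y _.
    by have [] := cdiff_polar_continuous (fd y).
  exact: le_trans (Re_le_modulus _) _.
have hI : `|\int[mu]_(y in `[- pi, pi]) complex.Im (f (polar x y))| <= M * (pi - - pi).
  apply: Rintegral_norm_le => // y _.
    by have [] := cdiff_polar_continuous (fd y).
  exact: le_trans (Im_le_modulus _) _.
by apply: le_trans (lerD hR hI) _; rewrite opprK; lra.
Qed.

(** The horizontal sides y = - pi and y = pi cancel by periodicity, so a vanishing boundary integral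
    equates the two vertical sides. *)
Let circle_int_rect f a b : a <= b -> cdiff_circle f a -> cdiff_circle f b ->
  rect_integral (fun x y => complex.Im (f (polar x y)))
                (fun x y => complex.Re (f (polar x y))) a b (- pi) pi = 0 ->
  rect_integral (fun x y => - complex.Re (f (polar x y)))
                (fun x y => complex.Im (f (polar x y))) a b (- pi) pi = 0 ->
  circle_int f a = circle_int f b.
Proof.
move=> ab fa fb; rewrite /rect_integral.
have I0 (F : R -> R) : (forall x, F x = 0) -> \int[mu]_(x in `[a, b]) F x = 0.
  by move=> F0; under eq_Rintegral do rewrite F0; rewrite Rintegral_cst//= mul0r.
rewrite I0; last by move=> x; rewrite polarNpi subrr.
rewrite [X in _ -> X + _ = 0 -> _]I0; last by move=> x; rewrite polarNpi subrr.
rewrite !add0r !RintegralB//;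
  [|exact: integrableIm|exact: integrableIm|exact: integrableRe|exact: integrableRe].
by move=> /eqP; rewrite subr_eq0 => /eqP hR /eqP; rewrite subr_eq0 => /eqP hI;
  rewrite /circle_int hR hI.
Qed.

Lemma circle_int_const f a b : a <= b ->
  (forall x y, a <= x <= b -> cdiff f (polar x y)) ->
  circle_int f a = circle_int f b.
Proof.
move=> ab fd.
have fa : cdiff_circle f a by move=> y; apply: fd; rewrite lexx ab.
have fb : cdiff_circle f b by move=> y; apply: fd; rewrite lexx ab.
apply: circle_int_rect => //; apply: goursat => // x y xab _.
  exact/closed_form_ReIm/fd.
exact/closed_form_ReImN/fd.
Qed.

Lemma circle_int_const_punctured f a b p q M del : a < p -> p < b ->
  - pi < q -> q < pi ->
  (forall x y, a <= x <= b -> - pi <= y <= pi -> (x, y) <> (p, q) ->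
     cdiff f (polar x y)) ->
  cdiff_circle f a -> cdiff_circle f b ->
  0 < del -> (forall x y, `|x - p| <= del -> `|y - q| <= del ->
    (x, y) <> (p, q) -> modulus (f (polar x y)) <= M) ->
  circle_int f a = circle_int f b.
Proof.
move=> ap pb qpi piq fd fa fb del0 fM.
have ab : a <= b by rewrite ltW// (lt_trans ap).
apply: circle_int_rect => //; apply: (goursat_punctured ap pb qpi piq _ del0).
- by move=> x y xab yab xy; exact/closed_form_ReIm/fd.
- by move=> x y xp yq xy; split; apply: le_trans (fM x y xp yq xy);
    [exact: Im_le_modulus|exact: Re_le_modulus].
- by move=> x y xab yab xy; exact/closed_form_ReImN/fd.
- by move=> x y xp yq xy; rewrite normrN; split; apply: le_trans (fM x y xp yq xy);
    [exact: Re_le_modulus|exact: Im_le_modulus].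
Qed.

End circle_integral.

(** * Cauchy's formula with a geometric remainder *)

Section cauchy.
Variable R : realType.
Implicit Types (x y a b p q M : R) (z w : R[i]).

(** The standard way below to discard a tail error: an estimate valid up to C t^n for every n holds
    exactly. *)
Lemma geometric_le0 (t C X : R) : 0 <= t -> t < 1 ->
  (forall n, X <= C * t ^+ n) -> X <= 0.
Proof.
move=> t0 t1 H; have tn : (fun n => C * t ^+ n) @ \oo --> C * 0.
  by apply: cvgMr; apply: cvg_expr; rewrite ger0_norm.
rewrite mulr0 in tn.
by apply: (cvgr_to_ge tn); near=> n; exact: H.
Unshelve. all: by end_near.
Qed.

Lemma cdiff_powV z k : z != 0 -> cdiff (fun w => (w ^+ k)^-1) z.
Proof.
by move=> z0; apply: cdiffV; [rewrite expf_neq0|exact: cdiffX].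
Qed.

(** For positive k the integral does not depend on the radius, yet enlarging the radius by the
    factor exp(1) multiplies it by exp(- k); hence it vanishes. *)
Lemma circle_int_powV k b : circle_int (fun w : R[i] => (w ^+ k)^-1) b =
  if k == 0%N then (2 * pi)%:C else 0.
Proof.
have dk x : cdiff_circle (fun w : R[i] => (w ^+ k)^-1) x.
  by move=> y; apply: cdiff_powV; exact: polar_neq0.
case: k dk => [|k] dk /=.
  rewrite /circle_int.
  under eq_Rintegral do rewrite expr0 invr1/=.
  under [X in _ +i* X]eq_Rintegral do rewrite expr0 invr1/=.
  rewrite !Rintegral_cst//= mul0r lebesgue_measure_itv/= lte_fin.
  rewrite gtrN ?pi_gt0//= mul1r opprK; congr (_ +i* _); ring.
have h1 : circle_int (fun w : R[i] => (w ^+ k.+1)^-1) b =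
          circle_int (fun w : R[i] => (w ^+ k.+1)^-1) (b + 1).
  apply: circle_int_const; first by rewrite lerDl.
  by move=> x y _; exact: dk.
have h2 : circle_int (fun w : R[i] => (w ^+ k.+1)^-1) (b + 1) =
    (polar 1 0 ^+ k.+1)^-1 * circle_int (fun w : R[i] => (w ^+ k.+1)^-1) b.
  rewrite -(circle_intZ _ (dk b)) /circle_int.
  have E y : (polar (b + 1) y ^+ k.+1)^-1 =
      (polar 1 0 ^+ k.+1)^-1 * (polar b y ^+ k.+1)^-1.
    by rewrite -[y in LHS]addr0 polarD exprMn invfM mulrC.
  by congr (_ +i* _); apply: eq_Rintegral => y _; rewrite E.
apply/eqP; move: h1; rewrite h2; move: (circle_int _ _) => I.
move/eqP; rewrite -subr_eq0 -{1}[I]mul1r -mulrBl mulf_eq0 => /orP[|//].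
rewrite subr_eq0 => /eqP/(congr1 (@modulus R)).
rewrite modulus1 modulusV modulusX modulus_polar => /eqP.
rewrite eq_sym invr_eq1 -expRM_natl mulr1 => /eqP e1.
by have := expR_gt1 (k.+1%:R : R); rewrite e1 ltxx ltr0Sn.
Qed.

(** The angle q must avoid both ends of [- pi, pi], which give the same ray. Then |y - q| / 2 < pi,
    and cos(y - q) = 1 leaves only y = q. *)
Lemma polar_inj p q x y : - pi < q -> q < pi -> - pi <= y <= pi ->
  polar x y = polar p q -> (x, y) = (p, q).
Proof.
move=> pq qp /andP[py yp] E.
have xp : x = p.
  by apply: expR_inj; rewrite -(modulus_polar x y) E modulus_polar.
subst x; congr (_, _); move: E; rewrite /polar => -[/mulfI c /mulfI s].
have e0 : expR p != 0 by rewrite gt_eqF// expR_gt0.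
move: (c e0) (s e0) => {}c {}s.
have cyq : cos (y - q) = 1.
  by rewrite cosB c s -!expr2 cos2Dsin2.
pose t := `|y - q| / 2.
have t0 : 0 <= t by rewrite divr_ge0.
have tpi : t < pi.
  by rewrite ltr_pdivrMr// ltr_norml; lra.
have : cos (t + t) = 1.
  have -> : t + t = `|y - q| by rewrite /t; lra.
  by case: (ler0P (y - q)) => _; rewrite ?cosN.
rewrite cosD -!expr2; have := cos2Dsin2 t => h1 h2.
have /eqP : (cos t) ^+ 2 = 1 by lra.
rewrite sqrf_eq1 => /orP[|] /eqP ct.
  have : t = 0.
    by apply: (@cos_inj R); rewrite ?in_itv/= ?t0 ?pi_ge0 ?lexx ?(ltW tpi)// cos0.
  by move=> /eqP; rewrite mulf_eq0 invr_eq0 (eqr_nat R 2 0) orbF normr_eq0 subr_eq0 => /eqP.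
have : t = pi.
  by apply: (@cos_inj R); rewrite ?in_itv/= ?t0 ?pi_ge0 ?lexx ?(ltW tpi)// cospi.
by move=> tE; rewrite tE ltxx in tpi.
Qed.

(** Off the real axis the puncture lies in the interior of the rectangle, as [goursat_punctured]
    demands. Real points are reached afterwards by continuity. *)
Lemma nonreal_polar z : complex.Im z != 0 ->
  exists p q, [/\ - pi < q, q < pi & z = polar p q].
Proof.
move=> Iz; have z0 : 0 < modulus z.
  by rewrite modulus_gt0; apply: contra_neq Iz => ->.
pose c := complex.Re z / modulus z.
have c2 : c ^+ 2 + (complex.Im z / modulus z) ^+ 2 = 1.
  by rewrite !expr_div_n -mulrDl -modulus_sqr mulfV// expf_neq0// gt_eqF.
have I2 : 0 < (complex.Im z / modulus z) ^+ 2.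
  by rewrite exprn_even_gt0//= mulf_neq0// invr_eq0 gt_eqF.
have c1 : -1 < c < 1.
  by rewrite -ltr_norml -(@ltr_pXn2r _ 2)// ?nnegrE// real_normK ?num_real// expr1n; lra.
have cle : -1 <= c <= 1 by lra.
have cgt : -1 < c <= 1 by lra.
have aK : cos (acos c) = c by rewrite acosK// in_itv.
have sK : sin (acos c) = `|complex.Im z| / modulus z.
  rewrite sin_acos// (_ : 1 - c ^+ 2 = (complex.Im z / modulus z) ^+ 2); last by lra.
  by rewrite sqrtr_sqr normrM normfV (ger0_norm (ltW z0)).
have a0 := acos_ge0 cle; have api := acos_ltpi cgt.
have a0' : 0 < acos c by apply: acos_gt0; lra.
have ez : expR (ln (modulus z)) = modulus z by rewrite lnK.
exists (ln (modulus z)); have [I0|I0] := ltP 0 (complex.Im z).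
  exists (acos c); split => //; first by lra.
  rewrite /polar ez aK sK gtr0_norm// /c !(mulrC (modulus z)) !divfK ?gt_eqF//.
  by case: (z).
exists (- acos c); split; [lra|lra|].
rewrite /polar ez cosN sinN aK sK ler0_norm// /c mulNr opprK.
rewrite !(mulrC (modulus z)) !divfK ?gt_eqF//.
by case: (z).
Qed.

Variable h : R[i] -> R[i].
Hypothesis hol : forall z, unit_disc z -> cdiff h z.

Lemma cdiff_difference_quotient (z0 w : R[i]) : unit_disc w -> w != z0 ->
  cdiff (fun w : R[i] => (w * ((h w - h z0) / (w - z0)))) w.
Proof.
move=> wD wz; apply: cdiffM; first exact: cdiff_id.
apply: (@cdiffM _ (fun w => h w - h z0) (fun w => (w - z0)^-1)).
  by apply: cdiffB; [exact: hol|exact: cdiff_cst].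
apply: (@cdiffV _ (fun w => w - z0)); first by rewrite subr_eq0.
by apply: cdiffB; [exact: cdiff_id|exact: cdiff_cst].
Qed.

Lemma polar_continuous p q del : 0 < del -> exists2 eta : R, 0 < eta &
  forall x y, `|x - p| <= eta -> `|y - q| <= eta ->
    modulus (polar x y - polar p q) < del.
Proof.
move=> del0.
have [d d0 H] := cderiv_polar (@cderiv_id R (polar p q)) ltr01.
have E0 := expR_gt0 p.
exists (Num.min (d / 2) (del / (4 * (expR p + 1)))).
  by rewrite lt_min !divr_gt0// mulr_gt0// addr_gt0.
move=> x y; rewrite !le_min => /andP[xd xe] /andP[yd ye].
have xd' : `|x - p| < d by lra.
have yd' : `|y - q| < d by lra.
have := H x y xd' yd'; rewrite mul1r.
set W := polar x y - polar p q; set K := _ +i* _ => HW.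
have -> : W = (W - polar p q * K) + polar p q * K by rewrite subrK.
apply: le_lt_trans (modulusD _ _) _.
rewrite modulusM modulus_polar.
have KS : modulus K <= `|x - p| + `|y - q| by exact: modulus_le_ReIm.
have := ler_wpM2l (ltW E0) KS.
move: xe ye; rewrite !ler_pdivlMr ?mulr_gt0 ?addr_gt0//.
by move: HW del0; clear; lra.
Qed.

(** The integrand is bounded near the puncture since h is differentiable there, so the integral does
    not depend on the radius, even across the circle through the puncture. On small circles about 0
    the factor w makes it tend to 0. *)
Lemma cauchy_kernel p q b : p < b -> b < 0 -> - pi < q -> q < pi ->
  circle_int (fun w : R[i] =>
    (w * ((h w - h (polar p q)) / (w - polar p q)))) b = 0.
Proof.
move=> pb b0 piq qpi; set z0 := polar p q; set phi := (X in circle_int X).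
have discx x y : x <= b -> unit_disc (polar x y).
  by move=> xb; rewrite /unit_disc/= modulus_polar expR_lt1 (le_lt_trans xb).
have z0D : unit_disc z0 by apply: discx; exact: ltW.
have dphi x y : x <= b -> polar x y != z0 -> cdiff phi (polar x y).
  by move=> xb xyz; apply: cdiff_difference_quotient => //; exact: discx.
have dcirc x : x <= b -> x != p -> cdiff_circle phi x.
  move=> xb xp y; apply: dphi => //; apply: contra_neq xp => /(congr1 (@modulus R)).
  by rewrite !modulus_polar => /expR_inj.
have [C C0 [del del0 HC]] := cdiff_bound (hol z0D).
have [eta eta0 Heta] := polar_continuous p q del0.
have same a : a < p -> circle_int phi a = circle_int phi b.
  move=> ap; apply: (@circle_int_const_punctured _ phi a b p q
    ((modulus z0 + del) * C) eta) => //.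
  - move=> x y /andP[ax xb] ypi xyn; apply: dphi => //.
    by apply/eqP => /(polar_inj piq qpi ypi).
  - by apply: dcirc; [rewrite ltW// (lt_trans ap)|rewrite lt_eqF].
  - by apply: dcirc => //; rewrite gt_eqF.
  - move=> x y xp yq _; have wz := Heta _ _ xp yq.
    rewrite /phi; move: wz; set w := polar x y => wz.
    rewrite (modulusM w) ler_pM ?modulus_ge0//.
      have -> : w = z0 + (w - z0) by rewrite subrKC.
      by apply: le_trans (modulusD _ _) _; rewrite lerD2l ltW.
    have [->|wz0] := eqVneq w z0.
      by rewrite [z0 - z0]subrr invr0 mulr0 modulus0 ltW.
    rewrite (modulusM (h w - h z0)) modulusV ler_pdivrMr ?modulus_gt0 ?subr_eq0//.
    exact: HC.
have zero0 : unit_disc (0 : R[i]) by rewrite /unit_disc/= modulus0 ltr01.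
have [C' C'0 [del' del'0 HC']] := cdiff_bound (hol zero0).
have mz0 : 0 < modulus z0 by rewrite modulus_polar expR_gt0.
pose A := C' * del' + modulus (h 0 - h z0).
have A0 : 0 <= A by rewrite addr_ge0 ?modulus_ge0// mulr_ge0// ltW.
have small a : a < p -> expR a < del' -> expR a <= modulus z0 / 2 ->
    modulus (circle_int phi a) <= 4 * pi * (expR a * (A / (modulus z0 / 2))).
  move=> ap ad az; apply: circle_int_le.
    by apply: dcirc; [rewrite ltW// (lt_trans ap)|rewrite lt_eqF].
  move=> y; rewrite /phi; set w := polar a y.
  have mw : modulus w = expR a by rewrite modulus_polar.
  rewrite (modulusM w) mw ler_wpM2l ?expR_ge0//.
  rewrite (modulusM (h w - h z0)) modulusV ler_pM ?invr_ge0 ?modulus_ge0//.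
    have -> : h w - h z0 = (h w - h 0) + (h 0 - h z0) by rewrite addrA subrK.
    apply: le_trans (modulusD _ _) _; rewrite lerD2r.
    apply: (@le_trans _ _ (C' * modulus (w - 0))).
      by apply: HC'; rewrite subr0 mw.
    by rewrite subr0 mw ler_wpM2l// ltW.
  rewrite lef_pV2 ?posrE ?divr_gt0//; last first.
    rewrite modulus_gt0 subr_eq0; apply/eqP => /(congr1 (@modulus R)).
    by rewrite mw modulus_polar => /expR_inj aE; rewrite aE ltxx in ap.
  have : modulus z0 <= modulus w + modulus (w - z0).
    have -> : modulus z0 = modulus (w - (w - z0)) by congr modulus; ring.
    exact: modulusB.
  by rewrite mw; move: az; clear; lra.
apply/eqP; rewrite -modulus_eq0; apply/eqP/le_anti; rewrite modulus_ge0 andbT.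
apply/ler_addgt0Pr => e e0; rewrite add0r.
pose B := 4 * pi * (A / (modulus z0 / 2)) + 1.
have B1 : 0 < B.
  have AA : 0 <= A / (modulus z0 / 2) by rewrite divr_ge0// ltW// divr_gt0.
  by rewrite /B ltr_wpDl// mulr_ge0// mulr_ge0// pi_ge0.
pose r := Num.min (Num.min (del' / 2) (modulus z0 / 2)) (e / B).
have r0 : 0 < r by rewrite !lt_min !divr_gt0.
have : r <= r by []. rewrite {2}/r !le_min => /andP[/andP[rd rz] re].
have er : expR (ln r) = r by rewrite lnK.
have lrp : ln r < p.
  by rewrite -ltr_expR er -(modulus_polar p q) -/z0; move: rz mz0; clear; lra.
rewrite -(same _ lrp); apply: le_trans (small _ lrp _ _) _.
- by rewrite er; move: rd del'0; clear; lra.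
- by rewrite er.
- rewrite er mulrCA; move: re; rewrite ler_pdivlMr// /B.
  by move: (4 * pi * _) => X; move: r0; clear; lra.
Qed.

Definition cauchy_coef b k : R[i] :=
  ((2 * pi)^-1)%:C * circle_int (fun w : R[i] => (h w / w ^+ k)) b.

(** w / (w - z0) is expanded as a finite geometric sum with remainder (z0 / w)^n w / (w - z0). The
    function g is general because g = 1 gives the winding integral and g = h the Taylor
    polynomial. *)
Lemma circle_int_kernel (g : R[i] -> R[i]) p q b M n : p < b ->
  cdiff_circle g b -> (forall y, modulus (g (polar b y)) <= M) ->
  modulus (circle_int (fun w : R[i] => (g w * (w / (w - polar p q)))) b -
    \sum_(k < n) polar p q ^+ k * circle_int (fun w : R[i] => (g w / w ^+ k)) b)
  <= 4 * pi * (M / (1 - expR (p - b)) * expR (p - b) ^+ n).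
Proof.
move=> pb gd gM; set z0 := polar p q; set t := expR (p - b).
have t1 : t < 1 by rewrite /t expR_lt1 subr_lt0.
have wz y : polar b y != z0.
  apply/eqP => /(congr1 (@modulus R)); rewrite !modulus_polar => /expR_inj bp.
  by rewrite bp ltxx in pb.
have w0 y : polar b y != 0 := polar_neq0 _ _.
have dK y : cdiff (fun w : R[i] => (w / (w - z0))) (polar b y).
  apply: cdiffM; first exact: cdiff_id.
  apply: (@cdiffV _ (fun w => w - z0)); first by rewrite subr_eq0.
  by apply: cdiffB; [exact: cdiff_id|exact: cdiff_cst].
have dgk k : cdiff_circle (fun w : R[i] => (g w / w ^+ k)) b.
  by move=> y; apply: cdiffM; [exact: gd|exact: cdiff_powV].
pose F k := fun w : R[i] => (z0 ^+ k * (g w / w ^+ k)).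
have dF k : cdiff_circle (F k) b.
  by move=> y; apply: cdiffM; [exact: cdiff_cst|exact: dgk].
pose E := fun w : R[i] => (z0 ^+ n * (g w / w ^+ n * (w / (w - z0)))).
have dE : cdiff_circle E b.
  move=> y; apply: cdiffM; [exact: cdiff_cst|].
  by apply: cdiffM; [exact: dgk|exact: dK].
have [sumE dsum] := @circle_int_sum R n F b (fun k _ => dF k).
have -> : circle_int (fun w : R[i] => (g w * (w / (w - z0)))) b =
  circle_int (fun z => \sum_(k < n) F k z) b + circle_int E b.
  rewrite -circle_intD//; apply: eq_circle_int => y.
  rewrite /F /E; move: (wz y) (w0 y); move: (polar b y) => w wz0 wn0.
  have wz1 : w - z0 != 0 by rewrite subr_eq0.
  clear -wz1 wn0; elim: n => [|n IH].
    by rewrite big_ord0 add0r !expr0 invr1 mulr1 mul1r.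
  rewrite big_ord_recr/= -addrA IH; congr (_ + _).
  rewrite !exprS; field; rewrite wz1 wn0 expf_neq0//.
rewrite sumE.
rewrite (eq_bigr (fun k : 'I_n => z0 ^+ k * circle_int (fun w : R[i] =>
    (g w / w ^+ k)) b)); last first.
  by move=> k _; rewrite -(circle_intZ _ (dgk k)).
rewrite addrC addKr; apply: circle_int_le => // y.
rewrite /E; set w := polar b y.
have mw : modulus w = expR b by rewrite modulus_polar.
have mz : modulus z0 = expR p by rewrite modulus_polar.
have tE : t = modulus z0 / modulus w by rewrite mw mz /t expRD expRN.
have mw0 : 0 < modulus w by rewrite mw expR_gt0.
rewrite (modulusM (z0 ^+ n)) (modulusM (g w / _)) (modulusM (g w)) (modulusM w).
rewrite !modulusV !modulusX.
have -> : modulus z0 ^+ n * (modulus (g w) / modulus w ^+ n *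
    (modulus w / modulus (w - z0))) =
   modulus (g w) * (modulus w / modulus (w - z0)) * t ^+ n.
  rewrite tE expr_div_n; move: (modulus (w - z0))^-1 (modulus (g w)) => A G.
  by field; rewrite expf_neq0// gt_eqF.
have ge0t : 0 <= t by exact: expR_ge0.
rewrite ler_wpM2r ?exprn_ge0// ler_pM ?modulus_ge0//.
  by rewrite divr_ge0// modulus_ge0.
  exact: gM.
have wz1 : 0 < modulus (w - z0) by rewrite modulus_gt0 subr_eq0; exact: wz.
rewrite ler_pdivrMr// mulrC ler_pdivlMr ?subr_gt0//.
rewrite tE mulrBr mulr1 mulrC divfK ?gt_eqF//.
rewrite lerBlDr.
have -> : modulus w = modulus ((w - z0) + z0) by rewrite subrK.
exact: modulusD.
Qed.

Lemma taylor_bound_polar p q b M n : p < b -> b < 0 -> - pi < q -> q < pi ->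
  (forall y, modulus (h (polar b y)) <= M) ->
  modulus (h (polar p q) - \sum_(k < n) cauchy_coef b k * polar p q ^+ k) <=
  2 * M / (1 - expR (p - b)) * expR (p - b) ^+ n.
Proof.
move=> pb b0 piq qpi hM; set z0 := polar p q; set t := expR (p - b).
have t0 : 0 <= t by exact: expR_ge0.
have t1 : t < 1 by rewrite /t expR_lt1 subr_lt0.
have hd : cdiff_circle h b.
  by move=> y; apply: hol; rewrite /unit_disc/= modulus_polar expR_lt1.
have pi2 : (2 * pi : R) != 0 by rewrite mulf_neq0// gt_eqF// pi_gt0.
(* The winding integral: in the expansion with g = 1 only the term k = 0 survives, and the remainder
   is discarded by [geometric_le0]. *)
pose K := circle_int (fun w : R[i] => (w / (w - z0))) b.
have KE : K = (2 * pi)%:C.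
  apply/eqP; rewrite -subr_eq0 -modulus_eq0; apply/eqP/le_anti.
  rewrite modulus_ge0 andbT.
  apply: (@geometric_le0 t (4 * pi * (1 / (1 - t)))) => // m.
  have := @circle_int_kernel (fun _ => 1) p q b 1 m.+1 pb
    (fun y => cdiff_cst _ _).
  rewrite -/z0 -/t.
  have m1 (y : R) : modulus (1 : R[i]) <= 1 by rewrite modulus1.
  move=> /(_ m1); rewrite big_ord_recl big1; last first.
    move=> i _; rewrite (eq_circle_int (g := fun w : R[i] =>
      (w ^+ (lift ord0 i))^-1)); last by move=> y; rewrite mul1r.
    by rewrite circle_int_powV/= mulr0.
  rewrite addr0 expr0 mul1r.
  rewrite (eq_circle_int (g := fun w : R[i] => (w / (w - z0)))); last first.
    by move=> y; rewrite mul1r.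
  rewrite -/K (eq_circle_int (g := fun w : R[i] => (w ^+ 0)^-1)); last first.
    by move=> y; rewrite mul1r.
  rewrite circle_int_powV/= => /le_trans; apply.
  rewrite -[leRHS]mulrA ler_wpM2l ?mulr_ge0 ?pi_ge0// ler_wpM2l ?divr_ge0 ?subr_ge0 ?(ltW t1)//.
  by rewrite exprS ler_piMl ?exprn_ge0// ltW.
have wz y : polar b y != z0.
  apply/eqP => /(congr1 (@modulus R)); rewrite !modulus_polar => /expR_inj bp.
  by rewrite bp ltxx in pb.
have dK : cdiff_circle (fun w : R[i] => (w / (w - z0))) b.
  move=> y; apply: cdiffM; first exact: cdiff_id.
  apply: (@cdiffV _ (fun w => w - z0)); first by rewrite subr_eq0.
  by apply: cdiffB; [exact: cdiff_id|exact: cdiff_cst].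
have dhK : cdiff_circle (fun w : R[i] => (h w * (w / (w - z0)))) b.
  by move=> y; apply: cdiffM; [exact: hd|exact: dK].
have hK : circle_int (fun w : R[i] => (h w * (w / (w - z0)))) b =
    h z0 * (2 * pi)%:C.
  rewrite -KE /K -(circle_intZ _ dK).
  rewrite (eq_circle_int (g := fun w : R[i] =>
     (w * ((h w - h z0) / (w - z0)) + h z0 * (w / (w - z0))))); last first.
    move=> y; move: (polar b y) (h (polar b y) : R[i]) (h z0 : R[i]) => w A B; ring.
  rewrite circle_intD.
  - by rewrite cauchy_kernel// add0r.
  - move=> y; apply: cdiff_difference_quotient => //.
    by rewrite /unit_disc/= modulus_polar expR_lt1.
  - by move=> y; apply: cdiffM; [exact: cdiff_cst|exact: dK].
have := circle_int_kernel q n pb hd hM; rewrite hK -/z0 -/t.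
set S := \sum_(k < n) _.
have -> : \sum_(k < n) cauchy_coef b k * z0 ^+ k = ((2 * pi)^-1)%:C * S.
  by rewrite mulr_sumr; apply: eq_bigr => k _; rewrite /cauchy_coef -mulrA [_ * z0 ^+ _]mulrC.
have -> : h z0 - ((2 * pi)^-1)%:C * S =
    ((2 * pi)^-1)%:C * (h z0 * (2 * pi)%:C - S).
  rewrite mulrBr mulrCA -rmorphM/= mulVf// mulr1//.
rewrite (modulusM _ (_ - S)) modulus_real => /(ler_wpM2l (normr_ge0 (2 * pi)^-1)).
move=> /le_trans; apply.
rewrite ger0_norm ?invr_ge0 ?mulr_ge0 ?pi_ge0//.
rewrite le_eqVlt; apply/orP; left; apply/eqP.
have := gt_eqF (pi_gt0 R) => /negbT pi0.
move: ((1 - t)^-1) (t ^+ n) => u w; move: (pi : R) pi0 => P P0.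
by field.
Qed.

(** A real z is approached by z + i eta. The radius r, strictly larger than |z|, leaves room for
    this, as the bound depends on the point only through r. *)
Lemma taylor_bound (z : R[i]) (r b M : R) n : modulus z < r -> r < expR b -> b < 0 ->
  (forall y, modulus (h (polar b y)) <= M) ->
  modulus (h z - \sum_(k < n) cauchy_coef b k * z ^+ k) <=
  2 * M / (1 - r / expR b) * (r / expR b) ^+ n.
Proof.
move=> zr rb b0 hM.
have M0 : 0 <= M by apply: le_trans (hM 0); exact: modulus_ge0.
have eb1 : expR b < 1 by rewrite expR_lt1.
have eb0 := expR_gt0 b.
have r0 : 0 < r by apply: le_lt_trans zr; exact: modulus_ge0.
have good w : complex.Im w != 0 -> modulus w < r ->
    modulus (h w - \sum_(k < n) cauchy_coef b k * w ^+ k) <=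
    2 * M / (1 - r / expR b) * (r / expR b) ^+ n.
  move=> /nonreal_polar[p [q [piq qpi ->]]]; rewrite modulus_polar => pr.
  have pb : p < b by rewrite -ltr_expR (lt_trans pr).
  apply: le_trans (taylor_bound_polar n pb b0 piq qpi hM) _.
  have tr : expR (p - b) <= r / expR b by rewrite expRD expRN ler_pM2r ?invr_gt0// ltW.
  have rb1 : r / expR b < 1 by rewrite ltr_pdivrMr// mul1r.
  apply: ler_pM.
  - by rewrite divr_ge0 ?mulr_ge0// subr_ge0 (le_trans tr)// ltW.
  - by rewrite exprn_ge0// expR_ge0.
  - rewrite ler_wpM2l ?mulr_ge0// lef_pV2 ?posrE ?subr_gt0 ?(le_lt_trans tr)//.
    by rewrite lerD2l lerN2.
  - by rewrite lerXn2r ?nnegrE ?expR_ge0// divr_ge0// ltW.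
have [Iz|Iz] := eqVneq (complex.Im z) 0; last exact: good.
pose f := fun w : R[i] => h w - \sum_(k < n) cauchy_coef b k * w ^+ k.
have fd : cdiff f z.
  apply: cdiffB; first by apply: hol; rewrite /unit_disc/= (lt_trans zr)// (lt_trans rb).
  apply: (@cdiff_sum _ (fun k w => cauchy_coef b k * w ^+ k)) => k _.
  by apply: cdiffM; [exact: cdiff_cst|exact: cdiffX].
have [D D0 [del del0 HD]] := cdiff_bound fd.
apply/ler_addgt0Pr => e e0.
pose eta := Num.min (Num.min (del / 2) ((r - modulus z) / 2)) (e / D).
have eta0 : 0 < eta by rewrite !lt_min !divr_gt0// subr_gt0.
have : eta <= eta by [].
rewrite {2}/eta !le_min => /andP[/andP[ed er] ee].
pose w := z + 0 +i* eta.
have mwz : modulus (w - z) = eta.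
  rewrite /w addrC addKr; apply/eqP; rewrite -(@eqrXn2 _ 2)// ?modulus_ge0 ?ltW//.
  by rewrite modulus_sqr/= expr0n add0r.
have Iw : complex.Im w != 0 by rewrite /w raddfD/= Iz add0r gt_eqF.
have wr : modulus w < r.
  have -> : w = z + (w - z) by rewrite subrKC.
  apply: le_lt_trans (modulusD _ _) _; rewrite mwz.
  by move: er zr; clear; lra.
have := good _ Iw wr; rewrite -/(f w) -/(f z) => fw.
have -> : f z = f w - (f w - f z) by rewrite opprB subrKC.
apply: le_trans (modulusB _ _) _; apply: lerD => //.
apply: le_trans (HD _ _) _; rewrite mwz; first by move: ed del0; clear; lra.
by rewrite mulrC -ler_pdivlMr.
Qed.
End cauchy.

(** * Power series *)

Section power_series.
Variable R : realType.
Implicit Types (c : nat -> R[i]) (z w : R[i]) (r s A : R).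

Definition psum c n z : R[i] := \sum_(k < n) c k * z ^+ k.

(* the radius of convergence of c is at least rho *)
Definition radius_ge (rho : R) c :=
  forall s, 0 < s -> s < rho -> exists A, forall k, modulus (c k) * s ^+ k <= A.

Lemma natr_mul_expr_le (t : R) k : 0 <= t -> t < 1 -> k%:R * t ^+ k <= (1 - t)^-1.
Proof.
move=> t0 t1; have u0 : 0 < 1 - t by rewrite subr_gt0.
rewrite -div1r ler_pdivlMr//.
have : k%:R * t ^+ k * (1 - t) <= 1 - t ^+ k.
  elim: k => [|k IH]; first by rewrite mul0r mul0r expr0 subrr.
  have tk1 : t ^+ k <= 1 by rewrite exprn_ile1// ltW.
  have tk0 : 0 <= t ^+ k by rewrite exprn_ge0.
  have := ler_wpM2l t0 IH.
  have : 0 <= (1 - t) * (1 - t * t ^+ k).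
    by rewrite mulr_ge0 ?(ltW u0)// subr_ge0 mulr_ile1// ltW.
  rewrite -natr1 exprS; move: (k%:R : R) (t ^+ k) tk0 tk1 {IH} => K T T0 T1.
  by clear; lra.
by move=> /le_trans; apply; rewrite gerBl exprn_ge0.
Qed.

Lemma psum_tail c s A z r m n : 0 < s -> (forall k, modulus (c k) * s ^+ k <= A) ->
  modulus z <= r -> r < s -> (n <= m)%N ->
  modulus (psum c m z - psum c n z) <= A / (1 - r / s) * (r / s) ^+ n.
Proof.
move=> s0 cA zr rs nm.
have r0 : 0 <= r by apply: le_trans zr; exact: modulus_ge0.
have A0 : 0 <= A.
  by apply: le_trans (cA 0%N); rewrite expr0 mulr1 modulus_ge0.
set t := r / s; have t0 : 0 <= t by rewrite divr_ge0// ltW.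
have t1 : t < 1 by rewrite ltr_pdivrMr// mul1r.
have u0 : 0 < 1 - t by rewrite subr_gt0.
have term k : modulus (c k * z ^+ k) <= A * t ^+ k.
  rewrite modulusM modulusX /t expr_div_n mulrA ler_pdivlMr ?exprn_gt0//.
  have sk0 : 0 <= s ^+ k by rewrite exprn_ge0// ltW.
  rewrite mulrAC ler_pM// ?mulr_ge0 ?exprn_ge0 ?modulus_ge0 ?(ltW s0)//.
  by rewrite lerXn2r ?nnegrE ?modulus_ge0.
(* The sharper bound with t^n - t^m is the one that passes through the induction on m. *)
suff : modulus (psum c m z - psum c n z) <= A / (1 - t) * (t ^+ n - t ^+ m).
  move=> /le_trans; apply; rewrite ler_wpM2l//.
    by rewrite divr_ge0// ltW.
  by rewrite gerBl exprn_ge0.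
rewrite -(subnKC nm); elim: (m - n)%N => [|d IH].
  by rewrite addn0 !subrr modulus0 mulr0.
rewrite addnS /psum big_ord_recr/= addrAC -/(psum c (n + d) z) -/(psum c n z).
apply: le_trans (modulusD _ _) _.
apply: le_trans (lerD IH (term _)) _.
rewrite le_eqVlt; apply/orP; left; apply/eqP.
rewrite exprS; move: (t ^+ n) (t ^+ (n + d)) => X Y.
by field; rewrite gt_eqF.
Qed.

(** Real and imaginary parts are summed separately, so that convergence follows from completeness of
    the reals. *)
Definition pser c z : R[i] :=
  lim (series (fun k => complex.Re (c k * z ^+ k)) @ \oo) +i*
  lim (series (fun k => complex.Im (c k * z ^+ k)) @ \oo).

Lemma Re_sum (I : Type) (l : seq I) (P : pred I) (F : I -> R[i]) :
  complex.Re (\sum_(i <- l | P i) F i) = \sum_(i <- l | P i) complex.Re (F i).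
Proof.
apply: (big_ind2 (fun x y => complex.Re x = y)) => //.
by move=> [? ?] ? [? ?] ? /= -> ->.
Qed.

Lemma Im_sum (I : Type) (l : seq I) (P : pred I) (F : I -> R[i]) :
  complex.Im (\sum_(i <- l | P i) F i) = \sum_(i <- l | P i) complex.Im (F i).
Proof.
apply: (big_ind2 (fun x y => complex.Im x = y)) => //.
by move=> [? ?] ? [? ?] ? /= -> ->.
Qed.

Lemma pser_tail c s A z r n : 0 < s ->
  (forall k, modulus (c k) * s ^+ k <= A) ->
  modulus z <= r -> r < s ->
  modulus (pser c z - psum c n z) <= 2 * (A / (1 - r / s)) * (r / s) ^+ n.
Proof.
move=> s0 cA zr rs.
have r0 : 0 <= r by apply: le_trans zr; exact: modulus_ge0.
have t0 : 0 <= r / s by rewrite divr_ge0// ltW.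
have t1 : r / s < 1 by rewrite ltr_pdivrMr// mul1r.
have A0 : 0 <= A.
  by apply: le_trans (cA 0%N); rewrite expr0 mulr1 modulus_ge0.
have tail := psum_tail s0 cA zr rs.
have cauchy_lim (u : nat -> R) : (forall m n, (n <= m)%N ->
    `|u m - u n| <= A / (1 - r / s) * (r / s) ^+ n) ->
    forall n, `|lim (u @ \oo) - u n| <= A / (1 - r / s) * (r / s) ^+ n.
  move=> uC k.
  have tn : (fun n => A / (1 - r / s) * (r / s) ^+ n) @ \oo --> (A / (1 - r / s) * 0 : R).
    by apply: cvgMr; apply: cvg_expr; rewrite ger0_norm.
  rewrite mulr0 in tn.
  have cu : cvg (u @ \oo).
    apply/cauchy_cvgP/cauchy_exP => e /= e0.
    have [N _ HN] := cvgr_lt _ tn _ e0.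
    exists (u N), N => // m /= Nm; rewrite /ball/= distrC.
    by rewrite (le_lt_trans (uC _ _ Nm))//; apply: HN => /=.
  have /cvgr_to_le : (fun m => `|u m - u k|) @ \oo --> `|lim (u @ \oo) - u k|.
    by apply: cvg_norm; apply: cvgB => //; exact: cvg_cst.
  by apply; exists k => // m /= km; exact: uC.
have ReE n' : series (fun k => complex.Re (c k * z ^+ k)) n' = complex.Re (psum c n' z).
  by rewrite /psum Re_sum /series/= big_mkord.
have ImE n' : series (fun k => complex.Im (c k * z ^+ k)) n' = complex.Im (psum c n' z).
  by rewrite /psum Im_sum /series/= big_mkord.
apply: le_trans (modulus_le_ReIm _) _; rewrite ReB ImB -ReE -ImE /=.
rewrite -mulrA mulr_natl mulr2n lerD//.
  apply: cauchy_lim => m k km; rewrite !ReE -ReB.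
  exact: le_trans (Re_le_modulus _) (tail _ _ km).
apply: cauchy_lim => m k km; rewrite !ImE -ImB.
exact: le_trans (Im_le_modulus _) (tail _ _ km).
Qed.

Lemma radius_tail rho c r : radius_ge rho c -> r < rho -> 0 < rho ->
  exists K t, [/\ 0 <= K, 0 <= t, t < 1 & forall z n, modulus z <= r ->
    modulus (pser c z - psum c n z) <= K * t ^+ n].
Proof.
move=> cr rrho rho0; pose r' := Num.max r 0.
have r'rho : r' < rho by rewrite gt_max rrho.
have r'0 : 0 <= r' by rewrite le_max lexx orbT.
pose s := (r' + rho) / 2.
have s0 : 0 < s by rewrite divr_gt0// ltr_wpDl.
have srho : s < rho by rewrite /s; clear -r'rho; lra.
have rs : r' < s by rewrite /s; clear -r'rho; lra.
have [A cA] := cr s s0 srho.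
have A0 : 0 <= A.
  by apply: le_trans (cA 0%N); rewrite expr0 mulr1 modulus_ge0.
exists (2 * (A / (1 - r' / s))), (r' / s); split.
- by rewrite mulr_ge0// divr_ge0// subr_ge0 ler_pdivrMr// mul1r ltW.
- by rewrite divr_ge0// ltW.
- by rewrite ltr_pdivrMr// mul1r.
- move=> z n zr; apply: pser_tail => //.
  by apply: le_trans zr _; rewrite le_max lexx.
Qed.

(** The main tool for evaluating a power series: a geometric rate for the partial sums suffices, and
    the two rates are merged into their maximum. *)
Lemma pser_unique rho c z w C t : radius_ge rho c -> modulus z < rho ->
  0 <= t -> t < 1 ->
  (forall n, modulus (w - psum c n z) <= C * t ^+ n) -> w = pser c z.
Proof.
move=> cr zrho t0 t1 H.
have rho0 : 0 < rho by apply: le_lt_trans zrho; exact: modulus_ge0.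
have [K [u [K0 u0 u1 HK]]] := radius_tail cr zrho rho0.
apply/eqP; rewrite -subr_eq0 -modulus_eq0; apply/eqP/le_anti.
rewrite modulus_ge0 andbT.
have C0 : 0 <= C.
  by apply: le_trans (le_trans _ (H 0%N)) _; rewrite ?modulus_ge0// expr0 mulr1.
pose m := Num.max t u.
apply: (@geometric_le0 R m (C + K)).
- by rewrite le_max t0.
- by rewrite gt_max t1.
- move=> n.
  have -> : w - pser c z = (w - psum c n z) - (pser c z - psum c n z).
    by rewrite opprB addrA subrK.
  apply: le_trans (modulusB _ _) _; rewrite mulrDl; apply: lerD.
    apply: le_trans (H n) _; rewrite ler_wpM2l// lerXn2r ?nnegrE//.
      by rewrite le_max t0.
    by rewrite le_max lexx.
  apply: le_trans (HK z n _) _ => //; rewrite ler_wpM2l// lerXn2r ?nnegrE//.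
    by rewrite le_max t0.
  by rewrite le_max lexx orbT.
Qed.

Lemma pser0 rho c : 0 < rho -> radius_ge rho c -> pser c 0 = c 0%N.
Proof.
move=> rho0 cr; apply/esym/(@pser_unique rho _ _ _ (modulus (c 0%N)) 0) => //.
  by rewrite modulus0.
case=> [|n]; first by rewrite /psum big_ord0 subr0 expr0 mulr1.
rewrite /psum big_ord_recl expr0 mulr1 big1.
  by rewrite addr0 subrr modulus0 expr0n mulr0.
by move=> i _; rewrite expr0n mulr0.
Qed.

Definition dcoef c k : R[i] := k.+1%:R * c k.+1.

Lemma modulus_natr n : modulus (n%:R : R[i]) = n%:R.
Proof.
have -> : (n%:R : R[i]) = (n%:R)%:C by rewrite rmorph_nat.
by rewrite modulus_real ger0_norm.
Qed.

Lemma radius_shift (rho : R) c : radius_ge rho c ->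
  radius_ge rho (fun k => c k.+1).
Proof.
move=> cr s s0 srho; have [A cA] := cr s s0 srho.
exists (A / s) => k; rewrite ler_pdivlMr//; apply: le_trans (cA k.+1).
by rewrite -mulrA -exprSr.
Qed.

Lemma radius_natmul (rho : R) c : 0 < rho -> radius_ge rho c ->
  radius_ge rho (fun k => k.+1%:R * c k).
Proof.
move=> rho0 cr s s0 srho; pose s' := (s + rho) / 2.
have s'0 : 0 < s' by rewrite /s'; clear -s0 rho0; lra.
have s'rho : s' < rho by rewrite /s'; clear -srho; lra.
have ss' : s < s' by rewrite /s'; clear -srho; lra.
move: s' s'0 s'rho ss' => s' s'0 s'rho ss'.
have [A cA] := cr s' s'0 s'rho.
have t0 : 0 <= s / s' by rewrite divr_ge0// ltW.
have t1 : s / s' < 1 by rewrite ltr_pdivrMr// mul1r.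
exists (A * (1 - s / s')^-1 * (s' / s)) => k.
rewrite modulusM modulus_natr.
have -> : k.+1%:R * modulus (c k) * s ^+ k =
  (modulus (c k) * s' ^+ k) * (k.+1%:R * (s / s') ^+ k.+1) * (s' / s).
  rewrite expr_div_n !exprS; move: (k.+1%:R : R) => K.
  by field; rewrite expf_neq0 !gt_eqF.
have h0 : 0 <= s' / s by rewrite divr_ge0// ltW.
rewrite ler_wpM2r//; apply: ler_pM => //.
- by rewrite mulr_ge0 ?modulus_ge0// exprn_ge0// ltW.
- by rewrite mulr_ge0// exprn_ge0.
- exact: natr_mul_expr_le.
Qed.

Lemma radius_dcoef (rho : R) c : 0 < rho -> radius_ge rho c -> radius_ge rho (dcoef c).
Proof. by move=> rho0 /radius_shift; exact: radius_natmul. Qed.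

Lemma sum_geometric_le (t : R) n : 0 <= t -> t < 1 ->
  \sum_(k < n) t ^+ k <= (1 - t)^-1.
Proof.
move=> t0 t1; have u0 : 0 < 1 - t by rewrite subr_gt0.
rewrite -div1r ler_pdivlMr//.
have -> : (\sum_(k < n) t ^+ k) * (1 - t) = 1 - t ^+ n.
  elim: n => [|n IH]; first by rewrite big_ord0 mul0r expr0 subrr.
  by rewrite big_ord_recr/= mulrDl IH exprS; ring.
by rewrite gerBl exprn_ge0.
Qed.

(** The second order remainder of the power k + 1 is of size (k + 1)^2 r^(k-1) |w|^2. Multiplying by
    r avoids the exponent k - 1 at k = 0. *)
Lemma expr_taylor2 z w r k : modulus z <= r -> modulus (z + w) <= r ->
  modulus ((z + w) ^+ k.+1 - z ^+ k.+1 - k.+1%:R * z ^+ k * w) * r <=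
  k.+1%:R ^+ 2 * r ^+ k * modulus w ^+ 2.
Proof.
move=> zr zwr; have r0 : 0 <= r by apply: le_trans zr; exact: modulus_ge0.
have diff j : modulus ((z + w) ^+ j - z ^+ j) * r <= j%:R * r ^+ j * modulus w.
  elim: j => [|j IH]; first by rewrite !expr0 subrr modulus0 !mul0r.
  have -> : (z + w) ^+ j.+1 - z ^+ j.+1 =
      (z + w) * ((z + w) ^+ j - z ^+ j) + w * z ^+ j.
    by rewrite !exprS; move: ((z + w) ^+ j) (z ^+ j) => X Y; ring.
  apply: le_trans (ler_wpM2r r0 (modulusD _ _)) _.
  rewrite mulrDl (modulusM (z + w)) (modulusM w) modulusX.
  have h1 : modulus (z + w) * modulus ((z + w) ^+ j - z ^+ j) * r <=
      r * (j%:R * r ^+ j * modulus w).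
    by rewrite -mulrA ler_pM ?modulus_ge0// mulr_ge0// modulus_ge0.
  have h2 : modulus w * modulus z ^+ j * r <= modulus w * r ^+ j * r.
    by rewrite ler_wpM2r// ler_wpM2l ?modulus_ge0// lerXn2r ?nnegrE ?modulus_ge0.
  apply: le_trans (lerD h1 h2) _; rewrite -natr1 exprS.
  rewrite le_eqVlt; apply/orP; left; apply/eqP.
  by move: (r ^+ j) (modulus w) (j%:R : R) => X Y J; ring.
elim: k => [|k IH].
  have -> : (z + w) ^+ 1 - z ^+ 1 - 1 * z ^+ 0 * w = 0 by rewrite !expr1 expr0; ring.
  rewrite modulus0 mul0r.
  by rewrite mulr_ge0 ?exprn_ge0 ?modulus_ge0// mulr_ge0 ?exprn_ge0.
have -> : (z + w) ^+ k.+2 - z ^+ k.+2 - k.+2%:R * z ^+ k.+1 * w =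
    (z + w) * ((z + w) ^+ k.+1 - z ^+ k.+1 - k.+1%:R * z ^+ k * w) +
    k.+1%:R * z ^+ k * w * w.
  rewrite -(natr1 k.+1) (exprS (z + w) k.+1) (exprS z k.+1) (exprS z k).
  by move: ((z + w) ^+ k.+1) (z ^+ k) (k.+1%:R : R[i]) => X Y K; ring.
apply: le_trans (ler_wpM2r r0 (modulusD _ _)) _; rewrite mulrDl.
set D := _ - k.+1%:R * _ * _ in IH *.
have h1 : modulus ((z + w) * D) * r <= r * (k.+1%:R ^+ 2 * r ^+ k * modulus w ^+ 2).
  by rewrite modulusM -mulrA ler_pM ?modulus_ge0// mulr_ge0// modulus_ge0.
have h2 : modulus (k.+1%:R * z ^+ k * w * w) * r <=
    k.+1%:R * r ^+ k * modulus w ^+ 2 * r.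
  have -> : modulus (k.+1%:R * z ^+ k * w * w) = k.+1%:R * modulus z ^+ k * modulus w ^+ 2.
    by rewrite !modulusM modulus_natr modulusX expr2 !mulrA.
  rewrite ler_wpM2r// ler_wpM2r ?exprn_ge0 ?modulus_ge0// ler_wpM2l//.
  by rewrite lerXn2r ?nnegrE ?modulus_ge0.
apply: le_trans (lerD h1 h2) _.
rewrite (exprS r k) -(natr1 k.+1).
have := ler0n R k.+1; have : 0 <= r * r ^+ k * modulus w ^+ 2.
  by rewrite !mulr_ge0 ?exprn_ge0 ?modulus_ge0.
move: (r ^+ k) (modulus w ^+ 2) (k.+1%:R : R) => X Y K XY K0.
have := mulr_ge0 K0 XY; move: XY.
set S := r * X * Y; have -> : r * (K ^+ 2 * X * Y) = K ^+ 2 * S by rewrite /S; ring.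
have -> : K * X * Y * r = K * S by rewrite /S; ring.
have -> : (K + 1) ^+ 2 * (r * X) * Y = (K + 1) ^+ 2 * S by rewrite /S; ring.
by have -> : (K + 1) ^+ 2 * S = K ^+ 2 * S + 2 * (K * S) + S; [ring|clear; lra].
Qed.

(** The partial sums have a second order remainder at most B |k|^2 with B independent of the number
    of terms, because the coefficients multiplied twice by the index still have radius rho. This
    bound passes to the limit. *)
Lemma cderiv_pser rho c z : radius_ge rho c -> modulus z < rho ->
  cderiv (pser c) z (pser (dcoef c) z).
Proof.
move=> cr zrho.
have rho0 : 0 < rho by apply: le_lt_trans zrho; exact: modulus_ge0.
pose r := (modulus z + rho) / 2.
have mz := modulus_ge0 z.
have r0 : 0 < r by rewrite /r; clear -mz rho0; lra.
have rrho : r < rho by rewrite /r; clear -zrho; lra.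
have zr : modulus z < r by rewrite /r; clear -zrho; lra.
pose s := (r + rho) / 2.
have s0 : 0 < s by rewrite /s; clear -r0 rho0; lra.
have srho : s < rho by rewrite /s; clear -rrho; lra.
have rs : r < s by rewrite /s; clear -rrho; lra.
move: r s r0 rrho zr s0 srho rs => r s r0 rrho zr s0 srho rs.
have [A cA] := radius_natmul rho0 (radius_dcoef rho0 cr) s0 srho.
have A0 : 0 <= A.
  by apply: le_trans (cA 0%N); rewrite expr0 mulr1 modulus_ge0.
have t0 : 0 <= r / s by rewrite divr_ge0// ltW.
have t1 : r / s < 1 by rewrite ltr_pdivrMr// mul1r.
pose B := A / (1 - r / s) / r.
have B0 : 0 <= B.
  by rewrite divr_ge0 ?(ltW r0)// divr_ge0// subr_ge0 ltW.
have part n k : modulus (z + k) <= r ->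
    modulus (psum c n.+1 (z + k) - psum c n.+1 z - psum (dcoef c) n z * k) <=
    B * modulus k ^+ 2.
  move=> zkr; rewrite /psum !big_ord_recl !expr0 mulr_suml.
  rewrite opprD addrACA subrr add0r -!sumrB.
  apply: le_trans (modulus_sum _ _ _) _.
  rewrite /B mulrAC ler_pdivlMr// mulr_suml.
  apply: (@le_trans _ _ (\sum_(i < n) A * (r / s) ^+ i * modulus k ^+ 2)).
    apply: ler_sum => i _; rewrite /= /bump /= !add1n /dcoef.
    have -> : c i.+1 * (z + k) ^+ i.+1 - c i.+1 * z ^+ i.+1 -
        i.+1%:R * c i.+1 * z ^+ i * k =
      c i.+1 * ((z + k) ^+ i.+1 - z ^+ i.+1 - i.+1%:R * z ^+ i * k).
      by move: (i.+1%:R : R[i]) ((z + k) ^+ i.+1) (z ^+ i.+1) (z ^+ i) => I X Y Z; ring.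
    rewrite modulusM -[leLHS]mulrA.
    have := ler_wpM2l (modulus_ge0 (c i.+1)) (expr_taylor2 i (ltW zr) zkr).
    move=> /le_trans; apply; rewrite mulrA ler_wpM2r ?exprn_ge0 ?modulus_ge0//.
    have := cA i; rewrite /dcoef !modulusM !modulus_natr => cAi.
    have -> : A * (r / s) ^+ i = A * r ^+ i / s ^+ i by rewrite expr_div_n mulrA.
    rewrite ler_pdivlMr ?exprn_gt0//.
    rewrite (_ : _ * s ^+ i = i.+1%:R * (i.+1%:R * modulus (c i.+1)) * s ^+ i * r ^+ i).
      by rewrite ler_wpM2r// exprn_ge0// ltW.
    by move: (i.+1%:R : R) (modulus (c i.+1)) (s ^+ i) (r ^+ i) => I X Y Z; ring.
  rewrite -mulr_suml ler_wpM2r ?exprn_ge0 ?modulus_ge0// -mulr_sumr ler_wpM2l//.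
  exact: sum_geometric_le.
have [K1 [q1 [K10 q10 q11 H1]]] := radius_tail cr rrho rho0.
have [K2 [q2 [K20 q20 q21 H2]]] := radius_tail (radius_dcoef rho0 cr) rrho rho0.
have whole k : modulus (z + k) <= r ->
    modulus (pser c (z + k) - pser c z - pser (dcoef c) z * k) <= B * modulus k ^+ 2.
  move=> zkr; rewrite -subr_le0; pose q := Num.max q1 q2.
  have q0 : 0 <= q by rewrite le_max q10.
  apply: (@geometric_le0 R q (2 * K1 + K2 * modulus k)) => //.
    by rewrite gt_max q11.
  move=> n; rewrite lerBlDr.
  have -> : pser c (z + k) - pser c z - pser (dcoef c) z * k =
      (psum c n.+1 (z + k) - psum c n.+1 z - psum (dcoef c) n z * k) +
      ((pser c (z + k) - psum c n.+1 (z + k)) - (pser c z - psum c n.+1 z) -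
       (pser (dcoef c) z - psum (dcoef c) n z) * k).
    by ring.
  apply: le_trans (modulusD _ _) _; rewrite addrC lerD//; last exact: part.
  apply: le_trans (modulusB _ _) _; rewrite modulusM mulrDl; apply: lerD.
    apply: le_trans (modulusB _ _) _.
    apply: le_trans (lerD (H1 _ n.+1 zkr) (H1 _ n.+1 (ltW zr))) _.
    suff h : K1 * q1 ^+ n.+1 <= K1 * q ^+ n.
      by apply: le_trans (lerD h h) _; rewrite -mulr2n -mulrA mulr_natl.
    rewrite ler_wpM2l// exprS (le_trans (ler_piMl _ (ltW q11))) ?exprn_ge0//.
    by rewrite lerXn2r ?nnegrE// le_max lexx.
  rewrite mulrAC ler_wpM2r ?modulus_ge0//.
  apply: le_trans (H2 _ n (ltW zr)) _; rewrite ler_wpM2l//.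
  by rewrite lerXn2r ?nnegrE// le_max lexx orbT.
move=> e e0; exists (Num.min (r - modulus z) (e / (B + 1))).
  by rewrite lt_min subr_gt0 zr divr_gt0// ltr_wpDl.
move=> k; rewrite lt_min => /andP[kr ke].
apply: le_trans (whole k _) _.
  by apply: le_trans (modulusD _ _) _; move: kr; clear; lra.
rewrite expr2 mulrA ler_wpM2r ?modulus_ge0//.
move: ke; rewrite ltr_pdivlMr ?ltr_wpDl//; have := modulus_ge0 k.
by move: (modulus k) B0 => m; clear; nra.
Qed.

Lemma cderiv_local (f g : R[i] -> R[i]) z d (del : R) : 0 < del ->
  (forall w, modulus (w - z) < del -> f w = g w) -> cderiv f z d -> cderiv g z d.
Proof.
move=> del0 fg fd e e0; have [del' del'0 H] := fd e e0.
exists (Num.min del del'); first by rewrite lt_min del0.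
move=> k; rewrite lt_min => /andP[k1 k2].
rewrite -!fg; first exact: H.
- by rewrite subrr modulus0.
- by rewrite addrC addKr.
Qed.

Lemma iter_dcoefE n c k : k`!%:R * iter n dcoef c k = (k + n)`!%:R * c (k + n)%N.
Proof.
elim: n k => [|n IH] k; first by rewrite addn0.
rewrite /= {1}/dcoef mulrA -natrM [(k`! * _)%N]mulnC -factS.
by rewrite IH addSnnS.
Qed.

(** By induction every derivative of h is, on the whole disc of radius rho, the series of the
    iterated derived coefficients; its value at 0 is n! c_n. *)
Lemma taylor_coef_pser rho c (h : R[i]^o -> R[i]^o) n : 0 < rho -> radius_ge rho c ->
  (forall z, modulus z < rho -> h z = pser c z) -> taylor_coef h n = c n.
Proof.
move=> rho0 cr hc.
have key m : radius_ge rho (iter m dcoef c) /\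
    forall z, modulus z < rho -> derive1n m h z = pser (iter m dcoef c) z.
  elim: m => [|m [IHr IH]]; first by split.
  split; first exact: radius_dcoef.
  move=> z zrho; rewrite derive1nS.
  have : cderiv (derive1n m h) z (pser (dcoef (iter m dcoef c)) z).
    have del0 : 0 < rho - modulus z by rewrite subr_gt0.
    apply: (cderiv_local del0 _ (cderiv_pser IHr zrho)) => w wz.
    rewrite IH//; have -> : w = z + (w - z) by rewrite subrKC.
    by apply: le_lt_trans (modulusD _ _) _; move: wz; clear; lra.
  by move=> /cderivP[].
have [cr' cn] := key n; rewrite /taylor_coef cn ?modulus0//.
rewrite (pser0 rho0 cr').
have := iter_dcoefE n c 0; rewrite fact0 mul1r add0n => ->.
by rewrite mulrC mulKf.
Qed.

Lemma cdiff_pser rho c z : radius_ge rho c -> modulus z < rho -> cdiff (pser c) z.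
Proof. by move=> cr zrho; exists (pser (dcoef c) z); exact: cderiv_pser cr zrho. Qed.

End power_series.

Section taylor_expansion.
Variable R : realType.
Variable h : R[i]^o -> R[i]^o.
Hypothesis hol : holomorphic_disc h.
Implicit Types (z : R[i]) (rho r M : R).

Let hd z : unit_disc z -> cdiff h z.
Proof. by move=> zD; apply/cdiffP; exact: hol. Qed.

Let coef_bound rho M k : 0 < rho -> rho < 1 ->
  (forall z, modulus z = rho -> modulus (h z) <= M) ->
  modulus (cauchy_coef h (ln rho) k) * rho ^+ k <= 2 * M.
Proof.
move=> rho0 rho1 hM; have eb : expR (ln rho) = rho by rewrite lnK.
have hM' y : modulus (h (polar (ln rho) y)) <= M.
  by apply: hM; rewrite modulus_polar.
have pi0 := pi_gt0 R.
rewrite /cauchy_coef modulusM modulus_real ger0_norm; last first.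
  by rewrite invr_ge0 mulr_ge0// ltW.
have cd : cdiff_circle h (ln rho).
  by move=> y; apply: hd; rewrite /unit_disc/= modulus_polar eb.
have := @circle_int_le R (fun w => h w / w ^+ k) (ln rho) (M / rho ^+ k) _ _.
move=> /(_ (fun y => cdiffM (cd y) (cdiff_powV k (polar_neq0 _ _)))) H.
have {}H : modulus (circle_int (fun w => h w / w ^+ k) (ln rho)) <=
    4 * pi * (M / rho ^+ k).
  apply: H => y; rewrite modulusM modulusV modulusX modulus_polar eb.
  by rewrite ler_wpM2r ?invr_ge0 ?exprn_ge0// ltW.
have h1 : 0 <= (2 * pi)^-1 * rho ^+ k.
  by rewrite mulr_ge0 ?exprn_ge0 ?invr_ge0 ?mulr_ge0// ltW.
rewrite mulrAC; apply: le_trans (ler_wpM2l h1 H) _.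
rewrite le_eqVlt; apply/orP; left; apply/eqP.
have : rho ^+ k != 0 by rewrite expf_neq0// gt_eqF.
move: (rho ^+ k) (pi : R) (lt0r_neq0 pi0) => X P P0 X0.
by field; rewrite P0 X0.
Qed.

(** For a function of the weighted space this is immediate: the weight is a positive constant on
    each circle about 0. *)
Hypothesis bounded_circles :
  forall rho, 0 < rho -> rho < 1 -> exists M, forall z, modulus z = rho -> modulus (h z) <= M.

Let coef_radius rho : 0 < rho -> rho < 1 -> radius_ge rho (cauchy_coef h (ln rho)).
Proof.
move=> rho0 rho1 s s0 srho; have [M hM] := bounded_circles rho0 rho1.
exists (2 * M) => k; apply: le_trans (coef_bound k rho0 rho1 hM).
by rewrite ler_wpM2l ?modulus_ge0// lerXn2r ?nnegrE ?(ltW s0) ?(ltW rho0) ?(ltW srho).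
Qed.

Let coef_pser rho z : 0 < rho -> rho < 1 -> modulus z < rho ->
  h z = pser (cauchy_coef h (ln rho)) z.
Proof.
move=> rho0 rho1 zrho; have [M hM] := bounded_circles rho0 rho1.
have eb : expR (ln rho) = rho by rewrite lnK.
pose r := (modulus z + rho) / 2; have mz := modulus_ge0 z.
have r0 : 0 <= r by rewrite divr_ge0// addr_ge0// ltW.
have [zr rrho] : (modulus z < r) * (r < rho) by exact: midf_lt.
apply: (@pser_unique R rho _ _ _ (2 * M / (1 - r / rho)) (r / rho)) => //.
- exact: coef_radius.
- by rewrite divr_ge0// ltW.
- by rewrite ltr_pdivrMr// mul1r.
- move=> n; rewrite -[in leRHS]eb; apply: taylor_bound => //; rewrite ?eb//.
    by rewrite -ltr_expR eb expR0.
  by move=> y; apply: hM; rewrite modulus_polar.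
Qed.

(** Shows that the Cauchy coefficients do not depend on the circle: on each disc they represent h,
    and a convergent power series determines its coefficients by its derivatives at 0. *)
Lemma taylor_coefE rho k : 0 < rho -> rho < 1 ->
  taylor_coef h k = cauchy_coef h (ln rho) k.
Proof.
move=> rho0 rho1; apply: (@taylor_coef_pser R rho) => //; first exact: coef_radius.
by move=> z zrho; exact: coef_pser.
Qed.

Lemma taylor_coef_le rho M k : 0 < rho -> rho < 1 ->
  (forall z, modulus z = rho -> modulus (h z) <= M) ->
  modulus (taylor_coef h k) * rho ^+ k <= 2 * M.
Proof. by move=> rho0 rho1 hM; rewrite (taylor_coefE k rho0 rho1) coef_bound. Qed.

Lemma taylor_radius : radius_ge 1 (taylor_coef h).
Proof.
move=> s s0 s1; have [M hM] := bounded_circles s0 s1.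
by exists (2 * M) => k; exact: taylor_coef_le.
Qed.

Lemma taylor_pser z : unit_disc z -> h z = pser (taylor_coef h) z.
Proof.
rewrite /unit_disc/= => z1; pose rho := (modulus z + 1) / 2; have mz := modulus_ge0 z.
have [zrho rho1] : (modulus z < rho) * (rho < 1) by exact: midf_lt.
have rho0 : 0 < rho by exact: le_lt_trans zrho.
rewrite (coef_pser rho0 rho1 zrho); congr pser; apply/funext => k.
by rewrite (taylor_coefE k rho0 rho1).
Qed.

End taylor_expansion.

(** * Partial sums of Taylor series *)

Section sine_bound.
Variable R : realType.

(* The mean value theorem on [0, pi/4] and monotonicity on [pi/4, pi/2]. *)
Lemma sin_ge_linear : exists2 k : R, 0 < k &
  forall x : R, 0 <= x -> x <= pi / 2 -> k * x <= sin x.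
Proof.
have pi0 := pi_gt0 R.
pose k0 := cos (pi / 4 : R).
have pi4 : 0 < pi / 4 :> R by rewrite divr_gt0.
have k00 : 0 < k0 by apply: cos_gt0_pihalf; rewrite /=; clear -pi0; lra.
have small x : 0 <= x -> x <= pi / 4 -> k0 * x <= sin x.
  move=> x0 x4; have [->|xn0] := eqVneq x 0; first by rewrite mulr0 sin0.
  have {}x0 : 0 < x by rewrite lt0r xn0.
  have [c] := @MVT R sin cos 0 x x0 (fun y _ => is_derive_sin y)
    (continuous_subspaceT (@continuous_sin R)).
  rewrite in_itv/= => /andP[c0 cx]; rewrite sin0 !subr0 => ->.
  rewrite ler_wpM2r ?(ltW x0)// /k0 leNgt; apply/negP.
  rewrite ltr_cos ?in_itv/=; first by clear -cx x4; lra.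
    by rewrite (ltW pi4); clear -pi0; lra.
  by rewrite (ltW c0); clear -pi0 cx x4; lra.
exists (k0 / 2); first by rewrite divr_gt0.
move=> x x0 x2; have [x4|x4] := leP x (pi / 4).
  apply: le_trans (small _ x0 x4); rewrite mulrAC ler_piMr//.
    by rewrite mulr_ge0// ltW.
  by rewrite invf_le1// ler1n.
have s4 : sin (pi / 4) <= sin x.
  rewrite leNgt; apply/negP; rewrite ltr_sin ?in_itv/=.
  - by clear -x4; lra.
  - by clear -x4 x2 pi0; lra.
  - by clear -pi0; lra.
apply: le_trans s4; apply: le_trans (small _ (ltW pi4) (lexx _)).
by have := ler_wpM2l (ltW k00) x2; clear; lra.
Qed.

(** |exp(i y) - 1| = 2 sin |y / 2|. This is the source of the bound by a multiple of 1 / |y| for the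
    Dirichlet kernel. *)
Lemma modulus_polar1_sub1 : exists2 k : R, 0 < k & forall y : R, - pi <= y <= pi ->
  k * `|y| <= modulus (polar 0 y - 1).
Proof.
have [k k0 H] := sin_ge_linear; exists k => // y /andP[y1 y2].
have hy : `|y / 2| <= pi / 2 by rewrite normrM (ger0_norm (_ : 0 <= 2^-1 :> R))// ler_pM2r// ler_norml y1.
have e : modulus (polar 0 y - 1) = 2 * sin `|y / 2|.
  have s0 : 0 <= sin `|y / 2|.
    by apply: le_trans (H _ _ hy) => //; rewrite mulr_ge0// ltW.
  apply/eqP; rewrite -(@eqrXn2 _ 2) ?modulus_ge0 ?mulr_ge0//.
  rewrite modulus_sqr ReB ImB /= expR0 !mul1r subr0.
  have -> : (2 * sin `|y / 2|) ^+ 2 = 4 * sin (y / 2) ^+ 2.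
    by rewrite exprMn; congr (_ * _); [ring|case: (ler0P (y / 2)) => _; rewrite ?sinN ?sqrrN].
  have := cos2Dsin2 (y / 2).
  rewrite (_ : cos y = cos (y / 2) ^+ 2 - sin (y / 2) ^+ 2); last first.
    by rewrite [in LHS](splitr y) cosD !expr2.
  rewrite (_ : sin y = 2 * (sin (y / 2) * cos (y / 2))); last first.
    by rewrite [in LHS](splitr y) sinD; ring.
  move: (cos (y / 2)) (sin (y / 2)) => c s cs; apply/eqP.
  have c2 : c ^+ 2 = 1 - s ^+ 2 by rewrite -cs addrK.
  have -> : (2 * (s * c)) ^+ 2 = 4 * s ^+ 2 * c ^+ 2 by ring.
  by rewrite c2; ring.
rewrite e; have := H _ (normr_ge0 (y / 2)) hy.
by rewrite normrM (ger0_norm (_ : 0 <= 2^-1 :> R))//; clear; lra.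
Qed.

End sine_bound.

Section log_integral.
Variable R : realType.
Notation mu := (@lebesgue_measure R).
Implicit Types (f : R -> R) (C a b : R).

(* Dyadic decomposition: |f y| <= C / y gives at most C on each [2^-(j+1) b, 2^-j b]. *)
Lemma Rintegral_inv_le f C b j : 0 < b -> 0 <= C -> continuous_on f 0 b ->
  (forall y, 0 < y <= b -> `|f y| <= C / y) ->
  `|\int[mu]_(y in `[b / 2 ^+ j, b]) f y| <= C *+ j.
Proof.
move=> b0 C0 cf fC; elim: j => [|j IH].
  by rewrite expr0 divr1 mulr0n set_itv1 Rintegral_set1 normr0.
have p0 i : 0 < b / 2 ^+ i by rewrite divr_gt0// exprn_gt0.
have h2 : b / 2 ^+ j = 2 * (b / 2 ^+ j.+1).
  by rewrite exprS; field; rewrite expf_neq0.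
have le1 : b / 2 ^+ j.+1 <= b / 2 ^+ j by rewrite h2 ler_peMl ?ltW// ltr1n.
have le2 : b / 2 ^+ j <= b.
  by rewrite ler_pdivrMr ?exprn_gt0// ler_peMr ?(ltW b0)// exprn_ege1// ler1n.
have cf' c d : 0 <= c -> d <= b -> continuous_on f c d.
  by move=> c0 db x /andP[cx xd]; apply: cf; rewrite (le_trans c0)// (le_trans xd).
rewrite (Rintegral_split le1 le2); last by apply: cf' => //; exact: ltW.
apply: le_trans (ler_normD _ _) _; rewrite [leRHS]mulrS; apply: lerD => //.
apply: (@le_trans _ _ (C / (b / 2 ^+ j.+1) * (b / 2 ^+ j - b / 2 ^+ j.+1))).
  apply: Rintegral_norm_le => //; first by apply: cf' => //; exact: ltW.
  move=> x /andP[x1 x2]; apply: le_trans (fC x _) _.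
    by rewrite (lt_le_trans (p0 j.+1) x1) (le_trans x2).
  by rewrite ler_wpM2l// lef_pV2 ?posrE// (lt_le_trans (p0 j.+1)).
rewrite h2 mulr_natl mulr2n addrK divfK// gt_eqF//.
Qed.

Lemma Rintegral_inv_leN f C b j : 0 < b -> 0 <= C -> continuous_on f (- b) 0 ->
  (forall y, - b <= y < 0 -> `|f y| <= C / - y) ->
  `|\int[mu]_(y in `[- b, - (b / 2 ^+ j)]) f y| <= C *+ j.
Proof.
move=> b0 C0 cf fC; elim: j => [|j IH].
  by rewrite expr0 divr1 mulr0n set_itv1 Rintegral_set1 normr0.
have p0 i : 0 < b / 2 ^+ i by rewrite divr_gt0// exprn_gt0.
have h2 : b / 2 ^+ j = 2 * (b / 2 ^+ j.+1).
  by rewrite exprS; field; rewrite expf_neq0.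
have le1 : - (b / 2 ^+ j) <= - (b / 2 ^+ j.+1) by rewrite lerN2 h2 ler_peMl ?ltW// ltr1n.
have le2 : - b <= - (b / 2 ^+ j).
  by rewrite lerN2 ler_pdivrMr ?exprn_gt0// ler_peMr ?(ltW b0)// exprn_ege1// ler1n.
have cf' c d : - b <= c -> d <= 0 -> continuous_on f c d.
  by move=> c0 db x /andP[cx xd]; apply: cf; rewrite (le_trans c0)// (le_trans xd).
rewrite (Rintegral_split le2 le1); last by apply: cf' => //; rewrite oppr_le0 ltW.
apply: le_trans (ler_normD _ _) _; rewrite [leRHS]mulrSr; apply: lerD => //.
apply: (@le_trans _ _ (C / (b / 2 ^+ j.+1) * (- (b / 2 ^+ j.+1) - - (b / 2 ^+ j)))).
  apply: Rintegral_norm_le => //; first by apply: cf' => //; rewrite oppr_le0 ltW.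
  move=> x /andP[x1 x2].
  have x0 : x < 0 by rewrite (le_lt_trans x2)// oppr_lt0.
  apply: le_trans (fC x _) _; first by rewrite x0 (le_trans le2).
  by rewrite ler_wpM2l// lef_pV2 ?posrE ?oppr_gt0// lerNr.
rewrite opprK h2 mulr_natl mulr2n addKr divfK// gt_eqF//.
Qed.

(** The crude bound N is used on [- b / 2^j, b / 2^j] and the bound C / |y| outside. With N
    proportional to n and 2^j at least n the central part is bounded, and j is of order log n. *)
Lemma Rintegral_log_le f C N b j : 0 < b -> 0 <= C -> 0 <= N ->
  continuous_on f (- b) b ->
  (forall y, - b <= y <= b -> y != 0 -> `|f y| <= C / `|y|) ->
  (forall y, - b <= y <= b -> `|f y| <= N) ->
  `|\int[mu]_(y in `[- b, b]) f y| <= C *+ (2 * j) + 2 * N * b / 2 ^+ j.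
Proof.
move=> b0 C0 N0 cf fC fN.
set e := b / 2 ^+ j; have e0 : 0 < e by rewrite divr_gt0// exprn_gt0.
have eb : e <= b.
  by rewrite /e ler_pdivrMr ?exprn_gt0// ler_peMr ?(ltW b0)// exprn_ege1// ler1n.
have bb : - b <= b by rewrite ge0_cp// ltW.
have h1 : - b <= - e by rewrite lerN2.
have h2 : - e <= e by rewrite ge0_cp// ltW.
have cf' c d : - b <= c -> d <= b -> continuous_on f c d.
  by move=> c0 db x /andP[cx xd]; apply: cf; rewrite (le_trans c0)// (le_trans xd).
rewrite (Rintegral_split h1 (le_trans h2 eb) cf) (Rintegral_split h2 eb); last exact: cf'.
apply: le_trans (ler_normD _ _) _.
have i1 : `|\int[mu]_(y in `[- b, - e]) f y| <= C *+ j.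
  apply: Rintegral_inv_leN => //; first by apply: cf' => //; exact: ltW.
  move=> y /andP[y1 y2]; rewrite -ltr0_norm//; apply: fC; last by rewrite lt_eqF.
  by rewrite y1 (le_trans (ltW y2))// ltW.
have i3 : `|\int[mu]_(y in `[e, b]) f y| <= C *+ j.
  apply: Rintegral_inv_le => //; first by apply: cf' => //; rewrite oppr_le0 ltW.
  move=> y /andP[y1 y2]; rewrite -[y in leRHS]gtr0_norm//; apply: fC; last by rewrite gt_eqF.
  by rewrite y2 (le_trans _ (ltW y1))// oppr_le0 ltW.
have i2 : `|\int[mu]_(y in `[- e, e]) f y| <= N * (e - - e).
  apply: Rintegral_norm_le => //; first exact: cf'.
  by move=> y /andP[y1 y2]; apply: fN; rewrite (le_trans h1)// (le_trans y2).
have := ler_normD (\int[mu]_(y in `[- e, e]) f y) (\int[mu]_(y in `[e, b]) f y).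
have -> : 2 * N * b / 2 ^+ j = N * (e - - e) by rewrite /e; field; rewrite expf_neq0.
rewrite mul2n -addnn mulrnDr.
by move: i1 i2 i3; clear; lra.
Qed.

End log_integral.

(** * Logarithmic growth of Taylor partial sums *)

Section partial_sums.
Variable R : realType.

Lemma modulus_sum_expr (u : R[i]) n : modulus u = 1 ->
  modulus (\sum_(k < n) u ^+ k) <= n%:R /\
  modulus (\sum_(k < n) u ^+ k) * modulus (u - 1) <= 2.
Proof.
move=> u1; have uk k : modulus (u ^+ k) = 1 by rewrite modulusX u1 expr1n.
split.
  apply: le_trans (modulus_sum _ _ _) _.
  under eq_bigr do rewrite uk.
  by rewrite big_const_ord iter_addr_0.
rewrite -modulusM.
have -> : (\sum_(k < n) u ^+ k) * (u - 1) = u ^+ n - 1.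
  elim: n => [|n IH]; first by rewrite big_ord0 mul0r expr0 subrr.
  by rewrite big_ord_recr/= mulrDl IH exprS; ring.
by apply: le_trans (modulusB _ _) _; rewrite uk modulus1.
Qed.

Lemma exists_log2 n : exists2 j, (n <= 2 ^ j)%N &
  j%:R * ln 2 <= 2 * ln (n%:R + 2) :> R.
Proof.
exists (trunc_log 2 n).+1; first exact/ltnW/trunc_log_ltn.
have n0 : 0 <= n%:R :> R by [].
have l2 : ln 2 <= ln (n%:R + 2) :> R by rewrite ler_ln ?posrE ?lerDr ?ltr_wpDl.
rewrite -(natr1 (trunc_log 2 n)) mulrDl mul1r [leRHS]mulr_natl [leRHS]mulr2n lerD//.
have [->|n1] := posnP n; first by rewrite trunc_log0 mul0r add0r ln_ge0 ?ler1n.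
rewrite mulr_natl -lnXn// ler_ln ?posrE ?exprn_gt0 ?ltr_wpDl//.
apply: (@le_trans _ _ n%:R); last by rewrite lerDl.
by rewrite -natrX ler_nat trunc_logP.
Qed.

(** The partial sum at rho is the mean over y of h(rho exp(i y)) times the kernel sum of exp(- i k
    y), whose L^1 norm is O(log n). For a positive real point the kernel peaks at y = 0, the centre
    of the interval of integration. *)
Lemma psum_real_log : exists2 C : R, 0 < C & forall h : R[i]^o -> R[i]^o,
  holomorphic_disc h ->
  (forall rho : R, 0 < rho -> rho < 1 ->
     exists M, forall z, modulus z = rho -> modulus (h z) <= M) ->
  forall (rho M : R) n, 0 < rho -> rho < 1 ->
    (forall z, modulus z = rho -> modulus (h z) <= M) ->
  modulus (psum (taylor_coef h) n rho%:C) <= C * ln (n%:R + 2) * M.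
Proof.
have [k k0 Hk] := modulus_polar1_sub1 R.
have pi0 := pi_gt0 R.
have l2 : 0 < ln 2 :> R by rewrite ln_gt0// ltr1n.
exists (8 / k / ln 2 / pi + 2 / ln 2).
  by rewrite addr_gt0// !divr_gt0.
move=> h hol hb rho M n rho0 rho1 hM.
have eb : expR (ln rho) = rho by rewrite lnK.
set b := ln rho in eb.
have M0 : 0 <= M.
  by apply: le_trans (hM (polar b 0) _); rewrite ?modulus_ge0// modulus_polar eb.
have cd : cdiff_circle h b.
  by move=> y; apply/cdiffP/hol; rewrite /unit_disc/= modulus_polar eb.
pose F := fun k (w : R[i]) => rho%:C ^+ k * (h w / w ^+ k).
have dk i : cdiff_circle (fun w => h w / w ^+ i) b.
  by move=> y; apply: cdiffM; [exact: cd|apply: cdiff_powV; exact: polar_neq0].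
have dF i : cdiff_circle (F i) b.
  by move=> y; apply: cdiffM; [exact: cdiff_cst|exact: dk].
have [sumF dsum] := circle_int_sum (fun i (_ : (i < n)%N) => dF i).
have -> : psum (taylor_coef h) n rho%:C =
    ((2 * pi)^-1)%:C * circle_int (fun w => \sum_(i < n) F i w) b.
  rewrite sumF mulr_sumr /psum; apply: eq_bigr => i _.
  rewrite (taylor_coefE hol hb i rho0 rho1) /cauchy_coef -/b /F circle_intZ//.
  by rewrite -mulrA [_ * rho%:C ^+ _]mulrC.
have Fy y : \sum_(i < n) F i (polar b y) = h (polar b y) * \sum_(i < n) polar 0 (- y) ^+ i.
  rewrite mulr_sumr; apply: eq_bigr => i _; rewrite /F mulrCA; congr (_ * _).
  have -> : rho%:C = polar b y * polar 0 (- y).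
    by rewrite -polarD addr0 subrr /polar eb cos0 sin0 mulr0 mulr1.
  by rewrite exprMn mulrC mulKf// expf_neq0// polar_neq0.
have pu y : modulus (polar (0 : R) (- y)) = 1 by rewrite modulus_polar expR0.
have hy y : modulus (h (polar b y)) <= M by apply: hM; rewrite modulus_polar.
have Fn y : modulus (\sum_(i < n) F i (polar b y)) <= M * n%:R.
  rewrite Fy modulusM; apply: ler_pM; rewrite ?modulus_ge0//.
  by have [] := modulus_sum_expr n (pu y).
have Finv y : - pi <= y <= pi -> y != 0 ->
    modulus (\sum_(i < n) F i (polar b y)) <= 2 * M / k / `|y|.
  move=> ypi y0; rewrite Fy modulusM.
  have [_ S2] := modulus_sum_expr n (pu y).
  have nypi : - pi <= - y <= pi.
    by case/andP: ypi => y1 y2; rewrite lerN2 y2 lerNl.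
  have := Hk _ nypi; rewrite normrN => ky; have ay : 0 < `|y| by rewrite normr_gt0.
  rewrite ler_pdivlMr// ler_pdivlMr//.
  set S := modulus (\sum_(i < n) _) in S2 *.
  have S0 : 0 <= S by exact: modulus_ge0.
  apply: (@le_trans _ _ (M * (S * (k * `|y|)))).
    rewrite [leLHS](_ : _ = modulus (h (polar b y)) * (S * (k * `|y|))).
      by rewrite ler_wpM2r// !mulr_ge0// ltW.
    by move: (modulus (h _)) (`|y|) => X Y; ring.
  rewrite [leRHS]mulrC ler_wpM2l// (le_trans _ S2)// ler_wpM2l//.
have [j nj jl] := exists_log2 n.
have bound (f : R -> R) : continuous_on f (- pi) pi ->
    (forall y, `|f y| <= modulus (\sum_(i < n) F i (polar b y))) ->
    `|\int[@lebesgue_measure R]_(y in `[- pi, pi]) f y| <=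
      (2 * M / k) *+ (2 * j) + 2 * M * pi.
  move=> cf fF.
  have Mk0 : 0 <= 2 * M / k by rewrite divr_ge0 ?(ltW k0)// mulr_ge0.
  have Mn0 : 0 <= M * n%:R by rewrite mulr_ge0.
  apply: le_trans (Rintegral_log_le j pi0 Mk0 Mn0 cf _ _) _.
  - by move=> y ypi y0; apply: le_trans (fF y) _; exact: Finv.
  - by move=> y _; apply: le_trans (fF y) _; exact: Fn.
  rewrite lerD2l ler_pdivrMr ?exprn_gt0// -!mulrA ler_wpM2l// ler_wpM2l//.
  by rewrite mulrC ler_wpM2l ?(ltW pi0)// -natrX ler_nat.
have hR := bound (fun y => complex.Re (\sum_(i < n) F i (polar b y))) _ _.
have hI := bound (fun y => complex.Im (\sum_(i < n) F i (polar b y))) _ _.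
have {}hR := hR (fun y _ => (cdiff_polar_continuous (dsum y)).1) (fun y => Re_le_modulus _).
have {}hI := hI (fun y _ => (cdiff_polar_continuous (dsum y)).2) (fun y => Im_le_modulus _).
rewrite modulusM modulus_real ger0_norm ?invr_ge0 ?mulr_ge0 ?(ltW pi0)//.
have := le_trans (modulus_le_ReIm (circle_int (fun w => \sum_(i < n) F i w) b)) (lerD hR hI).
have p2 : 0 <= (2 * pi)^-1 :> R by rewrite invr_ge0 mulr_ge0// ltW.
move=> /(ler_wpM2l p2)/le_trans; apply.
have n0 : 0 <= n%:R :> R by [].
have ln2 : ln 2 <= ln (n%:R + 2) :> R by rewrite ler_ln ?posrE ?lerDr ?ltr_wpDl.
set L := ln (n%:R + 2) in jl ln2 *.
rewrite -(mulr_natr (2 * M / k)) natrM.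
have -> : (2 * pi)^-1 * (2 * M / k * (2 * j%:R) + 2 * M * pi +
     (2 * M / k * (2 * j%:R) + 2 * M * pi)) =
  (4 / k / ln 2 / pi * M) * (j%:R * ln 2) + (2 / ln 2 * M) * ln 2.
  move: (j%:R : R) (ln 2 : R) l2 (pi : R) pi0 => J l l0 P P0.
  by field; rewrite !gt_eqF.
have -> : (8 / k / ln 2 / pi + 2 / ln 2) * L * M =
  (4 / k / ln 2 / pi * M) * (2 * L) + (2 / ln 2 * M) * L by ring.
by apply: lerD; rewrite ler_wpM2l// mulr_ge0// !divr_ge0// ltW.
Qed.

Lemma eq_pser (c d : nat -> R[i]) z w :
  (forall i, c i * z ^+ i = d i * w ^+ i) -> pser c z = pser d w.
Proof.
move=> E; rewrite /pser.
have -> : (fun i => complex.Re (c i * z ^+ i)) = (fun i => complex.Re (d i * w ^+ i)).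
  by apply/funext => i; rewrite E.
have -> // : (fun i => complex.Im (c i * z ^+ i)) = (fun i => complex.Im (d i * w ^+ i)).
by apply/funext => i; rewrite E.
Qed.

Lemma cdiff_scale (h : R[i] -> R[i]) u z : cdiff h (u * z) ->
  cdiff (fun w => h (u * w)) z.
Proof.
move=> [d H]; exists (d * u) => e e0.
have u0 : 0 < modulus u + 1 by rewrite ltr_wpDl// modulus_ge0.
have [del del0 {}H] := H (e / (modulus u + 1)) (divr_gt0 e0 u0).
exists (del / (modulus u + 1)); first by rewrite divr_gt0.
move=> k; rewrite ltr_pdivlMr// => kd.
have uk : modulus (u * k) <= modulus k * (modulus u + 1).
  by rewrite modulusM mulrC ler_wpM2l ?modulus_ge0// lerDl.
have := H (u * k) (le_lt_trans uk kd); rewrite mulrDr mulrA => /le_trans; apply.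
rewrite mulrAC ler_pdivrMr// -mulrA ler_wpM2l// ltW//.
Qed.

(** Rotation to the real axis: h is replaced by h(u w) with u = z / |z|, which multiplies the k-th
    coefficient by u^k and preserves the maximum on every circle. *)
Lemma psum_log : exists2 C : R, 0 < C & forall h : R[i]^o -> R[i]^o,
  holomorphic_disc h ->
  (forall rho : R, 0 < rho -> rho < 1 ->
     exists M, forall z, modulus z = rho -> modulus (h z) <= M) ->
  forall (z : R[i]) (M : R) n, unit_disc z ->
    (forall w, modulus w = modulus z -> modulus (h w) <= M) ->
  modulus (psum (taylor_coef h) n z) <= C * ln (n%:R + 2) * M.
Proof.
have [C C0 H] := psum_real_log.
(* The second summand covers z = 0, where u is undefined; there the partial sum is 0 or h(0), and
   ln(n + 2) is at least ln 2. *)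
exists (C + (ln 2)^-1); first by rewrite addr_gt0// invr_gt0 ln_gt0// ltr1n.
move=> h hol hb z M n zD hM.
have l2 : 0 < ln 2 :> R by rewrite ln_gt0// ltr1n.
have n0 : 0 <= n%:R :> R by [].
have ln2 : ln 2 <= ln (n%:R + 2) :> R by rewrite ler_ln ?posrE ?lerDr ?ltr_wpDl.
have M0 : 0 <= M by apply: le_trans (hM z _) => //; exact: modulus_ge0.
rewrite mulrDl mulrDl; have [z0|z0] := eqVneq z 0.
  subst z.
  apply: (@le_trans _ _ M).
    case: n {ln2 n0} => [|n]; first by rewrite /psum big_ord0 modulus0.
    rewrite /psum big_ord_recl expr0 mulr1 big1 ?addr0; last first.
      by move=> i _; rewrite expr0n mulr0.
    by rewrite /taylor_coef derive1n0 fact0 divr1; exact: hM.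
  rewrite -[leLHS]add0r lerD// ?mulr_ge0 ?(ltW C0)//.
    exact: le_trans (ltW l2) ln2.
  by rewrite ler_peMl// mulrC ler_pdivlMr// mul1r.
apply: (@le_trans _ _ (C * ln (n%:R + 2) * M)); last first.
  by rewrite lerDl !mulr_ge0// ?invr_ge0 ?(ltW l2)// (le_trans (ltW l2)).
pose rho := modulus z; pose u := z / rho%:C.
have rho0 : 0 < rho by rewrite modulus_gt0.
have rho1 : rho < 1 by exact: zD.
have u1 : modulus u = 1.
  by rewrite modulusM modulusV modulus_real gtr0_norm// mulfV// gt_eqF.
have zu : z = u * rho%:C.
  by rewrite /u divfK// (inj_eq (@complexI R)) gt_eqF.
have mu w : modulus (u * w) = modulus w by rewrite modulusM u1 mul1r.
pose hu := fun w : R[i]^o => h (u * w) : R[i]^o.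
have hol_u : holomorphic_disc hu.
  move=> w wD; apply/cdiffP; apply: cdiff_scale; apply/cdiffP/hol.
  by rewrite /unit_disc/= mu.
have hb_u (r : R) : 0 < r -> r < 1 ->
     exists M, forall w, modulus w = r -> modulus (hu w) <= M.
  move=> r0 r1; have [M' HM] := hb r r0 r1; exists M' => w wr.
  by apply: HM; rewrite mu.
have coefu k : taylor_coef hu k = u ^+ k * taylor_coef h k.
  have rad : radius_ge 1 (fun k => u ^+ k * taylor_coef h k).
    move=> s s0 s1; have [A HA] := taylor_radius hol hb s0 s1.
    by exists A => i; rewrite modulusM modulusX u1 expr1n mul1r.
  apply: (@taylor_coef_pser R 1 (fun k => u ^+ k * taylor_coef h k)) => // w w1.
  rewrite /hu (taylor_pser hol hb); last by rewrite /unit_disc/= mu.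
  have E i : taylor_coef h i * (u * w) ^+ i = u ^+ i * taylor_coef h i * w ^+ i.
    by rewrite exprMn mulrCA mulrA.
  exact: eq_pser.
rewrite zu; have -> : psum (taylor_coef h) n (u * rho%:C) = psum (taylor_coef hu) n rho%:C.
  by apply: eq_bigr => i _; rewrite coefu exprMn mulrCA mulrA.
by apply: H => // w wr; apply: hM; rewrite mu.
Qed.

End partial_sums.

(** * Condition (B) *)

Section peaks.
Variable R : realType.
Variable v : weight R.
Variable rho : R -> R.
Hypothesis peak : peak_points v rho.
Implicit Types (m n k r s : R).

Lemma profileE r : r < 1 -> profile v r = v r%:C.
Proof. by rewrite /profile => ->. Qed.

Lemma unit_disc_real r : -1 < r -> r < 1 -> unit_disc (r%:C : R[i]).
Proof. by move=> r1 r2; rewrite /unit_disc/= modulus_real ltr_norml r1. Qed.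

Lemma profile_gt0 r : 0 <= r -> r < 1 -> 0 < profile v r.
Proof.
move=> r0 r1; rewrite profileE//; apply: weight_gt0; apply: unit_disc_real => //.
exact: lt_le_trans r0.
Qed.

Lemma profile_ge0 r : 0 <= r -> 0 <= profile v r.
Proof.
rewrite /profile; case: ifPn => // r1 r0.
by have := profile_gt0 r0 r1; rewrite profileE// => /ltW.
Qed.

Lemma rho_in m : 0 < m -> 0 < rho m < 1.
Proof.
move=> m0; have [/andP[r0 r1] H] := peak m0.
have h2 : 0 <= (2^-1 : R) <= 1 by rewrite invr_ge0 ler0n invf_le1// ler1n.
have p2 : 0 < profile v 2^-1 by apply: profile_gt0; rewrite ?invr_ge0// invf_lt1// ltr1n.
have := H _ h2; have : 0 < (2^-1 : R) `^ m by rewrite powR_gt0// invr_gt0.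
move=> q0 /(lt_le_trans (mulr_gt0 q0 p2)) pos.
apply/andP; split.
  rewrite lt0r r0 andbT; apply/eqP => rE; move: pos.
  by rewrite rE powR0 ?gt_eqF// mul0r ltxx.
rewrite lt_neqAle r1 andbT; apply/eqP => rE; move: pos.
by rewrite rE /profile ltxx mulr0 ltxx.
Qed.

Definition lrho m := ln (rho m).
Definition lprof m := ln (profile v (rho m)).

Lemma rho_gt0 m : 0 < m -> 0 < rho m.
Proof. by move=> /rho_in/andP[]. Qed.

Lemma rho_lt1 m : 0 < m -> rho m < 1.
Proof. by move=> /rho_in/andP[]. Qed.

Lemma profile_rho m : 0 < m -> 0 < profile v (rho m).
Proof. by move=> /rho_in/andP[r0 r1]; exact: profile_gt0 (ltW r0) r1. Qed.

(* log of the maximum of r^m v(r), minus the value at the peak for n: a Bregman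
   divergence of the convex function m |-> log max r^m v(r) *)
Definition bregman m n := (m * lrho m + lprof m) - (m * lrho n + lprof n).

Lemma peak_log m s : 0 < m -> 0 < s -> s < 1 ->
  m * ln s + ln (profile v s) <= m * lrho m + lprof m.
Proof.
move=> m0 s0 s1; have [_ H] := peak m0.
have := H s; rewrite (ltW s0) (ltW s1) => /(_ isT).
have ps := profile_gt0 (ltW s0) s1; have pr := profile_rho m0; have r0 := rho_gt0 m0.
rewrite -ler_ln ?posrE ?mulr_gt0 ?powR_gt0//.
by rewrite !lnM ?posrE ?powR_gt0// !ln_powR.
Qed.

Lemma bregman_ge0 m n : 0 < m -> 0 < n -> 0 <= bregman m n.
Proof.
by move=> m0 n0; rewrite subr_ge0; apply: peak_log => //; [exact: rho_gt0|exact: rho_lt1].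
Qed.

Lemma bregmanD m n : bregman m n + bregman n m = (m - n) * (lrho m - lrho n).
Proof. by rewrite /bregman; ring. Qed.

(** The symmetrized divergence is a sum of two nonnegative terms and equals (m - n) (lrho m - lrho
    n): monotonicity of the subgradient of a convex function. *)
Lemma lrho_le m n : 0 < m -> m <= n -> lrho m <= lrho n.
Proof.
move=> m0; rewrite le_eqVlt => /orP[/eqP->//|mn].
have n0 : 0 < n by exact: lt_trans mn.
have := addr_ge0 (bregman_ge0 n0 m0) (bregman_ge0 m0 n0); rewrite bregmanD.
by rewrite pmulr_rge0 ?subr_gt0// subr_ge0.
Qed.

Lemma lrho_lt0 m : 0 < m -> lrho m < 0.
Proof. by move=> m0; rewrite /lrho ln_lt0// rho_in. Qed.

(** The defect is a product of an increment of the exponent and an increment of [lrho], both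
    nonnegative. *)
Lemma bregman_chain m n k : 0 < m -> m <= n -> n <= k ->
  bregman m n + bregman n k <= bregman m k /\
  bregman k n + bregman n m <= bregman k m.
Proof.
move=> m0 mn nk; have n0 := lt_le_trans m0 mn.
have l1 := lrho_le m0 mn; have l2 := lrho_le n0 nk.
have h1 : 0 <= (n - m) * (lrho k - lrho n) by rewrite mulr_ge0 ?subr_ge0.
have h2 : 0 <= (k - n) * (lrho n - lrho m) by rewrite mulr_ge0 ?subr_ge0.
have e1 : bregman m k = bregman m n + bregman n k + (n - m) * (lrho k - lrho n).
  by rewrite /bregman; ring.
have e2 : bregman k m = bregman k n + bregman n m + (k - n) * (lrho n - lrho m).
  by rewrite /bregman; ring.
by split; rewrite ?e1 ?e2 lerDl.
Qed.

Lemma profile_le r s : 0 < r -> r <= s -> s < 1 -> profile v s <= profile v r.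
Proof.
move=> r0; rewrite le_eqVlt => /orP[/eqP->//|rs s1].
by rewrite !profileE ?(lt_trans rs)//; exact: weight_nonincreasing.
Qed.

Lemma lprof_le1 n : 1 <= n -> lprof n <= lprof 1.
Proof.
move=> n1; have n0 : 0 < n by exact: lt_le_trans n1.
rewrite ler_ln ?posrE ?profile_rho//; apply: profile_le; rewrite ?rho_gt0 ?rho_lt1//.
by have := lrho_le ltr01 n1; rewrite ler_ln ?posrE ?rho_gt0.
Qed.

Lemma profile_small e : 0 < e -> exists d, [/\ 0 < d, d < 1 &
  forall r, d <= r -> r < 1 -> profile v r < e].
Proof.
move=> e0; have := weight_cvg0 v => /cvgr_lt/(_ _ e0)/nbhs_ballP[d /= d0 Hd].
pose d' := Num.max (1 - d / 2) 2^-1.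
have h2 : 2^-1 < 1 :> R by rewrite invf_lt1// ltr1n.
exists d'; split.
- by rewrite lt_max invr_gt0 ltr0n orbT.
- by rewrite gt_max h2 andbT; lra.
- move=> r; rewrite ge_max => /andP[rd _] r1; rewrite profileE//.
  by apply: Hd => //; rewrite /ball/= gtr0_norm ?subr_gt0//; lra.
Qed.

(** The peaks tend to 1, where v vanishes. If rho_n stayed below d < s < 1, comparing the peak with
    the point s would bound n (ln s - ln d). *)
Lemma lprof_cvgN A : exists n0, 1 <= n0 /\ forall n, n0 <= n -> lprof n <= A.
Proof.
have [d [d0 d1 Hd]] := profile_small (expR_gt0 A).
pose s := (d + 1) / 2.
have [ds s1] : (d < s) * (s < 1) by exact: midf_lt.
have s0 : 0 < s := lt_trans d0 ds.
have lds : 0 < ln s - ln d by rewrite subr_gt0 ltr_ln.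
pose X := `|lprof 1 - ln (profile v s)| + 1.
exists (1 + X / (ln s - ln d)); split.
  by rewrite lerDl divr_ge0 ?(ltW lds)// addr_ge0.
move=> n nX.
have X0 : 0 <= X / (ln s - ln d) by rewrite divr_ge0 ?(ltW lds)// addr_ge0.
have n1 : 1 <= n by apply: le_trans nX; rewrite lerDl.
have n0 : 0 < n by exact: lt_le_trans n1.
have pr := profile_rho n0.
rewrite /lprof -(ler_expR) lnK ?posrE//; apply/ltW/Hd; last exact: rho_lt1.
rewrite leNgt; apply/negP => rd.
have h1 := peak_log n0 s0 s1; have h2 := lprof_le1 n1.
have h3 : lrho n <= ln d by rewrite ler_ln ?posrE ?rho_gt0// ltW.
have h4 : n * lrho n <= n * ln d by rewrite ler_wpM2l// ltW.
have h5 : X < n * (ln s - ln d).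
  by rewrite -ltr_pdivrMr//; apply: lt_le_trans nX; rewrite ltrDr.
have h6 := ler_norm (lprof 1 - ln (profile v s)).
by move: h5 h1 h2 h4 h6; rewrite /X; lra.
Qed.

Hypothesis B : forall b1 : R, 1 < b1 -> exists2 b2 : R, 1 < b2 & exists2 c : R, 0 < c &
  forall m n : R, 0 < m -> 0 < n ->
    (rho m / rho n) `^ m * (profile v (rho m) / profile v (rho n)) <= b1 ->
    [/\ c <= m, c <= n & c <= `|m - n|] ->
    (rho n / rho m) `^ n * (profile v (rho n) / profile v (rho m)) <= b2.

Lemma expR_bregman m n : 0 < m -> 0 < n ->
  (rho m / rho n) `^ m * (profile v (rho m) / profile v (rho n)) = expR (bregman m n).
Proof.
move=> m0 n0; have rm := rho_gt0 m0; have rn := rho_gt0 n0.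
have pm := profile_rho m0; have pn := profile_rho n0.
rewrite -[LHS]lnK; last by rewrite posrE mulr_gt0 ?powR_gt0 ?divr_gt0.
congr expR; rewrite lnM ?posrE ?powR_gt0 ?divr_gt0// ln_powR !ln_div ?posrE//.
by rewrite /bregman /lrho /lprof; ring.
Qed.

Lemma condition_B_log (B1 : R) : exists B2 c, 0 < c /\ forall m n,
  c <= m -> c <= n -> c <= `|m - n| -> bregman m n <= B1 -> bregman n m <= B2.
Proof.
(* The maximum with 1 makes b1 > 1 for every real B1. *)
have [|b2 b21 [c c0 H]] := B (b1 := expR (Num.max B1 1)).
  by rewrite expR_gt1 lt_max ltr01 orbT.
exists (ln b2), c; split => // m n cm cn cmn mnB.
have m0 := lt_le_trans c0 cm; have n0 := lt_le_trans c0 cn.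
have := H m n m0 n0; rewrite !expR_bregman// ler_expR le_max mnB.
move=> /(_ isT); have b20 : 0 < b2 by exact: lt_trans b21.
by move=> /(_ (And3 cm cn cmn)); rewrite -{1}(lnK (b20 : b2 \in Num.pos)) ler_expR.
Qed.

Let natr_gt0 (n : nat) : (0 < n)%N -> 0 < n%:R :> R.
Proof. by rewrite ltr0n. Qed.

(* (B) and lim v = 0 force the peaks to separate as soon as the exponents have
   a large ratio: if bregman n m were bounded, lowering n until bregman n' m is
   about L + 1 and applying (B) there would bound m / n. *)
Lemma bregman_separation (L : R) : 0 < L -> exists K N0 : nat, (0 < N0)%N /\
  forall n m : nat, (N0 <= n)%N -> (K * n <= m)%N -> L <= bregman n%:R m%:R.
Proof.
(* Lowering the first exponent by one raises its divergence to m by at most S. *)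
move=> L0; pose S := - lrho 1; have S0 : 0 < S by rewrite oppr_gt0 lrho_lt0.
have [B2 [c [c0 H]]] := condition_B_log (L + 1 + S).
pose c' := (Num.bound c).+1.
have cc' : c <= c'%:R.
  have c0' : 0 <= c by exact: ltW.
  by rewrite ltW// (lt_trans (archi_boundP c0'))// ltr_nat.
have c'0 : 0 < c'%:R :> R by rewrite ltr0n.
have [n0 [n01 Hn0]] := lprof_cvgN (c'%:R * lrho c'%:R + lprof c'%:R - L - 1).
pose N0 := maxn (Num.bound n0) c'.
pose K := (Num.bound (`|B2| + L + S + 2)).+2.
have KB : `|B2| + L + S + 2 < K.-1%:R.
  apply: (lt_trans (archi_boundP _)); last by rewrite ltr_nat.
  by rewrite !addr_ge0// ltW.
exists K, N0; split; first by rewrite leq_max orbT.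
move=> n m; rewrite geq_max => /andP[n0n c'n] Knm; rewrite leNgt; apply/negP => nmL.
have n_gt0 : (0 < n)%N by exact: leq_trans c'n.
have nm : (n <= m)%N by apply: leq_trans Knm; rewrite leq_pmull.
have m_gt0 : (0 < m)%N by exact: leq_trans nm.
have n0nR : n0 <= n%:R.
  have n00 : 0 <= n0 by exact: le_trans n01.
  by rewrite ltW// (lt_le_trans (archi_boundP n00))// ler_nat.
(* At the fixed exponent c' the divergence is already large, since v(rho_n) tends to 0. *)
have base : L + 1 <= bregman c'%:R m%:R.
  have c'nR : c'%:R <= n%:R :> R by rewrite ler_nat.
  have nmR : n%:R <= m%:R :> R by rewrite ler_nat.
  have [h _] := bregman_chain c'0 c'nR nmR.
  have h1 := bregman_ge0 (natr_gt0 n_gt0) (natr_gt0 m_gt0).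
  apply: le_trans h; apply: (@le_trans _ _ (bregman c'%:R n%:R)); last by rewrite lerDl.
  have := Hn0 _ n0nR; rewrite /bregman.
  have : 0 <= c'%:R * - lrho n%:R.
    by rewrite mulr_ge0 ?(ltW c'0)// oppr_ge0 ltW// lrho_lt0// natr_gt0.
  by lra.
(* The largest index n' between c' and n with divergence at least L + 1. By maximality and the
   choice of S, its divergence is at most L + 1 + S, so (B) applies to n' and m. *)
pose P (i : nat) := [&& (c' <= i)%N, (i <= n)%N & L + 1 <= bregman i%:R m%:R].
have exP : exists i, P i by exists c'; rewrite /P leqnn c'n base.
have ubP i : P i -> (i <= n)%N by case/and3P.
have [n' /and3P[c'n' n'n n'L] maxn'] := ex_maxnP exP ubP.
have n'_gt0 : (0 < n')%N by exact: leq_trans c'n'.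
have n'ltn : (n' < n)%N.
  rewrite ltn_neqAle n'n andbT; apply/eqP => n'E; move: n'L nmL; rewrite n'E; lra.
have step : bregman n'%:R m%:R <= L + 1 + S.
  have : ~~ P n'.+1 by apply/negP => /maxn'; rewrite ltnn.
  rewrite /P n'ltn (leq_trans c'n' (leqnSn _))/= -ltNge => h.
  have pk := peak_log (natr_gt0 (isT : 0 < n'.+1)%N) (rho_gt0 (natr_gt0 n'_gt0))
    (rho_lt1 (natr_gt0 n'_gt0)).
  have lm := lrho_lt0 (natr_gt0 m_gt0).
  have l1 : lrho 1 <= lrho n'%:R by apply: lrho_le => //; rewrite ler1n.
  move: h pk; rewrite /bregman -/(lrho _) -/(lprof _) -(natr1 n') /S.
  by move: lm l1; lra.
have cn' : c <= n'%:R by apply: le_trans cc' _; rewrite ler_nat.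
have mn : m%:R - n%:R >= K.-1%:R * n%:R :> R.
  by rewrite lerBrDr -{2}[n%:R]mul1r -mulrDl natr1 prednK// -natrM ler_nat.
have cm : c <= m%:R by apply: le_trans cn' _; rewrite ler_nat (leq_trans n'n).
have n'nR : n'%:R <= n%:R :> R by rewrite ler_nat.
have n1 : 1 <= n%:R :> R by rewrite ler1n.
have cmn : c <= `|n'%:R - m%:R|.
  rewrite distrC ger0_norm ?subr_ge0 ?ler_nat ?(leq_trans n'n)//.
  apply: (@le_trans _ _ (m%:R - n%:R)); last by rewrite lerD2l lerN2.
  apply: le_trans mn; apply: le_trans cc' _; apply: (@le_trans _ _ n%:R).
    by rewrite ler_nat.
  by rewrite ler_peMl ?(ltW (natr_gt0 n_gt0))// ler1n.
have {}H := H _ _ cn' cm cmn step.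
have sumD := bregmanD m%:R n'%:R.
have pk := peak_log (natr_gt0 n_gt0) (rho_gt0 (natr_gt0 n'_gt0)) (rho_lt1 (natr_gt0 n'_gt0)).
(* The divergence drops by more than 1 from n' to n, which bounds n times the increment of [lrho]
   from below. As m - n >= (K - 1) n, the symmetrized divergence of m and n' is then at least K - 1,
   beyond B2 + L + 1 + S. *)
have D1 : 1 <= n%:R * (lrho m%:R - lrho n'%:R).
  have l0 : 0 <= lrho m%:R - lrho n'%:R.
    by rewrite subr_ge0 lrho_le ?natr_gt0// ler_nat (leq_trans n'n).
  apply: (@le_trans _ _ ((n%:R - n'%:R) * (lrho m%:R - lrho n'%:R))); last first.
    by rewrite ler_wpM2r// gerBl.
  move: n'L nmL pk; rewrite /bregman -/(lrho _) -/(lprof _).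
  by lra.
have l0 : 0 <= lrho m%:R - lrho n'%:R.
  by rewrite subr_ge0 lrho_le ?natr_gt0// ler_nat (leq_trans n'n).
have : K.-1%:R * 1 <= (m%:R - n'%:R) * (lrho m%:R - lrho n'%:R).
  apply: (@le_trans _ _ ((m%:R - n%:R) * (lrho m%:R - lrho n'%:R))); last first.
    by rewrite ler_wpM2r// lerD2l lerN2.
  apply: (@le_trans _ _ (K.-1%:R * n%:R * (lrho m%:R - lrho n'%:R))); last first.
    by rewrite ler_wpM2r.
  by rewrite -mulrA ler_wpM2l.
rewrite mulr1 -sumD; have := ler_norm B2.
by move: H step KB; lra.
Qed.

(** If the divergence from m to n were below L, (B) would bound the opposite one by B2; it is
    therefore first made larger than L + |B2|. The factor at least 2 between the exponents ensures m
    - n >= n >= c. *)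
Lemma bregman_separation2 (L : R) : 0 < L -> exists K N0 : nat, (0 < N0)%N /\
  forall n m : nat, (N0 <= n)%N -> (K * n <= m)%N ->
    L <= bregman n%:R m%:R /\ L <= bregman m%:R n%:R.
Proof.
move=> L0; have [B2 [c [c0 H]]] := condition_B_log L.
have [|K [N0 [N00 HK]]] := @bregman_separation (L + `|B2| + 1).
  by rewrite -addrA ltr_wpDr// addr_ge0.
pose c' := (Num.bound c).+1.
have cc' : c <= c'%:R.
  have c0' : 0 <= c by exact: ltW.
  by rewrite ltW// (lt_trans (archi_boundP c0'))// ltr_nat.
exists (maxn K 2), (maxn N0 c'); split; first by rewrite leq_max N00.
move=> n m; rewrite geq_max => /andP[N0n c'n].
rewrite maxnMl geq_max => /andP[Kn twon].
have n_gt0 : (0 < n)%N by exact: leq_trans N0n.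
have nm : (n <= m)%N by apply: leq_trans twon; rewrite leq_pmull.
have nmL := HK _ _ N0n Kn; have B20 := normr_ge0 B2; split; first by lra.
rewrite leNgt; apply/negP => mnL.
have cn : c <= n%:R by apply: le_trans cc' _; rewrite ler_nat.
have cm : c <= m%:R by apply: le_trans cn _; rewrite ler_nat.
have cmn : c <= `|m%:R - n%:R|.
  rewrite ger0_norm ?subr_ge0 ?ler_nat// -natrB// (le_trans cn)// ler_nat.
  by rewrite leq_subRL// addnn -mul2n.
by have := H _ _ cm cn cmn (ltW mnL); have := ler_norm B2; lra.
Qed.

(** Each step contributes ln 2 and [bregman_chain] adds the steps up, in both directions.
    Exponentiated, this becomes the factor 2^-(i - j) in the block estimates. *)
Lemma peak_blocks : exists N0 K : nat, [/\ (0 < N0)%N, (1 < K)%N &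
  forall j i : nat, (j <= i)%N ->
    (i - j)%:R * ln 2 <= bregman (N0 * K ^ j)%:R (N0 * K ^ i)%:R /\
    (i - j)%:R * ln 2 <= bregman (N0 * K ^ i)%:R (N0 * K ^ j)%:R].
Proof.
have l2 : 0 < ln 2 :> R by rewrite ln_gt0// ltr1n.
have [K0 [N0 [N00 H]]] := bregman_separation2 l2.
pose K := maxn K0 2; have K1 : (1 < K)%N by rewrite leq_max orbT.
have K_gt0 : (0 < K)%N by exact: ltnW.
exists N0, K; split => // j i /subnK<-; rewrite addnK.
have Npos (k : nat) : (0 < N0 * K ^ k)%N by rewrite muln_gt0 N00 expn_gt0 K_gt0.
elim: (i - j)%N => [|d [IH1 IH2]].
  by rewrite !mul0r; split; apply: bregman_ge0; rewrite natr_gt0.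
rewrite addSn.
have [h1 h2] : ln 2 <= bregman (N0 * K ^ (d + j))%:R (N0 * K ^ (d + j).+1)%:R /\
    ln 2 <= bregman (N0 * K ^ (d + j).+1)%:R (N0 * K ^ (d + j))%:R.
  apply: H; first by rewrite leq_pmulr// expn_gt0 K_gt0.
  by rewrite expnS [leqRHS]mulnCA leq_mul// leq_maxl.
have le1 : (N0 * K ^ j)%:R <= (N0 * K ^ (d + j))%:R :> R.
  by rewrite ler_nat leq_mul// leq_pexp2l// leq_addl.
have le2 : (N0 * K ^ (d + j))%:R <= (N0 * K ^ (d + j).+1)%:R :> R.
  by rewrite ler_nat leq_mul// leq_pexp2l.
have [c1 c2] := bregman_chain (natr_gt0 (Npos j)) le1 le2.
rewrite -natr1 mulrDl mul1r; split.
  exact: le_trans (lerD IH1 h1) c1.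
by rewrite addrC; exact: le_trans (lerD h2 IH2) c2.
Qed.

End peaks.

(** * Coefficient multipliers on the weighted space *)

Section maximum_principle.
Variable R : realType.
Implicit Types (f : R[i] -> R[i]) (z w : R[i]) (r rho M : R).

(* Cauchy's estimate loses a constant, which disappears on taking roots after
   applying it to the powers of f. *)
Lemma max_modulus f rho M z : 0 < rho -> rho < 1 ->
  (forall w, unit_disc w -> cdiff f w) ->
  (forall w, modulus w = rho -> modulus (f w) <= M) ->
  modulus z <= rho -> modulus (f z) <= M.
Proof.
move=> rho0 rho1 hf fM; rewrite le_eqVlt => /orP[/eqP/fM//|zrho].
have eb : expR (ln rho) = rho by rewrite lnK.
have M0 : 0 <= M.
  by apply: le_trans (fM (polar (ln rho) 0) _); rewrite ?modulus_ge0// modulus_polar.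
pose r := (modulus z + rho) / 2.
have [zr rrho] : (modulus z < r) * (r < rho) by exact: midf_lt.
have hfK K : forall w, unit_disc w -> cdiff (fun w => f w ^+ K) w.
  move=> w wD; elim: K => [|K IH].
    by under eq_fun do rewrite expr0; exact: cdiff_cst.
  by under eq_fun do rewrite exprS; apply: cdiffM => //; exact: hf.
have lb : ln rho < 0 by rewrite ln_lt0// rho0.
have bound K : modulus (f z) ^+ K <= 2 / (1 - r / rho) * M ^+ K.
  have := @taylor_bound R _ (hfK K) z r (ln rho) (M ^+ K) 0 zr.
  rewrite eb big_ord0 subr0 modulusX expr0 mulr1 [leRHS]mulrAC; apply => //.
  move=> y; rewrite modulusX lerXn2r ?nnegrE ?modulus_ge0// fM// modulus_polar.
  by rewrite eb.
rewrite leNgt; apply/negP => Mf.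
have fz0 : 0 < modulus (f z) by exact: le_lt_trans Mf.
have t0 : 0 <= M / modulus (f z) by rewrite divr_ge0// ltW.
have t1 : M / modulus (f z) < 1 by rewrite ltr_pdivrMr// mul1r.
suff : 1 <= 0 :> R by rewrite leNgt ltr01.
apply: (@geometric_le0 R (M / modulus (f z)) (2 / (1 - r / rho))) => // n.
by rewrite expr_div_n mulrA ler_pdivlMr ?exprn_gt0// mul1r.
Qed.

Variable d : nat -> R[i].

Definition block m n z : R[i] := \sum_(m <= k < n) d k * z ^+ k.

Lemma cdiff_psum (c : nat -> R[i]) n z : cdiff (psum c n) z.
Proof.
apply: (@cdiff_sum _ (fun k w => c k * w ^+ k)) => k _.
by apply: cdiffM; [exact: cdiff_cst|exact: cdiffX].
Qed.

(** The block is z^m times a polynomial, to which the maximum principle on |z| <= rho applies. *)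
Lemma block_inner m n rho M z : (m <= n)%N -> 0 < rho -> rho < 1 ->
  (forall w, modulus w = rho -> modulus (block m n w) <= M) ->
  modulus z <= rho -> modulus (block m n z) <= (modulus z / rho) ^+ m * M.
Proof.
move=> mn rho0 rho1 bM zrho.
have bE w : block m n w = w ^+ m * psum (fun k => d (m + k)%N) (n - m) w.
  rewrite /block -{1}[m]add0n big_addn big_mkord mulr_sumr; apply: eq_bigr => k _.
  by rewrite addnC exprD mulrCA.
have gM w : modulus w = rho ->
    modulus (psum (fun k => d (m + k)%N) (n - m) w) <= M / rho ^+ m.
  move=> wrho; rewrite ler_pdivlMr ?exprn_gt0// mulrC.
  by have := bM w wrho; rewrite bE modulusM modulusX wrho.
have := max_modulus rho0 rho1 (fun w _ => cdiff_psum _ _ w) gM zrho.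
rewrite bE modulusM modulusX expr_div_n => H.
rewrite mulrAC -mulrA ler_wpM2l ?exprn_ge0 ?modulus_ge0//.
Qed.

(** The inversion w -> rho r / w, with r = |z|, exchanges the circles of radii rho and r. As the
    block has degree at most N, w^N times its transform is a polynomial, and the maximum principle
    on |w| <= r applies. *)
Lemma block_outer m n N rho M z : (n <= N.+1)%N -> 0 < rho ->
  (forall w, modulus w = rho -> modulus (block m n w) <= M) ->
  rho <= modulus z -> modulus z < 1 ->
  modulus (block m n z) <= (modulus z / rho) ^+ N * M.
Proof.
move=> nN rho0 bM zrho z1; set r := modulus z.
have r0 : 0 < r by exact: lt_le_trans zrho.
pose q w := \sum_(m <= k < n) d k * (rho * r)%:C ^+ k * w ^+ (N - k).
have qd w : cdiff q w.
  rewrite /q; elim: (index_iota m n) => [|k s IH].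
    by under eq_fun do rewrite big_nil; exact: cdiff_cst.
  under eq_fun do rewrite big_cons; apply: cdiffD => //.
  by apply: cdiffM; [exact: cdiff_cst|exact: cdiffX].
have qE w : w != 0 -> q w = w ^+ N * block m n ((rho * r)%:C / w).
  move=> w0; rewrite /block mulr_sumr; apply: eq_big_nat => k /andP[_ kn].
  have kN : (k <= N)%N by rewrite -ltnS (leq_trans kn).
  rewrite -[in w ^+ N](subnK kN) exprD expr_div_n.
  move: ((rho * r)%:C ^+ k) (w ^+ (N - k)) => X Y.
  by field; rewrite expf_neq0.
have rr : modulus (rho * r)%:C = rho * r.
  by rewrite modulus_real ger0_norm// mulr_ge0// ltW.
have qM w : modulus w = r -> modulus (q w) <= r ^+ N * M.
  move=> wr; have w0 : w != 0 by rewrite -modulus_gt0 wr.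
  rewrite qE// modulusM modulusX wr ler_wpM2l ?exprn_ge0 ?(ltW r0)//.
  by apply: bM; rewrite modulusM modulusV rr wr mulfK// gt_eqF.
have z0 : z != 0 by rewrite -modulus_gt0.
pose w := (rho * r)%:C / z.
have mw : modulus w = rho by rewrite modulusM modulusV rr mulfK// gt_eqF.
have w0 : w != 0 by rewrite -modulus_gt0 mw.
have := max_modulus r0 z1 (fun w _ => qd w) qM (z := w).
rewrite mw => /(_ zrho); rewrite qE// modulusM modulusX mw.
have -> : (rho * r)%:C / w = z.
  rewrite /w invf_div mulrCA mulfV ?mulr1//.
  by rewrite -modulus_eq0 rr mulf_neq0// gt_eqF.
by rewrite expr_div_n mulrAC ler_pdivlMr ?exprn_gt0// mulrC.
Qed.

End maximum_principle.

Section abel.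
Variable R : realType.
Implicit Types (c g : nat -> R[i]) (tau : nat -> R).

(* tau dominates g together with its total variation from n on *)
Definition dominated g tau := forall n,
  modulus (g n) <= tau n /\ modulus (g n - g n.+1) <= tau n - tau n.+1.

(** The boundary terms cost (tau n + tau m) B and the variation (tau m - tau n) B; the terms in tau
    n cancel, whence the factor 2 tau m. *)
Lemma abel_summation c g tau m n z (B : R) : dominated g tau -> (m <= n)%N ->
  (forall k, (k <= n)%N -> modulus (psum c k z) <= B) ->
  modulus (block (fun k => g k * c k) m n z) <= 2 * B * tau m.
Proof.
move=> gt mn SB.
have B0 : 0 <= B by apply: le_trans (SB 0%N _) => //; exact: modulus_ge0.
have E : block (fun k => g k * c k) m n z = g n * psum c n z - g m * psum c m z +
    \sum_(m <= k < n) (g k - g k.+1) * psum c k.+1 z.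
  rewrite -(subnKC mn); elim: (n - m)%N => [|k IH].
    by rewrite addn0 /block !big_geq// addr0 subrr.
  rewrite addnS /block !big_nat_recr ?leq_addr//= -/(block _ _ _ _) IH.
  rewrite /psum big_ord_recr/= -/(psum c (m + k) z).
  by move: (psum c (m + k) z) (z ^+ (m + k)) (\sum_(m <= _ < _) _) => S Z X; ring.
rewrite E; apply: le_trans (modulusD _ _) _.
have h1 : modulus (g n * psum c n z - g m * psum c m z) <= (tau n + tau m) * B.
  apply: le_trans (modulusB _ _) _; rewrite !modulusM mulrDl lerD//.
    by apply: ler_pM; rewrite ?modulus_ge0 ?SB//; have [] := gt n.
  by apply: ler_pM; rewrite ?modulus_ge0 ?SB//; have [] := gt m.
have h2 : modulus (\sum_(m <= k < n) (g k - g k.+1) * psum c k.+1 z) <=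
    (tau m - tau n) * B.
  apply: le_trans (modulus_sum _ _ _) _.
  have -> : tau m - tau n = \sum_(m <= k < n) (tau k - tau k.+1).
    rewrite -opprB -(telescope_sumr _ mn) -sumrN.
    by apply: eq_bigr => k _; rewrite opprB.
  rewrite mulr_suml !big_nat; apply: ler_sum => k /andP[_ kn].
  by rewrite modulusM; apply: ler_pM; rewrite ?modulus_ge0 ?SB//; have [] := gt k.
apply: le_trans (lerD h1 h2) _.
by rewrite le_eqVlt; apply/orP; left; apply/eqP; ring.
Qed.

(** Two geometric series: at most 4 A from the indices below i and 2 A from the others. The shift j
    + 1 reflects that a block seen from outside is measured at the peak of its upper end. *)
Lemma sum_two_sided (b : nat -> R) (A : R) i :
  (forall j, (i <= j)%N -> b j <= A * 2^-1 ^+ (j - i)) ->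
  (forall j, (j < i)%N -> b j <= A * (2 * 2^-1 ^+ (i - j.+1))) ->
  0 <= A -> forall J, \sum_(j < J) b j <= 6 * A.
Proof.
move=> bge blt A0 J.
have low J' : (J' <= i)%N -> \sum_(j < J') b j <= A * (4 * 2^-1 ^+ (i - J')).
  elim: J' => [_|J' IH Ji].
    by rewrite big_ord0 !mulr_ge0// exprn_ge0// invr_ge0.
  rewrite big_ord_recr/=; apply: le_trans (lerD (IH (ltnW Ji)) (blt _ Ji)) _.
  rewrite -mulrDr ler_wpM2l// -subSS subSn// exprS.
  by move: (2^-1 ^+ _) => X; rewrite le_eqVlt; apply/orP; left; apply/eqP; field.
have high k : \sum_(j < i + k) b j <= A * (6 - 2 * 2^-1 ^+ k).
  elim: k => [|k IH].
    rewrite addn0; apply: le_trans (low i (leqnn _)) _.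
    by rewrite subnn !expr0 !mulr1 ler_wpM2l//; lra.
  rewrite addnS big_ord_recr/=; apply: le_trans (lerD IH (bge _ (leq_addr _ _))) _.
  rewrite -mulrDr ler_wpM2l// addnC addnK exprS.
  by move: (2^-1 ^+ _) => X; rewrite le_eqVlt; apply/orP; left; apply/eqP; field.
have [Ji|iJ] := leqP J i.
  apply: le_trans (low _ Ji) _; rewrite mulrC ler_wpM2r//.
  have : 2^-1 ^+ (i - J) <= 1 :> R by rewrite exprn_ile1 ?invr_ge0 ?invf_le1 ?ler1n.
  by lra.
rewrite -(subnKC (ltnW iJ)); apply: le_trans (high _) _; rewrite mulrC ler_wpM2r//.
by rewrite gerBl mulr_ge0// exprn_ge0// invr_ge0.
Qed.

End abel.

Section peak_decay.
Variable R : realType.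
Variable v : weight R.
Variable rho : R -> R.
Hypothesis peak : peak_points v rho.

(** At exponent n the value at r is at most the value at rho_n. The factor r^(m - n) left over is
    controlled by the sign condition, which says that rho_n separates r from rho_m. *)
Lemma peak_decay (m n : nat) (r : R) : (0 < m)%N -> (0 < n)%N -> 0 < r -> r < 1 ->
  (m%:R - n%:R) * (ln r - lrho rho n%:R) <= 0 ->
  (r / rho m%:R) ^+ m * (profile v r / profile v (rho m%:R)) <=
  expR (- bregman v rho m%:R n%:R).
Proof.
move=> m0 n0 r0 r1 H.
have m0R : 0 < m%:R :> R by rewrite ltr0n.
have n0R : 0 < n%:R :> R by rewrite ltr0n.
have rm := rho_gt0 peak m0R; have pm := profile_rho peak m0R.
have pr := profile_gt0 v (ltW r0) r1.
have pos : 0 < (r / rho m%:R) ^+ m * (profile v r / profile v (rho m%:R)).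
  by rewrite mulr_gt0 ?exprn_gt0 ?divr_gt0.
rewrite -[leLHS]lnK ?posrE// ler_expR lnM ?posrE ?exprn_gt0 ?divr_gt0//.
rewrite lnXn ?divr_gt0// !ln_div ?posrE// -mulr_natl.
have := peak_log peak n0R r0 r1.
by move: H; rewrite /bregman /lrho /lprof; lra.
Qed.

End peak_decay.

(** * Norm bound for logarithmically decaying multipliers *)

Section multiplier_bound.
Variable R : realType.
Variable v : weight R.

Lemma weight_profile (z : R[i]) : unit_disc z -> v (modulus z)%:C = profile v (modulus z).
Proof. by move=> zD; rewrite profileE. Qed.

Lemma weighted_bounded_circles (h : R[i] -> R[i]) (H : R) :
  (forall z, unit_disc z -> modulus (h z) * v (modulus z)%:C <= H) ->
  forall rho : R, 0 < rho -> rho < 1 ->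
    exists M, forall z, modulus z = rho -> modulus (h z) <= M.
Proof.
move=> hH rho rho0 rho1; exists (H / profile v rho) => z zrho.
have zD : unit_disc z by rewrite /unit_disc/= zrho.
have := hH z zD; rewrite weight_profile// zrho -ler_pdivlMr//.
exact: profile_gt0 (ltW rho0) rho1.
Qed.

Lemma dominated_radius (g : nat -> R[i]) (tau : nat -> R) (c : nat -> R[i]) :
  dominated g tau -> radius_ge 1 c -> radius_ge 1 (fun k => g k * c k).
Proof.
move=> gt cr s s0 s1; have [A HA] := cr s s0 s1.
have tau_le n : tau n <= tau 0%N.
  elim: n => // n IH; apply: le_trans IH; rewrite -subr_ge0.
  by have [_] := gt n; apply: le_trans; exact: modulus_ge0.
exists (tau 0%N * A) => k; rewrite modulusM -mulrA; apply: ler_pM.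
- exact: modulus_ge0.
- by rewrite mulr_ge0 ?modulus_ge0// exprn_ge0// ltW.
- by have [+ _] := gt k; move=> /le_trans; apply.
- exact: HA.
Qed.

Lemma multiplier_bound : condition_B v -> exists2 C : R, 0 < C &
  forall (E H : R) (h : R[i]^o -> R[i]^o) (g : nat -> R[i]) (tau : nat -> R),
    holomorphic_disc h ->
    (forall z, unit_disc z -> modulus (h z) * v (modulus z)%:C <= H) ->
    dominated g tau -> (forall n, tau n * ln (n%:R + 2) <= E) ->
    forall z, unit_disc z ->
      modulus (pser (fun k => g k * taylor_coef h k) z) * v (modulus z)%:C <= C * E * H.
Proof.
move=> [rho peak B].
have [N0 [K [N00 K1 sep]]] := peak_blocks peak B.
have [C0 C00 HC0] := psum_log R.
have l2 : 0 < ln 2 :> R by rewrite ln_gt0// ltr1n.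
have K_gt0 : (0 < K)%N by exact: ltnW.
have lnK_ge0 : 0 <= ln K%:R :> R by rewrite ln_ge0// ler1n.
have lnN0_ge0 : 0 <= ln (N0%:R + 2) :> R by rewrite ln_ge0// ler_wpDl// ler1n.
(* ln(N_(j+1) + 2) <= K' ln(N_j + 2): within a block the logarithm changes by a bounded factor only,
   so tau at the lower end balances the logarithm at the upper end. *)
pose K' : R := 1 + ln K%:R / ln 2; have K'0 : 0 < K' by rewrite ltr_wpDr// divr_ge0// ltW.
(* The three summands bound, in order, the blocks j >= 0, the initial block below N_0 and the value
   at z = 0. *)
pose A1 := 2 * C0 * K' + 2 * C0 * ln (N0%:R + 2) / ln 2 + (ln 2)^-1.
have A10 : 0 <= 2 * C0 * K' by rewrite !mulr_ge0// ltW.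
have A20 : 0 <= 2 * C0 * ln (N0%:R + 2) / ln 2.
  by rewrite divr_ge0 ?(ltW l2)// mulr_ge0// mulr_ge0// ltW.
have A30 : 0 < (ln 2)^-1 :> R by rewrite invr_gt0.
have A1_gt0 : 0 < A1 by rewrite ltr_wpDl// addr_ge0.
(* 1 for the initial block and 6 from [sum_two_sided]. *)
exists (7 * A1); first by rewrite mulr_gt0.
move=> E H h g tau hol hH gt tauE z zD.
have hb := weighted_bounded_circles hH.
have rad := taylor_radius hol hb.
set c := taylor_coef h; set d := fun k => g k * c k.
have radd : radius_ge 1 d by exact: dominated_radius rad.
have tau_dec n m : (n <= m)%N -> tau m <= tau n.
  move=> /subnK<-; elim: (m - n)%N => // i IH; rewrite addSn.
  apply: le_trans IH; rewrite -subr_ge0.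
  by have [_] := gt (i + n)%N; apply: le_trans; exact: modulus_ge0.
have tau_ge0 n : 0 <= tau n by have [+ _] := gt n; apply: le_trans; exact: modulus_ge0.
have lnn (n : nat) : ln 2 <= ln (n%:R + 2) :> R by rewrite ler_ln ?posrE ?lerDr ?ltr_wpDl.
have H0 : 0 <= H.
  have z0 : unit_disc (0 : R[i]) by rewrite /unit_disc/= modulus0 ltr01.
  by apply: le_trans (hH _ z0); rewrite mulr_ge0 ?modulus_ge0// weight_profile// profile_ge0// modulus0.
have E0 : 0 <= E.
  by apply: le_trans (tauE 0%N); rewrite mulr_ge0// (le_trans (ltW l2)).
have EH : 0 <= E * H by exact: mulr_ge0.
pose N j := (N0 * K ^ j)%N.
have Npos j : (0 < N j)%N by rewrite muln_gt0 N00 expn_gt0 K_gt0.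
have Nle j i : (j <= i)%N -> (N j <= N i)%N by move=> ji; rewrite leq_mul// leq_pexp2l.
pose A := A1 * (E * H).
have A0 : 0 <= A by rewrite mulr_ge0// ltW.
have part_bound w n m : unit_disc w -> (m <= n)%N ->
    modulus (block d m n w) * profile v (modulus w) <=
    2 * C0 * H * (ln (n%:R + 2) * tau m).
  move=> wD mn; have pw := profile_gt0 v (modulus_ge0 w) wD.
  rewrite -ler_pdivlMr//.
  have hw u : modulus u = modulus w -> modulus (h u) <= H / profile v (modulus w).
    move=> uw; have uD : unit_disc u by rewrite /unit_disc/= uw.
    by have := hH u uD; rewrite weight_profile// uw -ler_pdivlMr.
  have SB k : (k <= n)%N -> modulus (psum c k w) <=
      C0 * ln (n%:R + 2) * (H / profile v (modulus w)).
    move=> kn; apply: le_trans (HC0 h hol hb w _ k wD hw) _.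
    rewrite ler_wpM2r ?divr_ge0 ?(ltW pw)// ler_wpM2l ?(ltW C00)//.
    by rewrite ler_ln ?posrE ?ltr_wpDl// lerD2r ler_nat.
  apply: le_trans (abel_summation gt mn SB) _.
  by rewrite le_eqVlt; apply/orP; left; apply/eqP; field; rewrite gt_eqF.
have blk_bound j w : unit_disc w ->
    modulus (block d (N j) (N j.+1) w) * profile v (modulus w) <= A.
  move=> wD; apply: le_trans (part_bound w _ _ wD (Nle _ _ (leqnSn j))) _.
  have lnNK : ln ((N j.+1)%:R + 2) <= K' * ln ((N j)%:R + 2) :> R.
    apply: (@le_trans _ _ (ln (K%:R * ((N j)%:R + 2)))).
      rewrite ler_ln ?posrE ?mulr_gt0 ?ltr_wpDl ?ltr0n// mulrDr /N expnS mulnCA natrM.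
      by rewrite lerD2l ler_peMl// ler1n.
    rewrite lnM ?posrE ?ltr_wpDl ?ltr0n// /K' mulrDl mul1r addrC lerD2l.
    by rewrite mulrAC ler_pdivlMr// ler_wpM2l.
  apply: (@le_trans _ _ (2 * C0 * H * (K' * E))).
    rewrite ler_wpM2l// ?mulr_ge0 ?(ltW C00)//.
    apply: le_trans (ler_wpM2r (tau_ge0 _) lnNK) _.
    by rewrite -mulrA ler_wpM2l ?(ltW K'0)// mulrC tauE.
  rewrite /A /A1 [2 * C0 * H * _](_ : _ = 2 * C0 * K' * (E * H)); last by ring.
  by rewrite ler_wpM2r// -addrA lerDl addr_ge0// ltW.
have blk0_bound w : unit_disc w ->
    modulus (block d 0 (N 0) w) * profile v (modulus w) <= A.
  move=> wD; apply: le_trans (part_bound w _ _ wD (leq0n _)) _.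
  have tau0 : tau 0%N <= E / ln 2.
    by rewrite ler_pdivlMr//; have := tauE 0%N; rewrite add0r.
  have -> : (N 0)%:R = N0%:R :> R by rewrite /N expn0 muln1.
  apply: (@le_trans _ _ (2 * C0 * H * (ln (N0%:R + 2) * (E / ln 2)))).
    by rewrite ler_wpM2l ?mulr_ge0 ?(ltW C00)// ler_wpM2l.
  rewrite /A /A1 [leLHS](_ : _ = 2 * C0 * ln (N0%:R + 2) / ln 2 * (E * H)); last by ring.
  by rewrite ler_wpM2r// addrAC lerDr addr_ge0// ltW.
have zD' : modulus z < 1 by exact: zD.
rewrite weight_profile//.
have [z0|z0] := eqVneq z 0.
  subst z; rewrite (pser0 ltr01 radd).
  rewrite /d modulusM.
  have h0 := hH 0 zD; rewrite weight_profile// in h0.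
  have -> : c 0%N = h 0 by rewrite /c /taylor_coef derive1n0 fact0 divr1.
  have t0 : modulus (g 0%N) <= E / ln 2.
    by have [+ _] := gt 0%N; move=> /le_trans; apply; rewrite ler_pdivlMr//; have := tauE 0%N; rewrite add0r.
  rewrite -mulrA; apply: le_trans (ler_pM (modulus_ge0 _) _ t0 h0) _.
    by rewrite mulr_ge0 ?modulus_ge0// profile_ge0// modulus_ge0.
  have -> : E / ln 2 * H = (ln 2)^-1 * (E * H) by ring.
  rewrite -[leRHS]mulrA ler_wpM2r//.
  by apply: (@le_trans _ _ A1); [rewrite /A1 lerDr addr_ge0|rewrite ler_peMl ?(ltW A1_gt0)// ler1n].
set r := modulus z in zD' *.
have r0 : 0 < r by rewrite /r modulus_gt0.
have pr := profile_gt0 v (ltW r0) zD'.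
have NR0 j : 0 < (N j)%:R :> R by rewrite ltr0n.
have rhoN0 j : 0 < rho (N j)%:R by have := rho_gt0 peak (NR0 j).
have rho_mono j k : (j <= k)%N -> rho (N j)%:R <= rho (N k)%:R.
  move=> jk; have := lrho_le peak (NR0 j) (_ : (N j)%:R <= (N k)%:R :> R).
  by rewrite /lrho ler_ln ?posrE//; apply; rewrite ler_nat Nle.
have [i0 Hi0] : exists i, r <= rho (N i)%:R.
  have [A' HA'] := lprof_cvgN peak (ln (profile v r) - 1).
  have [A'1 HA''] := HA'.
  exists (Num.bound A'); rewrite leNgt; apply/negP => rr.
  have bA : A' <= (N (Num.bound A'))%:R.
    apply: (@le_trans _ _ (Num.bound A')%:R).
      by rewrite ltW// archi_boundP// (le_trans _ A'1).
    rewrite ler_nat; apply: (@leq_trans (K ^ Num.bound A')); last by rewrite leq_pmull.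
    by rewrite ltnW// ltn_expl.
  have := HA'' _ bA; rewrite /lprof.
  have := profile_le v (rho_gt0 peak (NR0 _)) (ltW rr) zD'.
  rewrite -ler_ln ?posrE ?profile_rho//.
  by set X := ln (profile v (rho _)); lra.
(* The first i whose peak radius is at least |z|: the blocks j >= i are estimated from inside their
   peak circle, those with j < i from outside. *)
have [i ri imin] := ex_minnP (ex_intro (fun i => r <= rho (N i)%:R) i0 Hi0).
have exp_half k (x : R) : k%:R * ln 2 <= x -> expR (- x) <= 2^-1 ^+ k.
  move=> kx; rewrite exprVn expRN lef_pV2 ?posrE ?expR_gt0 ?exprn_gt0//.
  by rewrite -[leLHS]lnK ?posrE ?exprn_gt0// ler_expR lnXn// -[leLHS]mulr_natl.
have circ (s : R) (f : R[i] -> R[i]) : 0 < s -> s < 1 ->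
    (forall w, unit_disc w -> modulus (f w) * profile v (modulus w) <= A) ->
    forall w, modulus w = s -> modulus (f w) <= A / profile v s.
  move=> s0 s1 fA w ws; have wD : unit_disc w by rewrite /unit_disc/= ws.
  by have := fA w wD; rewrite ws -ler_pdivlMr//; exact: profile_gt0 (ltW s0) s1.
pose b j := modulus (block d (N j) (N j.+1) z) * profile v r.
have b_ge j : (i <= j)%N -> b j <= A * 2^-1 ^+ (j - i).
  move=> ij; have rj := rho_in peak (NR0 j).
  have /andP[rj0 rj1] := rj.
  have zj : modulus z <= rho (N j)%:R by exact: le_trans ri (rho_mono _ _ ij).
  have := block_inner (Nle _ _ (leqnSn j)) rj0 rj1 (circ _ _ rj0 rj1 (blk_bound j)) zj.
  move=> /(ler_wpM2r (ltW pr)); rewrite -/r -/(b j) => /le_trans; apply.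
  rewrite [leLHS](_ : _ = A * ((r / rho (N j)%:R) ^+ N j *
     (profile v r / profile v (rho (N j)%:R)))); last by ring.
  rewrite ler_wpM2l//; apply: le_trans (peak_decay peak (Npos j) (Npos i) r0 zD' _) _.
    apply: mulr_ge0_le0; first by rewrite subr_ge0 ler_nat Nle.
    by rewrite subr_le0 /lrho ler_ln ?posrE.
  by apply: exp_half; have [_] := sep _ _ ij.
have b_lt j : (j < i)%N -> b j <= A * (2 * 2^-1 ^+ (i - j.+1)).
  (* For j = i - 1 the point may lie strictly between the peaks of the two ends of the block, and
     only the uniform bound is available. *)
  move=> ji; have [->|ji1] := eqVneq i j.+1.
    rewrite subnn expr0 mulr1; apply: le_trans (blk_bound j z zD) _.
    by rewrite ler_peMr// ler1n.
  have {}ji1 : (j.+1 <= i.-1)%N by move: ji ji1; case: (i) => // i' /=; rewrite !ltnS => ji /negP ne; rewrite ltn_neqAle ji andbT; apply/negP => /eqP jE; apply: ne; rewrite jE.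
  have i0' : (0 < i)%N by exact: leq_trans ji.
  have rlt : rho (N i.-1)%:R < r.
    by rewrite ltNge; apply/negP => /imin; rewrite -{1}(prednK i0') ltnn.
  have /andP[rj0 rj1] := rho_in peak (NR0 j.+1).
  have zj : rho (N j.+1)%:R <= modulus z by exact: le_trans (rho_mono _ _ ji1) (ltW rlt).
  have := block_outer (leqnSn (N j.+1)) rj0 (circ _ _ rj0 rj1 (blk_bound j)) zj zD'.
  move=> /(ler_wpM2r (ltW pr)); rewrite -/r -/(b j) => /le_trans; apply.
  rewrite [leLHS](_ : _ = A * ((r / rho (N j.+1)%:R) ^+ N j.+1 *
     (profile v r / profile v (rho (N j.+1)%:R)))); last by ring.
  rewrite ler_wpM2l//.
  apply: le_trans (peak_decay peak (Npos j.+1) (Npos i.-1) r0 zD' _) _.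
    apply: mulr_le0_ge0; first by rewrite subr_le0 ler_nat Nle.
    by rewrite subr_ge0 /lrho ler_ln ?posrE// ltW.
  have -> : 2 * 2^-1 ^+ (i - j.+1) = 2^-1 ^+ (i.-1 - j.+1) :> R.
    by rewrite -{1}(prednK i0') subSn// exprS mulrA mulfV// mul1r.
  by apply: exp_half; have [+ _] := sep _ _ ji1.
have partial J : modulus (psum d (N J) z) * profile v r <= 7 * A.
  have -> : psum d (N J) z = block d 0 (N 0) z + \sum_(j < J) block d (N j) (N j.+1) z.
    elim: J => [|J IH]; first by rewrite big_ord0 addr0 /psum /block big_mkord.
    rewrite big_ord_recr/= addrA -IH /psum /block -!(big_mkord xpredT (fun k => d k * z ^+ k)).
    by rewrite -big_cat_nat//= Nle.
  apply: le_trans (ler_wpM2r (ltW pr) (modulusD _ _)) _; rewrite mulrDl.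
  have -> : 7 * A = A + 6 * A by ring.
  apply: lerD; first exact: blk0_bound.
  apply: le_trans (ler_wpM2r (ltW pr) (modulus_sum _ _ _)) _; rewrite mulr_suml.
  exact: (sum_two_sided b_ge b_lt A0).
have [Q [t [Q0 t0 t1 tail]]] := radius_tail radd zD' ltr01.
have -> : 7 * A1 * E * H = 7 * A by rewrite /A; ring.
rewrite -subr_le0; apply: (@geometric_le0 R t (Q * profile v r)) => // J.
rewrite lerBlDr.
have JN : (J <= N J)%N by rewrite (@leq_trans (K ^ J))// ?leq_pmull// ltnW// ltn_expl.
have -> : pser d z = (pser d z - psum d (N J) z) + psum d (N J) z by rewrite subrK.
apply: le_trans (ler_wpM2r (ltW pr) (modulusD _ _)) _; rewrite mulrDl lerD//.
rewrite mulrAC ler_wpM2r ?(ltW pr)//; apply: le_trans (tail z (N J) (lexx _)) _.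
by rewrite ler_wpM2l// ler_wiXn2l// ltW.
Qed.

End multiplier_bound.

(** * Moments of monotone radial functions *)

Lemma open_unit_disc (R : realType) : open (@unit_disc R).
Proof.
rewrite openE => z zD; apply/nbhs_ballP.
exists (1 - modulus z)%:C => [|w /ball_modulus wz]; first by rewrite /= ltcR subr_gt0.
rewrite /unit_disc/= -(subrK z w); apply: le_lt_trans (modulusD _ _) _.
by rewrite modulusC -ltrBrDr.
Qed.

Section moments.
Variable R : realType.
Variable v : weight R.
Notation mu := (@lebesgue_measure R).
Implicit Types (f g : R -> R) (p n : nat) (r s K q A : R).

(** At r = 1 the left limit is the hypothesis that v tends to 0 and the right limit is the
    convention that [profile] vanishes from 1 on. *)
Lemma profile_continuous : continuous_on (profile v) 0 1.
Proof.
move=> r /andP[r0]; rewrite le_eqVlt => /orP[/eqP->|r1].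
  apply/left_right_continuousP; split.
    rewrite /profile ltxx.
    have := weight_cvg0 v; apply: cvg_trans; apply: near_eq_cvg.
    by near=> s; rewrite ifT//; near: s; exact: nbhs_left_lt.
  rewrite /profile ltxx; apply: cvg_near_cst; near=> s.
  by rewrite ifF//; apply/negbTE; rewrite -leNgt ltW//; near: s; exact: nbhs_right_gt.
have cv : {for r, continuous (fun s : R => v s%:C)}.
  have rD : unit_disc (r%:C : R[i]) by apply: unit_disc_real => //; exact: lt_le_trans r0.
  have cr : (s%:C : R[i]^o) @[s --> r] --> (r%:C : R[i]^o).
    apply/cvg_modulusP => e e0; near=> s.
    rewrite -rmorphB modulus_real distrC; near: s.
    by exists e.
  have cw := @weight_continuous R v; rewrite continuous_open_subspace in cw; last exact: open_unit_disc.
  exact: (cvg_comp _ _ cr (cw _ (mem_set rD))).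
change (profile v s @[s --> r] --> profile v r); rewrite (profileE v r1).
apply: cvg_trans cv; apply: near_eq_cvg.
by near=> s; rewrite /profile ifT//; near: s; exact: lt_nbhsl.
Unshelve. all: by end_near. Qed.

Lemma moment_continuous f p : continuous_on f 0 1 ->
  continuous_on (fun r => r ^+ p * profile v r * f r) 0 1.
Proof.
move=> cf r r01; apply: continuousM; last exact: cf.
by apply: continuousM; [exact: exprn_continuous|exact: profile_continuous].
Qed.

Lemma moment_integrable f p : continuous_on f 0 1 ->
  mu.-integrable `[0, 1] (EFin \o (fun r => r ^+ p * profile v r * f r)).
Proof. by move=> cf; apply: continuous_on_integrable; exact: moment_continuous. Qed.

Lemma momentD f g p : continuous_on f 0 1 -> continuous_on g 0 1 ->
  moment v (fun r => f r + g r) p = moment v f p + moment v g p.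
Proof.
move=> cf cg; rewrite /moment -RintegralD//; try exact: moment_integrable.
by apply: eq_Rintegral => r _; rewrite mulrDr.
Qed.

Lemma momentZ f (c : R) p : continuous_on f 0 1 ->
  moment v (fun r => c * f r) p = c * moment v f p.
Proof.
move=> cf; rewrite /moment -RintegralZl//; last exact: moment_integrable.
by apply: eq_Rintegral => r _; rewrite mulrCA.
Qed.

Lemma moment_shift f (p q : nat) : moment v (fun r => r ^+ p * f r) q = moment v f (p + q).
Proof. by apply: eq_Rintegral => r _; rewrite exprD; ring. Qed.

Lemma moment_le f g p : continuous_on f 0 1 -> continuous_on g 0 1 ->
  (forall r, 0 <= r -> r <= 1 -> f r <= g r) -> moment v f p <= moment v g p.
Proof.
move=> cf cg fg; apply: le_Rintegral => //; try exact: moment_integrable.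
move=> r /=; rewrite in_itv/= => /andP[r0 r1].
by rewrite ler_wpM2l ?fg// mulr_ge0 ?exprn_ge0// profile_ge0.
Qed.

Lemma continuous_on_cst (c a b : R) : continuous_on (fun=> c) a b.
Proof. by move=> r _; exact: cst_continuous. Qed.

Lemma continuous_onX p (a b : R) : continuous_on (fun r : R => r ^+ p) a b.
Proof. by move=> r _; exact: exprn_continuous. Qed.

Lemma continuous_onM f g (a b : R) : continuous_on f a b -> continuous_on g a b ->
  continuous_on (fun r => f r * g r) a b.
Proof. by move=> cf cg r rab; apply: continuousM; [exact: cf|exact: cg]. Qed.

Lemma continuous_onD f g (a b : R) : continuous_on f a b -> continuous_on g a b ->
  continuous_on (fun r => f r + g r) a b.
Proof. by move=> cf cg r rab; apply: continuousD; [exact: cf|exact: cg]. Qed.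

(** The mass between s and 1 already gives this lower bound. With s > r_1 it makes any contribution
    of size r_1^p negligible after division by the moment. *)
Lemma moment_lower s : 0 < s -> s < 1 ->
  exists2 c : R, 0 < c & forall p, c * s ^+ p <= moment v (fun=> 1) p.
Proof.
move=> s0 s1; pose t := (s + 1) / 2.
have [st t1] : (s < t) * (t < 1) by exact: midf_lt.
have t0 : 0 < t by exact: lt_trans st.
exists ((t - s) * profile v t) => [|p].
  by rewrite mulr_gt0 ?subr_gt0// profile_gt0// ltW.
have cm := @moment_continuous _ p (@continuous_on_cst 1 0 1).
have cm' : continuous_on (fun r => r ^+ p * profile v r * 1) s 1.
  by move=> r /andP[sr r1]; apply: cm; rewrite (le_trans (ltW s0) sr).
rewrite /moment (Rintegral_split (ltW s0) (ltW s1))// ler_wpDl//.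
  apply: Rintegral_ge0 => r; rewrite /= in_itv/= => /andP[r0 _].
  by rewrite mulr1 mulr_ge0 ?exprn_ge0// profile_ge0.
rewrite (Rintegral_split (ltW st) (ltW t1))// ler_wpDr//.
  apply: Rintegral_ge0 => r; rewrite /= in_itv/= => /andP[tr _].
  have r0 := le_trans (ltW t0) tr.
  by rewrite mulr1 mulr_ge0 ?exprn_ge0// profile_ge0.
have <- : \int[mu]_(r in `[s, t]) (s ^+ p * profile v t) = (t - s) * profile v t * s ^+ p.
  by rewrite Rintegral_cst//= lebesgue_measure_itv/= lte_fin st/=; ring.
apply: le_Rintegral => //.
- exact: continuous_on_integrable (@continuous_on_cst _ _ _).
- apply: continuous_on_integrable => r /andP[sr rt]; apply: cm'.
  by rewrite sr (le_trans rt (ltW t1)).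
- move=> r /=; rewrite in_itv/= => /andP[sr rt]; have r0 := lt_le_trans s0 sr.
  rewrite mulr1; apply: ler_pM; rewrite ?exprn_ge0 ?profile_ge0 ?(ltW s0) ?(ltW t0)//.
    by rewrite lerXn2r ?nnegrE ?(ltW s0) ?(ltW r0).
  exact: profile_le.
Qed.

Lemma moment_gt0 p : 0 < moment v (fun=> 1) p.
Proof.
have h0 : 0 < 2^-1 :> R by rewrite invr_gt0.
have h1 : 2^-1 < 1 :> R by rewrite invf_lt1// ltr1n.
have [c c0 /(_ p)] := moment_lower h0 h1.
by apply: lt_le_trans; rewrite mulr_gt0// exprn_gt0.
Qed.

Definition mean f p : R := moment v f p / moment v (fun=> 1) p.

Lemma meanD f g p : continuous_on f 0 1 -> continuous_on g 0 1 ->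
  mean (fun r => f r + g r) p = mean f p + mean g p.
Proof. by move=> cf cg; rewrite /mean momentD// mulrDl. Qed.

Lemma meanZ f (c : R) p : continuous_on f 0 1 ->
  mean (fun r => c * f r) p = c * mean f p.
Proof. by move=> cf; rewrite /mean momentZ// mulrA. Qed.

Lemma mean_ge0 f p : (forall r, 0 <= r -> r <= 1 -> 0 <= f r) -> 0 <= mean f p.
Proof.
move=> f0; apply: divr_ge0; last exact: ltW (moment_gt0 p).
apply: Rintegral_ge0 => r; rewrite /= in_itv/= => /andP[r0 r1].
by rewrite mulr_ge0 ?f0// mulr_ge0 ?exprn_ge0// profile_ge0.
Qed.

Definition nonincr01 f := forall r s, 0 <= r -> r <= s -> s <= 1 -> f s <= f r.

(* Chebyshev: (r^2 - k) and f r - f (sqrt k) have opposite signs, and k is the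
   mean of r^2, so that the constant f (sqrt k) does not contribute. *)
Lemma mean_nonincr f p : continuous_on f 0 1 -> nonincr01 f ->
  mean f p.+2 <= mean f p.
Proof.
move=> cf nf; have m0 := moment_gt0 p; have m2 := moment_gt0 p.+2.
pose k : R := moment v (fun=> 1) p.+2 / moment v (fun=> 1) p.
have k0 : 0 <= k by rewrite divr_ge0// ltW.
have c1 := @continuous_on_cst 1 0 1.
have cX : continuous_on (fun r : R => r ^+ 2 * 1) 0 1.
  by apply: continuous_onM => //; exact: continuous_onX.
have k1 : k <= 1.
  rewrite ler_pdivrMr// mul1r -(addn2 p) addnC -moment_shift; apply: moment_le => //.
  by move=> r r0 r1; rewrite mulr1 exprn_ile1.
pose s := Num.sqrt k.
have s0 : 0 <= s by exact: sqrtr_ge0.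
have s1 : s <= 1 by rewrite -sqrtr1 ler_wsqrtr.
have sk : s ^+ 2 = k by rewrite sqr_sqrtr.
have cXf : continuous_on (fun r : R => r ^+ 2 * f r) 0 1.
  by apply: continuous_onM => //; exact: continuous_onX.
have ckf c : continuous_on (fun r : R => c * f r) 0 1.
  by apply: continuous_onM => //; exact: continuous_on_cst.
have cc c : continuous_on (fun r : R => c * 1) 0 1 by exact: continuous_on_cst.
have cX' c : continuous_on (fun r : R => c * (r ^+ 2 * 1)) 0 1.
  by apply: continuous_onM => //; exact: continuous_on_cst.
have : moment v (fun r => (r ^+ 2 * f r + (- k) * f r) +
     ((- f s) * (r ^+ 2 * 1) + (k * f s) * 1)) p <= moment v (fun r => 0 * 1) p.
  apply: moment_le => //; first by apply: continuous_onD; apply: continuous_onD.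
  move=> r r0 r1.
  have -> : r ^+ 2 * f r + - k * f r + (- f s * (r ^+ 2 * 1) + k * f s * 1) =
    (r ^+ 2 - k) * (f r - f s) by ring.
  rewrite mul0r -sk; have [rs|sr] := leP r s.
    apply: mulr_le0_ge0; last by rewrite subr_ge0 nf.
    by rewrite subr_le0 lerXn2r ?nnegrE.
  apply: mulr_ge0_le0; last by rewrite subr_le0 nf// ltW.
  by rewrite subr_ge0 lerXn2r ?nnegrE// ltW.
rewrite !momentD ?momentZ//; try by apply: continuous_onD.
rewrite !moment_shift add2n mul0r.
have kE : k * moment v (fun=> 1) p = moment v (fun=> 1) p.+2 by rewrite /k divfK// gt_eqF.
rewrite -kE => H; rewrite /mean ler_pdivrMr// -kE.
have -> : moment v f p / moment v (fun=> 1) p * (k * moment v (fun=> 1) p) =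
  k * moment v f p by field; rewrite gt_eqF.
by move: H; lra.
Qed.

Definition lower_mass s p := \int[mu]_(r in `[0, s]) (r ^+ p * profile v r * 1).

Lemma mean_split f p s : continuous_on f 0 1 -> nonincr01 f ->
  (forall r, 0 <= r -> r <= 1 -> 0 <= f r) -> 0 <= s -> s <= 1 ->
  mean f p <= f s + f 0 * (lower_mass s p / moment v (fun=> 1) p).
Proof.
move=> cf nf f0 s0 s1; have m0 := moment_gt0 p.
have cw := @moment_continuous _ p (@continuous_on_cst 1 0 1).
have cmf := @moment_continuous _ p cf.
rewrite ler_pdivrMr// mulrDl mulrA divfK ?gt_eqF// {1}/moment.
rewrite (Rintegral_split s0 s1)// addrC; apply: lerD.
  apply: (@le_trans _ _ (f s * \int[mu]_(r in `[s, 1]) (r ^+ p * profile v r * 1))).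
    have iw : mu.-integrable `[s, 1] (EFin \o (fun r => r ^+ p * profile v r * 1)).
      apply: continuous_on_integrable => r /andP[sr r1]; apply: cw.
      by rewrite (le_trans s0 sr).
    rewrite -RintegralZl//; apply: le_Rintegral => //.
    - apply: continuous_on_integrable => r /andP[sr r1]; apply: cmf.
      by rewrite (le_trans s0 sr).
    - apply: continuous_on_integrable; apply: continuous_onM; first exact: continuous_on_cst.
      by move=> r /andP[sr r1]; apply: cw; rewrite (le_trans s0 sr).
    - move=> r /=; rewrite in_itv/= => /andP[sr r1]; have r0 := le_trans s0 sr.
      by rewrite mulr1 mulrC ler_wpM2r ?nf// mulr_ge0 ?exprn_ge0// profile_ge0.
  rewrite ler_wpM2l ?f0// /moment [leRHS](Rintegral_split s0 s1)// ler_wpDl//.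
  apply: Rintegral_ge0 => r; rewrite /= in_itv/= => /andP[r0 _].
  by rewrite mulr1 mulr_ge0 ?exprn_ge0// profile_ge0.
have ci r : 0 <= r <= s -> 0 <= r <= 1 by move=> /andP[-> rs]; rewrite (le_trans rs).
rewrite -RintegralZl//; last by apply: continuous_on_integrable => r /ci; exact: cw.
apply: le_Rintegral => //.
- by apply: continuous_on_integrable => r /ci; exact: cmf.
- apply: continuous_on_integrable; apply: continuous_onM; first exact: continuous_on_cst.
  by move=> r /ci; exact: cw.
- move=> r /=; rewrite in_itv/= => /andP[r0 rs].
  rewrite mulr1 mulrC ler_wpM2r ?nf// ?(le_trans rs)// mulr_ge0 ?exprn_ge0//.
  by rewrite profile_ge0.
Qed.

End moments.

(** * Concentration of the moments near 1 *)

Section moment_ratio.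
Variable R : realType.
Variable v : weight R.
Variable eps : R.
Hypothesis eps0 : 0 < eps.
Hypothesis ratio : moment_ratio_bounded v eps.
Notation mu := (@lebesgue_measure R).
Implicit Types (p : nat) (s K : R).

(** With q = p^eps, r^p = r^q r^(p - q) <= s^q r^(p - q) on ]0, s], and the moment condition bounds
    the integral of r^(p - q) v. The estimate stays in the extended reals because p - q may be
    negative. *)
Lemma lower_mass_le : exists2 K : R, 0 <= K & forall p s, (0 < p)%N -> 0 < s -> s < 1 ->
  lower_mass v s p <= K * s `^ (p%:R `^ eps) * moment v (fun=> 1) p.
Proof.
move: ratio; rewrite /moment_ratio_bounded; set S := [set _ | _ in _] => Sy.
have [K K0 HK] : exists2 K : R, 0 <= K & (ereal_sup S <= K%:E)%E.
  case: (ereal_sup S) Sy => [r| |] // _.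
    by exists `|r| => //; rewrite lee_fin ler_norm.
  by exists 0 => //; exact: leNye.
exists K => // p s p0 s0 s1.
have m0 := moment_gt0 v p.
have cw := @moment_continuous _ v _ p (@continuous_on_cst _ 1 0 1).
set q := p%:R `^ eps.
have wE : (\int[mu]_(r in `[0%R, 1%R]) (r ^+ p * profile v r)%:E)%E =
    (moment v (fun=> 1) p)%:E.
  rewrite /moment /Rintegral fineK.
    by apply: eq_integral => r _; rewrite mulr1.
  by apply: integrable_fin_num => //; exact: continuous_on_integrable.
have : ((\int[mu]_(r in `[0%R, 1%R]) (r `^ (p%:R - q) * profile v r)%:E) /
   (moment v (fun=> 1) p)%:E <= K%:E)%E.
  apply: le_trans HK; apply: ereal_sup_ubound; rewrite -wE.
  by exists p.
rewrite inver gt_eqF// lee_pdivrMr// -EFinM => H.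
suff : ((lower_mass v s p)%:E <= (s `^ q * (K * moment v (fun=> 1) p))%:E)%E.
  by rewrite lee_fin mulrCA mulrA.
have mp : measurable_fun (`[0, 1] : set R) (profile v).
  by have /integrableP[/measurable_EFinP] := continuous_on_integrable (@profile_continuous _ v).
have mw : measurable_fun (`[0, 1] : set R) (fun r : R => (r `^ (p%:R - q) * profile v r)%:E).
  apply/measurable_EFinP; apply: measurable_funM => //.
  by apply: measurable_funS (@measurable_powR R _).
have w0 r : 0 <= r -> (0 <= (r `^ (p%:R - q) * profile v r)%:E)%E.
  by move=> r0; rewrite lee_fin mulr_ge0 ?powR_ge0// profile_ge0.
have sub : (`[0, s] : set R) `<=` `[0, 1].
  by move=> r /=; rewrite !in_itv/= => /andP[-> rs]; rewrite (le_trans rs)// ltW.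
have mws := measurable_funS (measurable_itv _) sub mw.
apply: (@le_trans _ _ ((s `^ q)%:E * \int[mu]_(r in `[0%R, 1%R]) (r `^ (p%:R - q) * profile v r)%:E)%E); last first.
  by rewrite EFinM lee_wpmul2l// lee_fin powR_ge0.
apply: (@le_trans _ _ ((s `^ q)%:E * \int[mu]_(r in `[0%R, s]) (r `^ (p%:R - q) * profile v r)%:E)%E); last first.
  rewrite lee_wpmul2l ?lee_fin ?powR_ge0//; apply: ge0_subset_integral => //.
  by move=> r /=; rewrite in_itv/= => /andP[r0 _]; exact: w0.
rewrite -ge0_integralZl_EFin ?powR_ge0//; last first.
  by move=> r /=; rewrite in_itv/= => /andP[r0 _]; exact: w0.
have ci : continuous_on (fun r : R => r ^+ p * profile v r * 1) 0 s.
  by move=> r /andP[r0 rs]; apply: cw; rewrite r0 (le_trans rs)// ltW.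
rewrite /lower_mass /Rintegral fineK; last first.
  by apply: integrable_fin_num => //; exact: continuous_on_integrable.
apply: ge0_le_integral => //.
- move=> r /=; rewrite in_itv/= => /andP[r0 _].
  by rewrite lee_fin mulr1 mulr_ge0 ?exprn_ge0// profile_ge0.
- by have /integrableP[] := continuous_on_integrable ci.
- by apply: emeasurable_funM => //; exact: measurable_cst.
- move=> r /=; rewrite in_itv/= => /andP[r0 rs].
  rewrite -EFinM lee_fin mulr1 mulrA ler_wpM2r ?profile_ge0//.
  move: r0; rewrite le_eqVlt => /orP[/eqP<-|r0].
    by rewrite expr0n gtn_eqF// mulr_ge0 ?powR_ge0.
  rewrite -(powR_mulrn _ (ltW r0)) -[in leLHS](subrK q p%:R) addrC powRD; last first.
    by apply/implyP => _; rewrite lt0r_neq0.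
  rewrite ler_wpM2r ?powR_ge0// ge0_ler_powR ?nnegrE ?powR_ge0 ?(ltW r0) ?(ltW s0)//.
Qed.

Lemma powR_unbounded (a B : R) : 0 < a -> exists N, forall p, (N <= p)%N -> B <= p%:R `^ a.
Proof.
move=> a0; exists (Num.bound (Num.max B 1 `^ a^-1)) => p Np.
have B1 : 0 <= Num.max B 1 :> R by rewrite le_max ler01 orbT.
apply: (@le_trans _ _ (Num.max B 1)); first by rewrite le_max lexx.
have -> : Num.max B 1 = (Num.max B 1 `^ a^-1) `^ a.
  by rewrite -powRrM mulVf ?gt_eqF// powRr1.
apply: ge0_ler_powR; rewrite ?nnegrE ?powR_ge0 ?(ltW a0)//.
apply: (@le_trans _ _ (Num.bound (Num.max B 1 `^ a^-1))%:R); last by rewrite ler_nat.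
by rewrite ltW// archi_boundP// powR_ge0.
Qed.

(* The interval [0, s] with s = 1 - p^(-eps/2) carries a negligible part of the
   mass of r^p v, and |ln (1 - s)| is comparable to ln p. *)
Lemma mean_log_le (f : R -> R) (k r0 : R) : continuous_on f 0 1 -> nonincr01 f ->
  (forall r, 0 <= r -> r <= 1 -> 0 <= f r) -> r0 < 1 ->
  (forall r, r0 <= r -> r < 1 -> f r * - ln (1 - r) <= k) ->
  forall eta : R, 0 < eta -> exists N, forall p, (N <= p)%N ->
    mean v f p * ln (p%:R + 1) <= 4 / eps * k + eta.
Proof.
move=> cf nf f0 r01 fk eta eta0.
have [K K0 HK] := lower_mass_le.
have e20 : 0 < eps / 2 by rewrite divr_gt0.
have f00 : 0 <= f 0 by exact: f0.
(* Thresholds for X = p^(eps/2), with s = 1 - 1/X: the first gives s >= r0, the second 1/X <= 1/2,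
   the third makes the part from [0, s] at most eta. *)
pose B := Num.max ((1 - r0)^-1) (Num.max 2 (16 * f 0 * K / (eps * eta))).
have [N HN] := powR_unbounded B e20.
exists (maxn N 2) => p; rewrite geq_max => /andP[/HN].
set X := p%:R `^ (eps / 2); rewrite /B !ge_max => /and3P[Xr X2 XB] p2.
have X0 : 0 < X by exact: lt_le_trans X2.
have pR : 2 <= p%:R :> R by rewrite ler_nat.
have p0 : 0 < p%:R :> R by exact: lt_le_trans pR.
pose s := 1 - X^-1.
have Xi0 : 0 < X^-1 by rewrite invr_gt0.
have Xi1 : X^-1 <= 2^-1 by rewrite lef_pV2 ?posrE.
have s0 : 0 < s by rewrite /s; move: Xi1; lra.
have s1 : s < 1 by rewrite /s gtrBl.
have sr : r0 <= s.
  rewrite /s lerBrDr -lerBrDl -[leRHS]invrK lef_pV2 ?posrE// invr_gt0 subr_gt0//.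
have lnX : ln X = eps / 2 * ln p%:R by rewrite ln_powR.
have lp0 : 0 <= ln p%:R :> R by rewrite ln_ge0// (le_trans _ pR)// ler1n.
have lnp : ln (p%:R + 1) <= 2 * ln p%:R :> R.
  apply: (@le_trans _ _ (ln ((p%:R : R) ^+ 2))); last by rewrite lnXn// mulr_natl.
  rewrite ler_ln ?posrE ?exprn_gt0 ?addr_gt0//.
  have : 0 <= (p%:R - 2) * (p%:R + 1) :> R by rewrite mulr_ge0 ?subr_ge0// addr_ge0// ltW.
  by move: pR; rewrite expr2; lra.
have lnp1 : 0 <= ln (p%:R + 1) :> R by rewrite ln_ge0// lerDr ltW.
have first : f s * ln (p%:R + 1) <= 4 / eps * k.
  have := fk s sr s1; rewrite /s opprB addrCA subrr addr0 lnV ?posrE// opprK lnX => H.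
  apply: le_trans (ler_wpM2l (f0 _ (ltW s0) (ltW s1)) lnp) _.
  rewrite mulrAC ler_pdivlMr//.
  have -> : f s * (2 * ln p%:R) * eps = 4 * (f s * (eps / 2 * ln p%:R)) by field.
  by rewrite ler_wpM2l.
(* s^(p^eps) = (1 - 1/X)^(X^2) <= exp(- X) <= 4 / X^2. One power of 1/X absorbs ln(p + 1) <= (4 /
   eps) X, and the other makes the product small. *)
have mass : lower_mass v s p / moment v (fun=> 1) p <= K * (4 / X ^+ 2).
  have m0 := moment_gt0 v p.
  rewrite ler_pdivrMr//; apply: le_trans (HK p s _ s0 s1) _; first exact: ltnW p2.
  rewrite ler_wpM2r ?(ltW m0)// ler_wpM2l//.
  have X2E : p%:R `^ eps = X ^+ 2.
    by rewrite /X -powR_mulrn ?powR_ge0// -powRrM divfK// pnatr_eq0.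
  rewrite X2E /powR gt_eqF//.
  have ls : ln s <= - X^-1.
    rewrite -[leRHS]expRK ler_ln ?posrE ?expR_gt0//.
    by apply: le_trans (expR_ge1Dx _); rewrite /s.
  apply: (@le_trans _ _ (expR (- X))).
    rewrite ler_expR; apply: le_trans (ler_wpM2l _ ls) _; first by rewrite exprn_ge0// ltW.
    by rewrite mulrN expr2 mulfK// gt_eqF.
  rewrite expRN -[leRHS]invrK lef_pV2 ?posrE ?expR_gt0 ?invr_gt0 ?divr_gt0 ?exprn_gt0//.
  rewrite invf_div; apply: le_trans (expR_ge1Dxn 1 (ltW X0)).
  rewrite (_ : 2`!%:R = 2)//; have := exprn_ge0 2 (ltW X0).
  by move: (X ^+ 2) => Y; lra.
have second : f 0 * (lower_mass v s p / moment v (fun=> 1) p) * ln (p%:R + 1) <= eta.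
  have lX : ln (p%:R + 1) <= 4 / eps * X :> R.
    apply: le_trans lnp _; rewrite mulrAC ler_pdivlMr//.
    have -> : 2 * ln p%:R * eps = 4 * ln X by rewrite lnX; field.
    rewrite ler_wpM2l// -ler_expR lnK ?posrE//; apply: le_trans (expR_ge1Dx _).
    by rewrite lerDr.
  apply: (@le_trans _ _ (f 0 * (K * (4 / X ^+ 2)) * (4 / eps * X))).
    apply: ler_pM => //; last by rewrite ler_wpM2l.
    by rewrite mulr_ge0// divr_ge0 ?(ltW (moment_gt0 _ _))// Rintegral_ge0// => r;
       rewrite /= in_itv/= => /andP[? _]; rewrite mulr1 mulr_ge0 ?exprn_ge0// profile_ge0.
  have -> : f 0 * (K * (4 / X ^+ 2)) * (4 / eps * X) = 16 * f 0 * K / eps / X.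
    by field; rewrite !gt_eqF.
  rewrite !ler_pdivrMr//; move: XB; rewrite ler_pdivrMr ?mulr_gt0// => /le_trans; apply.
  by rewrite le_eqVlt; apply/orP; left; apply/eqP; ring.
apply: le_trans (ler_wpM2r lnp1 (mean_split v p cf nf f0 (ltW s0) (ltW s1))) _.
by rewrite mulrDl lerD.
Qed.

End moment_ratio.

(** * The scale 1 / |log(1 - r)| and functions with slope bounded on it *)

Section log_scale.
Variable R : realType.
Implicit Types (u : R -> R) (r s k e : R).

(** 1 / |log(1 - r)|. Its derivative is minus the bound 1 / ((1 - r) log(1 - r)^2) assumed for the
    slope of the symbol. *)
Definition inv_log r : R := - (ln (1 - r))^-1.

Lemma ln_1B_lt0 r : 0 < r -> r < 1 -> ln (1 - r) < 0.
Proof. by move=> r0 r1; rewrite ln_lt0// subr_gt0 r1 gtrBl. Qed.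

Lemma inv_log_gt0 r : 0 < r -> r < 1 -> 0 < inv_log r.
Proof. by move=> r0 r1; rewrite oppr_gt0 invr_lt0 ln_1B_lt0. Qed.

Lemma inv_logM r : 0 < r -> r < 1 -> inv_log r * - ln (1 - r) = 1.
Proof. by move=> r0 r1; rewrite mulrNN mulVf// lt_eqF// ln_1B_lt0. Qed.

Lemma inv_log_small e : 0 < e ->
  exists r0, [/\ 0 < r0, r0 < 1 & forall r, r0 <= r -> r < 1 -> inv_log r <= e].
Proof.
move=> e0; have i0 : 0 < e^-1 by rewrite invr_gt0.
have x0 := expR_gt0 (- e^-1).
have x1 : expR (- e^-1) < 1 by rewrite -expR0 ltr_expR oppr_lt0.
exists (1 - expR (- e^-1)); split; rewrite ?subr_gt0 ?gtrBl//.
move=> r r0 r1; have rp : 0 < r by apply: lt_le_trans r0; rewrite subr_gt0.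
rewrite -(ler_pM2r (_ : 0 < - ln (1 - r))) ?oppr_gt0 ?ln_1B_lt0// inv_logM//.
rewrite -ler_pdivrMl// mulr1 lerNr -[leRHS]expRK ler_ln ?posrE ?subr_gt0//.
by rewrite lerBlDr addrC -lerBlDr.
Qed.

(** With y = - ln(1 - r) this is y^2 exp(- y) <= 2. It makes linear terms M (1 - r) negligible on
    the logarithmic scale. *)
Lemma xlog_le r : 0 < r -> r < 1 -> (1 - r) * - ln (1 - r) <= 2 * inv_log r.
Proof.
move=> r0 r1; have y0 : 0 < - ln (1 - r) by rewrite oppr_gt0 ln_1B_lt0.
rewrite -(ler_pM2r y0) -mulrA -[leRHS]mulrA inv_logM// mulr1 -expr2.
have x0 : 0 < 1 - r by rewrite subr_gt0.
have xE : 1 - r = (expR (- ln (1 - r)))^-1 by rewrite -expRN opprK lnK.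
rewrite {1}xE; move: (- ln (1 - r)) y0 => y y0.
rewrite mulrC ler_pdivrMr ?expR_gt0//.
have := expR_ge1Dxn 1 (ltW y0); rewrite (_ : 2`!%:R = 2)//.
by move: (y ^+ 2) (expR y) => Y Z; lra.
Qed.

Lemma is_derive_inv_log r : 0 < r -> r < 1 ->
  is_derive r 1 inv_log (- ((1 - r) * ln (1 - r) ^+ 2)^-1).
Proof.
move=> r0 r1; have x0 : 0 < 1 - r by rewrite subr_gt0.
have l0 := ln_1B_lt0 r0 r1.
have d1 : is_derive r 1 (fun s : R => 1 - s) (-1).
  have := @is_deriveB R R R (cst 1) id r 1 0 1 (is_derive_cst _ _ _) (is_derive_id _ _).
  by rewrite sub0r.
have d2 : is_derive r 1 (fun s : R => ln (1 - s)) ((1 - r)^-1 *: -1).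
  by have := @is_derive1_comp _ (@ln R) (fun s => 1 - s) r _ _ (is_derive1_ln x0) d1.
have l0' : ln (1 - r) != 0 by rewrite lt_eqF.
have d3 := @is_deriveV R (fun s => ln (1 - s)) r _ 1 l0' d2.
apply: (is_derive_eq (is_deriveN d3)).
rewrite /GRing.scale/=; field.
by rewrite l0' gt_eqF.
Qed.

Definition log_slope u r0 k := forall r, r0 < r -> r < 1 -> derivable u r 1 /\
  `|derive1 u r| <= k / ((1 - r) * ln (1 - r) ^+ 2).

(** Both u + k [inv_log] and - u + k [inv_log] are nonincreasing by the sign of their
    derivatives. *)
Lemma log_slope_osc u r0 k r s : 0 <= r0 -> log_slope u r0 k ->
  r0 < r -> r <= s -> s < 1 -> `|u s - u r| <= k * (inv_log r - inv_log s).
Proof.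
move=> r00 us rr0 rs s1.
have key (w : R -> R) : (forall t, r0 < t -> t < 1 -> derivable w t 1 /\
    derive1 w t <= k / ((1 - t) * ln (1 - t) ^+ 2)) ->
    w s - w r <= k * (inv_log r - inv_log s).
  move=> hw; pose f t := w t + k * inv_log t.
  have fd t : r0 < t -> t < 1 -> is_derive t 1 f
      (derive1 w t + k *: - ((1 - t) * ln (1 - t) ^+ 2)^-1).
    move=> t0 t1; have [dw _] := hw t t0 t1.
    apply: is_deriveD; first by rewrite derive1E; exact: derivableP.
    by apply: is_deriveZ; apply: is_derive_inv_log => //; exact: le_lt_trans t0.
  have := @ler0_derive1_nincr R f r s.
  have inr t : r <= t -> t <= s -> r0 < t /\ t < 1.
    by move=> rt ts; rewrite (lt_le_trans rr0)// (le_lt_trans ts).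
  move=> /(_ _ _ _ r s (lexx r) rs (lexx s)) H.
  have {}H : f s <= f r.
    apply: H => [t|t|].
    - by rewrite in_itv/= => /andP[/ltW rt /ltW ts]; have [a b] := inr t rt ts; case: (fd t a b).
    - rewrite in_itv/= => /andP[/ltW rt /ltW ts]; have [a b] := inr t rt ts.
      rewrite derive1E (@derive_val _ _ _ _ _ _ _ (fd t a b)).
      by rewrite /GRing.scale/= mulrN subr_le0; have [_] := hw t a b.
    - apply: derivable_within_continuous => t; rewrite in_itv/= => /andP[rt ts].
      by have [a b] := inr t rt ts; case: (fd t a b).
  by move: H; rewrite /f; lra.
rewrite ler_norml; apply/andP; split.
  rewrite lerNl opprB; have := key (fun t => - u t); rewrite opprK addrC; apply.
  move=> t t0 t1; have [du ub] := us t t0 t1; split; first exact: derivableN.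
  rewrite derive1E deriveN//= -derive1E.
  by apply: le_trans ub; rewrite -normrN ler_norm.
apply: key => t t0 t1; have [du ub] := us t t0 t1; split => //.
by apply: le_trans ub; rewrite ler_norm.
Qed.

(** Every value of u - k [inv_log] lies below every value of u + k [inv_log], by the oscillation
    bound. The supremum of the former is the limit, with the rate included. *)
Lemma log_slope_limit u r0 k : 0 <= r0 -> r0 < 1 -> 0 <= k -> log_slope u r0 k ->
  exists l, forall r, r0 < r -> r < 1 -> `|u r - l| <= k * inv_log r.
Proof.
move=> r00 r01 k0 us; pose f r := u r - k * inv_log r.
pose S := [set f r | r in [set r | r0 < r < 1]].
have fub r s : r0 < r < 1 -> r0 < s < 1 -> f r <= u s + k * inv_log s.
  move=> /andP[rr0 r1] /andP[ss0 s1]; rewrite /f.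
  have gr : 0 <= k * inv_log r by rewrite mulr_ge0// ltW// inv_log_gt0// (le_lt_trans r00).
  have gs : 0 <= k * inv_log s by rewrite mulr_ge0// ltW// inv_log_gt0// (le_lt_trans r00).
  have [rs|/ltW sr] := leP r s.
    by have := log_slope_osc r00 us rr0 rs s1; rewrite ler_norml; lra.
  by have := log_slope_osc r00 us ss0 sr r1; rewrite ler_norml; lra.
exists (sup S) => r rr0 r1; have rin : r0 < r < 1 by rewrite rr0.
have H1 : f r <= sup S.
  apply: ub_le_sup; last by exists r.
  by exists (u r + k * inv_log r) => _ [s sin <-]; exact: fub.
have H2 : sup S <= u r + k * inv_log r.
  by apply: ge_sup; [exists (f r), r|move=> _ [s sin <-]; exact: fub].
by rewrite ler_norml; move: H1 H2; rewrite /f; lra.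
Qed.

Lemma log_limit_cvg u r0 l k : r0 < 1 -> 0 <= k ->
  (forall r, r0 < r -> r < 1 -> `|u r - l| <= k * inv_log r) ->
  u r @[r --> (1 : R)^'-] --> l.
Proof.
move=> r01 k0 H; apply/cvgrPdist_le => e e0.
have k1 : 0 < k + 1 by rewrite ltr_wpDl.
have [s [s0 s1 Hs]] := inv_log_small (divr_gt0 e0 k1).
near=> r; rewrite distrC; have r1 : r < 1 by near: r; exact: nbhs_left_lt.
have sr : s <= r by near: r; exact: nbhs_left_ge.
apply: le_trans (H r _ r1) _; first by near: r; exact: nbhs_left_gt.
apply: le_trans (ler_wpM2l k0 (Hs r sr r1)) _.
by rewrite mulrA ler_pdivrMr// mulrDr mulr1 mulrC lerDl ltW.
Unshelve. all: by end_near. Qed.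

(** Keeps the limit l while k shrinks: in the little-o case the slope constant is arbitrarily small
    on a smaller interval, with the limit already fixed. *)
Lemma log_slope_limit_le u r0 k l : 0 <= r0 -> 0 <= k -> log_slope u r0 k ->
  u r @[r --> (1 : R)^'-] --> l ->
  forall r, r0 < r -> r < 1 -> `|u r - l| <= k * inv_log r.
Proof.
move=> r00 k0 us ul r rr0 r1; apply/ler_addgt0Pr => e e0.
have H : \forall s \near (1 : R)^'-, `|l - u s| < e by exact: cvgr_dist_lt.
have [s [usl rs s1]] : exists s, [/\ `|l - u s| < e, r < s & s < 1].
  have Hn : \forall s \near (1 : R)^'-, [/\ `|l - u s| < e, r < s & s < 1].
    near=> s; split; near: s => //; [exact: nbhs_left_gt|exact: nbhs_left_lt].
  by have [s Hs] := @filter_ex _ (1 : R)^'- _ _ Hn; exists s.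
have gs : 0 < inv_log s by apply: inv_log_gt0 => //; apply: le_lt_trans r00 _; exact: lt_trans rs.
have := log_slope_osc r00 us rr0 (ltW rs) s1; rewrite mulrBr => osc.
have kg : 0 <= k * inv_log s by rewrite mulr_ge0// ltW.
have -> : u r - l = (u r - u s) - (l - u s) by ring.
apply: le_trans (ler_normB _ _) _; rewrite distrC.
by move: osc usl kg; lra.
Unshelve. all: by end_near. Qed.

Lemma geometric_log (t : R) : 0 <= t -> t < 1 -> forall e : R, 0 < e ->
  exists N : nat, forall n : nat, (N <= n)%N -> t ^+ (2 * n) * ln (n%:R + 2) <= e.
Proof.
move=> t0 t1 e e0; have d0 : 0 < 1 - t by rewrite subr_gt0.
pose B : R := (1 - t)^-1 + 1; have B0 : 0 < B by rewrite addr_gt0// invr_gt0.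
exists (Num.bound (B / (1 - t) / e)).+1 => n Nn.
have n0 : 0 < n%:R :> R by rewrite ltr0n (leq_trans _ Nn).
have nB : B / (1 - t) / e <= n%:R.
  apply: (@le_trans _ _ (Num.bound (B / (1 - t) / e))%:R).
    by rewrite ltW// archi_boundP// ltW// !divr_gt0.
  by rewrite ler_nat ltnW.
have tn0 : 0 <= t ^+ n by exact: exprn_ge0.
have tn1 : t ^+ n <= 1 by rewrite exprn_ile1// ltW.
have kt := natr_mul_expr_le n t0 t1.
have l0 : ln (n%:R + 2) <= n%:R + 1 :> R.
  have -> : n%:R + 2 = 1 + (n%:R + 1) :> R by ring.
  by apply: le_ln1Dx; move: n0; lra.
apply: (@le_trans _ _ (t ^+ n * B)).
  rewrite mulnC exprM expr2 -mulrA ler_wpM2l//.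
  apply: le_trans (ler_wpM2l tn0 l0) _; rewrite mulrDr mulr1 [t ^+ n * _]mulrC.
  by rewrite lerD.
have : t ^+ n * B * n%:R <= e * n%:R.
  rewrite mulrAC [t ^+ n * _]mulrC; apply: le_trans (ler_wpM2r (ltW B0) kt) _.
  by move: nB; rewrite ler_pdivrMr// mulrC [n%:R * e]mulrC.
by rewrite ler_pM2r.
Qed.

Lemma limf_esup_bounded (f : R -> R) : (limf_esup (EFin \o f) (1 : R)^'- < +oo)%E ->
  exists M r0, r0 < 1 /\ forall r, r0 < r -> r < 1 -> f r <= M.
Proof.
move=> H; have [V FV HV] : exists2 V, (1 : R)^'- V &
    (ereal_sup [set (f r)%:E | r in V] < +oo)%E.
  apply: contrapT => nV; move: H; rewrite ltNge => /negP; apply.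
  apply: le_ereal_inf_tmp => _ [V FV <-]; rewrite leNgt; apply/negP => VH.
  by apply: nV; exists V.
have [M HM] : exists M : R, (ereal_sup [set (f r)%:E | r in V] <= M%:E)%E.
  case: ereal_sup HV => [r| |]// _; first by exists r.
  by exists 0; exact: leNye.
move: FV => [d /= d0 dV]; exists M, (1 - d); split; first by rewrite gtrBl.
move=> r dr r1; rewrite -lee_fin; apply: le_trans HM; apply: ereal_sup_ubound.
exists r => //; apply: dV => //=.
by rewrite ger0_norm ?subr_ge0 ?ltW//; move: dr; lra.
Qed.

End log_scale.

Import HBNNSimple.

(** * Integrals modulo null sets *)

Section null_sets.
Context d (T : measurableType d) (R : realType).
Variable mu : {measure set T -> \bar R}.
Local Open Scope ereal_scope.
Implicit Types (f g : T -> \bar R) (N : set T).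

(* The integral of a nonnegative function is a lower integral, so no
   measurability is needed here. *)
Lemma ge0_le_integral_null N f g : measurable N -> mu N = 0 ->
  (forall x, 0 <= f x) -> (forall x, 0 <= g x) -> (forall x, ~ N x -> f x = g x) ->
  \int[mu]_x f x <= \int[mu]_x g x.
Proof.
move=> mN N0 f0 g0 fg; rewrite !ge0_integralTE//; apply: ge_ereal_sup => _ [h /= hf <-].
have mNc : measurable (~` N) by exact: measurableC.
have -> : sintegral mu h = sintegral mu (proj_nnsfun h mNc).
  rewrite -!integralT_nnsfun; apply: ae_eq_integral => //; do 1? exact/measurable_EFinP.
  exists N; split => // x /= Nx; apply: contrapT => nNx; apply: Nx => _.
  by rewrite mindicE mem_set// mulr1.
apply: ereal_sup_ubound; exists (proj_nnsfun h mNc) => //= x.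
rewrite mindicE; have [xN|xN] := pselect (N x).
  by rewrite memNset ?mulr0//=; exact/contrapT.
by rewrite mem_set// mulr1 -fg.
Qed.

(** Stated without measurability of f and g, because the radial profile of the symbol is only
    controlled off a null set. *)
Lemma eq_integral_null N (D : set T) f g : measurable N -> mu N = 0 ->
  (forall x, D x -> ~ N x -> f x = g x) ->
  \int[mu]_(x in D) f x = \int[mu]_(x in D) g x.
Proof.
move=> mN N0 fg; rewrite !(integral_mkcond D) [LHS]integralE [RHS]integralE.
have fgD x : ~ N x -> (f \_ D) x = (g \_ D) x.
  by move=> Nx; rewrite /patch; case: ifPn => // /set_mem Dx; exact: fg.
congr (_ - _); apply/eqP; rewrite eq_le; apply/andP; split;
  by apply: (ge0_le_integral_null mN N0) => // x Nx; rewrite ?funeposE ?funenegE fgD.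
Qed.

End null_sets.

Section symbol.
Variable R : realType.
Variable v : weight R.
Variable eps : R.
Hypothesis eps0 : 0 < eps.
Hypothesis ratio : moment_ratio_bounded v eps.
Notation mu := (@lebesgue_measure R).
Implicit Types (u E F : R -> R) (r s k e q : R) (p n : nat).

Let m01 : measurable (`[0, 1]%classic : set (measurableTypeR R)).
Proof. exact: measurable_itv. Qed.

Definition null_outside (P : R -> Prop) :=
  exists N : set (measurableTypeR R), [/\ measurable N, mu N = 0%E & forall r, ~ N r -> P r].

(** One factor of r^(p+1) turns u into r u, which agrees with F. The point 0 joins the null set, and
    at r = 1 both integrands vanish with [profile]. *)
Lemma moment_radial u F p : null_outside (fun r => 0 < r -> r < 1 -> r * u r = F r) ->
  moment v u p.+1 = moment v F p.
Proof.
move=> [N [mN N0 uF]]; rewrite /moment /Rintegral; congr fine.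
apply: (@eq_integral_null _ _ R mu (N `|` [set 0])).
- by apply: measurableU.
- by rewrite measureU0//; exact: lebesgue_measure_set1.
- move=> r /=; rewrite in_itv/= => /andP[r0 r1] nN; congr EFin.
  have rN : ~ N r by move=> Nr; apply: nN; left.
  have rp : 0 < r by rewrite lt_neqAle r0 andbT eq_sym; apply/eqP => r00; apply: nN; right.
  move: r1; rewrite le_eqVlt => /orP[/eqP->|r1].
    by rewrite /profile ltxx !mulr0 !mul0r.
  by rewrite -(uF r rN rp r1) exprSr; ring.
Qed.

Lemma profile_bounded : exists2 P : R, 0 < P & forall r, 0 <= r -> r <= 1 -> profile v r <= P.
Proof.
have [c cin Hc] := EVT_max (@ler01 R) (continuous_on_within (@profile_continuous _ v)).
exists (profile v c + 1).
  by rewrite ltr_wpDl// profile_ge0//; move: cin; rewrite in_itv/= => /andP[].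
move=> r r0 r1; have := Hc r; rewrite in_itv/= r0 r1 => /(_ isT).
by move=> /le_trans; apply; rewrite lerDl.
Qed.

Lemma moment_integrableM F p : mu.-integrable `[0, 1] (EFin \o F) ->
  mu.-integrable `[0, 1] (EFin \o (fun r => r ^+ p * profile v r * F r)).
Proof.
move=> iF; have cw := @moment_continuous _ v _ p (@continuous_on_cst _ 1 0 1).
have [P P0 HP] := profile_bounded.
pose w r := r ^+ p * profile v r * 1.
have mw : measurable_fun (`[0, 1] : set (measurableTypeR R)) w.
  by have /integrableP[/measurable_EFinP] := continuous_on_integrable cw.
have bw : [bounded w r | r in `[0, 1]%classic].
  exists P; split; first exact: num_real.
  move=> x Px r /=; rewrite in_itv/= => /andP[r0 r1].
  rewrite /w mulr1 ger0_norm ?mulr_ge0 ?exprn_ge0 ?profile_ge0//; apply: le_trans (ltW Px).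
  by rewrite -[leRHS]mul1r ler_pM ?exprn_ge0 ?profile_ge0 ?exprn_ile1 ?HP.
have := integrableMr m01 mw bw iF; apply: eq_integrable => // r _ /=.
by rewrite /w mulr1 EFinM.
Qed.

(** Almost all of E lives on [0, r1], where r^p <= r1^p, and [profile] is bounded. *)
Lemma moment_support E (r1 : R) : mu.-integrable `[0, 1] (EFin \o E) -> 0 <= r1 ->
  null_outside (fun r => r1 < r -> r < 1 -> E r = 0) ->
  exists2 Q : R, 0 <= Q & forall p, `|moment v E p| <= Q * r1 ^+ p.
Proof.
move=> iE r10 [N [mN N0 NE]]; have [P P0 HP] := profile_bounded.
exists (P * \int[mu]_(r in `[0, 1]) `|E r|) => [|p].
  by rewrite mulr_ge0 ?(ltW P0)// Rintegral_ge0.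
have iw := moment_integrableM p iE.
have iaE : mu.-integrable `[0, 1] (EFin \o (fun r => `|E r|)).
  by have := integrable_norm iE.
rewrite mulrAC -RintegralZl//; apply: le_trans (le_normr_Rintegral _ iw) _ => //.
have iZ : mu.-integrable `[0, 1] (EFin \o (fun r => P * r1 ^+ p * `|E r|)).
  have := integrableZl m01 (P * r1 ^+ p) iaE.
  by apply: eq_integrable => // r _ /=; rewrite EFinM.
apply: fine_le.
- apply: integrable_fin_num => //; by have := integrable_norm iw.
- exact: integrable_fin_num.
apply: ae_ge0_le_integral => //.
- by have /integrableP[+ _] := integrable_norm iw.
- by move=> r _; rewrite lee_fin !mulr_ge0 ?(ltW P0) ?exprn_ge0.
- by have /integrableP[+ _] := iZ.
exists N; split => // r /= Hr; apply: contrapT => Nr; apply: Hr.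
rewrite in_itv/= => /andP[r0 rle1]; rewrite lee_fin normrM.
have [rr1|r1r] := leP r r1.
  rewrite ler_wpM2r// ger0_norm ?mulr_ge0 ?exprn_ge0 ?profile_ge0// mulrC.
  by rewrite ler_pM ?exprn_ge0 ?profile_ge0 ?HP// lerXn2r ?nnegrE.
have ge0 : 0 <= P * r1 ^+ p * `|E r| by rewrite !mulr_ge0 ?(ltW P0) ?exprn_ge0.
move: rle1; rewrite le_eqVlt => /orP[/eqP r1E|rlt1].
  by rewrite r1E /profile ltxx mulr0 normr0 mul0r -r1E.
by rewrite (NE r Nr r1r rlt1) normr0 !mulr0.
Qed.

Section one_sided.
Variables (u F : R -> R) (delta C l M : R).
Hypothesis iF : mu.-integrable `[0, 1] (EFin \o F).
Hypothesis uF : null_outside (fun r => 0 < r -> r < 1 -> r * u r = F r).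
Hypotheses (delta0 : 0 <= delta) (delta1 : delta < 1).
Hypothesis du : log_slope u delta C.
Hypothesis dM : forall r, delta < r -> r < 1 -> derive1 u r <= M.
Hypothesis ul : u r @[r --> (1 : R)^'-] --> l.

Let r1 : R := (delta + 1) / 2.

Let dr1 : delta < r1. Proof. by have [] : (delta < r1) * (r1 < 1) by exact: midf_lt. Qed.
Let r11 : r1 < 1. Proof. by have [] : (delta < r1) * (r1 < 1) by exact: midf_lt. Qed.
Let r10 : 0 < r1. Proof. exact: le_lt_trans dr1. Qed.

(** Subtracting M r turns the one-sided bound u' <= M into monotonicity near 1. *)
Let w r : R := u r - M * r.

Let w_nonincr r s : delta < r -> r <= s -> s < 1 -> w s <= w r.
Proof.
move=> dr rs s1.
have dw t : delta < t -> t < 1 -> is_derive t 1 w (derive1 u t - M).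
  move=> dt t1; have [Du _] := du dt t1.
  apply: is_deriveB; first by rewrite derive1E; exact: derivableP.
  by apply: is_derive_eq; rewrite /GRing.scale/= mulr1.
have inr t : r <= t -> t <= s -> delta < t /\ t < 1.
  by move=> rt ts; rewrite (lt_le_trans dr)// (le_lt_trans ts).
apply: (@ler0_derive1_nincr R w r s) => // [t|t|].
- by rewrite in_itv/= => /andP[/ltW rt /ltW ts]; have [a b] := inr t rt ts; case: (dw t a b).
- rewrite in_itv/= => /andP[/ltW rt /ltW ts]; have [a b] := inr t rt ts.
  by rewrite derive1E (@derive_val _ _ _ _ _ _ _ (dw t a b)) subr_le0 dM.
- apply: derivable_within_continuous => t; rewrite in_itv/= => /andP[rt ts].
  by have [a b] := inr t rt ts; case: (dw t a b).
Qed.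

Let w_cvg : w r @[r --> (1 : R)^'-] --> l - M.
Proof.
apply: cvgB => //; rewrite -[X in _ --> X]mulr1; apply: cvgMr.
by apply: cvg_within.
Qed.

Let w_ge r : delta < r -> r < 1 -> l - M <= w r.
Proof.
move=> dr rl1; rewrite leNgt; apply/negP => H.
have Hn : \forall s \near (1 : R)^'-, [/\ w r < w s, r < s & s < 1].
  near=> s; split; near: s.
  - exact: (cvgr_gt _ w_cvg).
  - exact: nbhs_left_gt.
  - exact: nbhs_left_lt.
have [s [ws rs s1]] := @filter_ex _ (1 : R)^'- _ _ Hn.
by have := w_nonincr dr (ltW rs) s1; rewrite leNgt ws.
Unshelve. all: by end_near. Qed.

(* u - l = wt - M (1 - r) on [r1, 1[, with wt nonnegative and nonincreasing on
   the whole interval *)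
Let wt r : R := if r < 1 then w (Num.max r r1) - (l - M) else 0.

Let max_in r : r < 1 -> delta < Num.max r r1 /\ Num.max r r1 < 1.
Proof. by move=> h; rewrite lt_max dr1 orbT gt_max h. Qed.

Let wt_ge0 r : 0 <= wt r.
Proof.
rewrite /wt; case: ifPn => // h; have [a b] := max_in h.
by rewrite subr_ge0 w_ge.
Qed.

Let wt_nonincr : nonincr01 wt.
Proof.
move=> r s r0 rs s1; have [s1'|s1'] := ltP s 1; last by rewrite {1}/wt ltNge s1'.
rewrite /wt s1' (le_lt_trans rs s1') lerD2r.
have [a _] := max_in (le_lt_trans rs s1'); have [_ b] := max_in s1'.
by apply: w_nonincr => //; rewrite ge_max !le_max rs lexx orbT.
Qed.

Let wt_continuous : continuous_on wt 0 1.
Proof.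
move=> r /andP[r0]; rewrite le_eqVlt => /orP[/eqP->|rl1].
  apply/left_right_continuousP; rewrite [wt 1](_ : _ = 0); last by rewrite /wt ltxx.
  split.
    have : w r - (l - M) @[r --> (1 : R)^'-] --> 0.
      by rewrite -(subrr (l - M)); apply: cvgB => //; exact: cvg_cst.
    apply: cvg_trans; apply: near_eq_cvg; near=> s.
    have s1 : s < 1 by near: s; exact: nbhs_left_lt.
    have rs : r1 <= s by near: s; exact: nbhs_left_ge.
    by rewrite /wt s1 max_l.
  apply: cvg_near_cst; near=> s.
  by rewrite /wt ifF//; apply/negbTE; rewrite -leNgt ltW//; near: s; exact: nbhs_right_gt.
have [a b] := max_in rl1.
have cw : {for Num.max r r1, continuous w}.
  have [Du _] := du a b.
  apply: continuousB; first by apply: differentiable_continuous; exact/derivable1_diffP.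
  exact: mulrl_continuous.
have cm : {for r, continuous (fun s : R => Num.max s r1)}.
  by apply: continuous_max; [exact: cvg_id|exact: cst_continuous].
change (wt s @[s --> r] --> wt r); rewrite {2}/wt rl1.
have : w (Num.max s r1) - (l - M) @[s --> r] --> w (Num.max r r1) - (l - M).
  by apply: cvgB; [exact: (continuous_comp cm cw)|exact: cvg_cst].
apply: cvg_trans; apply: near_eq_cvg; near=> s.
by rewrite /wt ifT//; near: s; exact: lt_nbhsl.
Unshelve. all: by end_near. Qed.

Let idf r : R := 1 - r.

Let idf_continuous : continuous_on idf 0 1.
Proof. by move=> r _; apply: continuousB; [exact: cst_continuous|exact: cvg_id]. Qed.

Let idf_nonincr : nonincr01 idf.
Proof. by move=> r s _ rs _; rewrite lerD2l lerN2. Qed.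

Let idf_ge0 r : 0 <= r -> r <= 1 -> 0 <= idf r.
Proof. by move=> _ h; rewrite subr_ge0. Qed.

(** A continuous substitute for u on all of [0, 1], equal to u on [r1, 1[: the l and M terms of [wt]
    and [idf] recombine there. The difference [E] of the weighted functions is thus carried by
    [0, r1] up to a null set. *)
Let c r : R := l * 1 + (wt r + - M * idf r).

Let c_continuous : continuous_on c 0 1.
Proof.
apply: continuous_onD; first exact: continuous_on_cst.
apply: continuous_onD => //; apply: continuous_onM => //; exact: continuous_on_cst.
Qed.

Let mean_c p : mean v c p = l + (mean v wt p - M * mean v idf p).
Proof.
rewrite meanD; [|exact: continuous_on_cst|]; last first.
  by apply: continuous_onD => //; apply: continuous_onM => //; exact: continuous_on_cst.
rewrite meanD//; last by apply: continuous_onM => //; exact: continuous_on_cst.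
rewrite !meanZ//; last exact: continuous_on_cst.
by rewrite /mean divff ?gt_eqF ?moment_gt0// mulr1 mulNr.
Qed.

Let E r : R := F r - r * c r.

Let ci : mu.-integrable `[0, 1] (EFin \o (fun r => r * c r)).
Proof.
apply: continuous_on_integrable; apply: continuous_onM => //.
by move=> r _; exact: cvg_id.
Qed.

Let iE : mu.-integrable `[0, 1] (EFin \o E).
Proof. by have := integrableB m01 iF ci; apply: eq_integrable. Qed.

Let E0 : null_outside (fun r => r1 < r -> r < 1 -> E r = 0).
Proof.
have [N [mN N0 HN]] := uF; exists N; split => // r Nr rr1 rl1.
rewrite /E -(HN r Nr (lt_trans r10 rr1) rl1) /c /wt rl1 max_l ?(ltW rr1)// /w /idf.
by ring.
Qed.

Let momentE p : moment v u p.+1 = moment v c p.+1 + moment v E p.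
Proof.
rewrite (moment_radial _ uF) -(addn1 p) addnC -moment_shift.
rewrite /moment -RintegralD//; last 2 first.
- have := @moment_integrableM (fun r => r * c r) p ci.
  by apply: eq_integrable => // r _ /=; rewrite expr1.
- exact: moment_integrableM.
by apply: eq_Rintegral => r _; rewrite /E expr1; ring.
Qed.

(** The constant k of the last clause is left free, so that the same [tau] serves the boundedness,
    with k = C, and the little-o case, with k arbitrarily small. *)
Lemma one_sided_moments : exists g tau : nat -> R, [/\
  forall n, moment v u (2 * n + 1) / moment v (fun=> 1) (2 * n + 1) = l + g n,
  forall n, `|g n| <= tau n /\ `|g n - g n.+1| <= tau n - tau n.+1 &
  forall k r0, 0 <= k -> r0 < 1 ->
    (forall r, r0 < r -> r < 1 -> `|u r - l| <= k * inv_log r) ->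
    forall e, 0 < e -> exists N, forall n, (N <= n)%N ->
      tau n * ln (n%:R + 2) <= 4 / eps * k + e].
Proof.
have [Q Q0 HQ] := moment_support iE (ltW r10) E0.
(* The moment of [E] is O(r1^(2n)) and the denominator at least b s^(2n+1); with r1 < s the quotient
   [a n] decays like (r1 / s)^(2n). *)
pose s : R := (r1 + 1) / 2.
have [r1s s1] : (r1 < s) * (s < 1) by exact: midf_lt.
have s0 : 0 < s by exact: lt_trans r1s.
have [b b0 Hb] := moment_lower v s0 s1.
pose t := r1 / s.
have t0 : 0 <= t by rewrite divr_ge0// ltW.
have t1 : t < 1 by rewrite ltr_pdivrMr// mul1r.
pose a n := moment v E (2 * n) / moment v (fun=> 1) (2 * n + 1).
pose A := Q / (b * s).
have A0 : 0 <= A by rewrite divr_ge0// mulr_ge0// ltW.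
have aA n : `|a n| <= A * t ^+ (2 * n).
  have m0 := moment_gt0 v (2 * n + 1).
  rewrite normrM normfV (gtr0_norm m0) ler_pdivrMr//; apply: le_trans (HQ _) _.
  have -> : Q * r1 ^+ (2 * n) = A * t ^+ (2 * n) * (b * s ^+ (2 * n + 1)).
    rewrite /A /t exprD expr1 [(r1 / s) ^+ _]expr_div_n.
    have := exprn_gt0 (2 * n) s0; move: (s ^+ (2 * n)) (r1 ^+ (2 * n)) => X Y X0.
    have -> : Q / (b * s) * (Y / X) * (b * (X * s)) = Q * Y * ((b * s) / (b * s)) * (X / X) by ring.
    by rewrite !divff ?mulr1 ?gt_eqF// mulr_gt0.
  by apply: ler_wpM2l; [rewrite mulr_ge0// exprn_ge0|exact: Hb].
pose q := t ^+ 2.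
have q0 : 0 <= q by exact: exprn_ge0.
have q1 : q < 1 by rewrite /q expr_lt1.
have q1' : 0 < 1 - q by rewrite subr_gt0.
(* [a n] has no monotonicity. The decrement of A' t^(2n) is 2 A t^(2n), enough to dominate |a_n -
   a_(n+1)|, so this geometric term is added to [tau]. *)
pose A' := 2 * A / (1 - q).
have AA' : A <= A'.
  rewrite ler_pdivlMr// mulrC; apply: ler_wpM2r => //; lra.
have A'0 : 0 <= A' by exact: le_trans AA'.
pose W n := mean v wt (2 * n + 1); pose I n := mean v idf (2 * n + 1).
have W0 n : 0 <= W n by apply: mean_ge0 => *; exact: wt_ge0.
have I0 n : 0 <= I n by apply: mean_ge0.
have WS n : W n.+1 <= W n by rewrite /W mulnS !addSn add0n; exact: mean_nonincr.
have IS n : I n.+1 <= I n by rewrite /I mulnS !addSn add0n; exact: mean_nonincr.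
pose g n := (W n - M * I n) + a n.
pose tau n := (W n + `|M| * I n) + A' * t ^+ (2 * n).
exists g, tau; split => [n|n|k r0 k0 r01 uk e e0].
- rewrite addn1 momentE mulrDl -addn1 -/(mean v c _) mean_c -addrA.
  by rewrite /g /W /I /a addn1.
- have tn0 : 0 <= t ^+ (2 * n) by exact: exprn_ge0.
  split.
    rewrite /g /tau; apply: le_trans (ler_normD _ _) _; apply: lerD; last first.
      by apply: le_trans (aA n) _; rewrite ler_wpM2r.
    apply: le_trans (ler_normB _ _) _.
    by apply: lerD; [rewrite ger0_norm|rewrite normrM ler_wpM2l// ger0_norm].
  have -> : g n - g n.+1 = (W n - W n.+1) - M * (I n - I n.+1) + (a n - a n.+1).
    by rewrite /g; ring.
  have -> : tau n - tau n.+1 = (W n - W n.+1) + `|M| * (I n - I n.+1) +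
      2 * A * t ^+ (2 * n).
    rewrite /tau mulnS exprD -/q /A'; move: (t ^+ (2 * n)) => X.
    by field; rewrite gt_eqF.
  apply: le_trans (ler_normD _ _) _; apply: lerD.
    apply: le_trans (ler_normB _ _) _; rewrite normrM.
    by apply: lerD; [rewrite ger0_norm ?subr_ge0|rewrite ler_wpM2l// ger0_norm ?subr_ge0].
  apply: le_trans (ler_normB _ _) _; apply: le_trans (lerD (aA n) (aA n.+1)) _.
  rewrite mulnS exprD -/q.
  have : A * (q * t ^+ (2 * n)) <= A * t ^+ (2 * n).
    by rewrite ler_wpM2l// ler_piMl// ltW.
  by lra.
- have e4 : 0 < e / 8 by rewrite divr_gt0.
  have c4 : 0 < 4 / eps by rewrite divr_gt0.
  pose e1 := e / 8 / (4 / eps).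
  have e10 : 0 < e1 by rewrite divr_gt0.
  have M1 : 0 < 2 * `|M| + 2 by rewrite ltr_wpDl// mulr_ge0.
  have [r2 [r20 r21 Hr2]] := inv_log_small (divr_gt0 e10 M1).
  pose r3 := Num.max r2 (Num.max r1 ((r0 + 1) / 2)).
  have [r0m m1] : (r0 < (r0 + 1) / 2) * ((r0 + 1) / 2 < 1) by exact: midf_lt.
  have r31 : r3 < 1 by rewrite /r3 !gt_max r21 r11 m1.
  have r3P r : r3 <= r -> [/\ r2 <= r, r1 <= r & r0 < r].
    by rewrite /r3 !ge_max => /and3P[? ? h]; split => //; exact: lt_le_trans h.
  have Ml r : r3 <= r -> r < 1 -> (2 * `|M| + 2) * inv_log r <= e1.
    by move=> /r3P[h _ _] rl1; rewrite mulrC -ler_pdivlMr// Hr2.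
  have H1 : forall r, r3 <= r -> r < 1 -> wt r * - ln (1 - r) <= k + e1.
    move=> r r3r rl1; have [h2 h1 h0] := r3P r r3r; have rp := lt_le_trans r10 h1.
    have lr : 0 < - ln (1 - r) by rewrite oppr_gt0 ln_1B_lt0.
    have -> : wt r = (u r - l) + M * (1 - r) by rewrite /wt rl1 max_l// /w; ring.
    rewrite mulrDl; apply: lerD.
      apply: (@le_trans _ _ (k * inv_log r * - ln (1 - r))).
        by rewrite ler_pM2r//; apply: le_trans (uk r h0 rl1); exact: ler_norm.
      by rewrite -mulrA inv_logM// mulr1.
    apply: le_trans (Ml r r3r rl1).
    apply: (@le_trans _ _ (`|M| * ((1 - r) * - ln (1 - r)))).
      rewrite -mulrA ler_wpM2r ?ler_norm// mulr_ge0 ?(ltW lr)// subr_ge0 ltW//.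
    apply: le_trans (ler_wpM2l (normr_ge0 _) (xlog_le rp rl1)) _.
    have := inv_log_gt0 rp rl1; move: (inv_log r) => G G0.
    have -> : `|M| * (2 * G) = 2 * `|M| * G by ring.
    by rewrite [leRHS]mulrDl lerDl mulr_ge0// ltW.
  pose e2 := e1 / (`|M| + 1).
  have M2 : 0 < `|M| + 1 by rewrite ltr_wpDl.
  have e20 : 0 < e2 by rewrite divr_gt0.
  have H2 : forall r, r3 <= r -> r < 1 -> idf r * - ln (1 - r) <= e2.
    move=> r r3r rl1; have [h2 h1 h0] := r3P r r3r; have rp := lt_le_trans r10 h1.
    apply: le_trans (xlog_le rp rl1) _; rewrite ler_pdivlMr//.
    by apply: le_trans (Ml r r3r rl1); rewrite le_eqVlt; apply/orP; left; apply/eqP; ring.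
  have [N1 HN1] := mean_log_le eps0 ratio wt_continuous wt_nonincr (fun r _ _ => wt_ge0 r) r31 H1 e4.
  have e40 : 0 < e / 8 / (`|M| + 1) by rewrite divr_gt0.
  have [N2 HN2] := mean_log_le eps0 ratio idf_continuous idf_nonincr idf_ge0 r31 H2 e40.
  have A'1 : 0 < A' + 1 by rewrite ltr_wpDl.
  have [N3 HN3] := geometric_log t0 t1 (divr_gt0 e4 A'1).
  exists (maxn N1 (maxn N2 N3)) => n; rewrite !geq_max => /and3P[n1 n2 n3].
  have np (N : nat) : (N <= n)%N -> (N <= 2 * n + 1)%N.
    by move=> Nn; rewrite (leq_trans Nn)// mulSn mul1n -addnA leq_addr.
  have ll : ln (n%:R + 2) <= ln ((2 * n + 1)%:R + 1) :> R.
    rewrite ler_ln ?posrE ?ltr_wpDl// natrD natrM -addrA lerD//.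
    by rewrite ler_peMl// ler1n.
  have K1 := le_trans (ler_wpM2l (W0 n) ll) (HN1 _ (np _ n1)).
  have K2 := le_trans (ler_wpM2l (I0 n) ll) (HN2 _ (np _ n2)).
  have K3 := HN3 _ n3.
  rewrite /tau [leLHS]mulrDl [X in X + _ <= _]mulrDl.
  have {}K2 : `|M| * I n * ln (n%:R + 2) <= e / 8 + e / 8.
    rewrite -mulrA; apply: le_trans (ler_wpM2l (normr_ge0 _) K2) _.
    have pos : 0 <= 4 / eps * e2 + e / 8 / (`|M| + 1) by rewrite addr_ge0 ?ltW// mulr_gt0.
    apply: le_trans (ler_wpM2r pos (_ : `|M| <= `|M| + 1)) _; first by rewrite lerDl.
    rewrite le_eqVlt; apply/orP; left; apply/eqP; rewrite /e2 /e1.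
    move: M2 => + ; move: (`|M|) => m m0.
    move: (e / 8) (4 / eps) c4 => X D D0.
    have -> : (m + 1) * (D * (X / D / (m + 1)) + X / (m + 1)) =
      (D / D) * X * ((m + 1) / (m + 1)) + X * ((m + 1) / (m + 1)) by ring.
    by rewrite !divff ?mul1r ?mulr1// gt_eqF.
  have {}K3 : A' * t ^+ (2 * n) * ln (n%:R + 2) <= e / 8.
    rewrite -mulrA; apply: le_trans (ler_wpM2l A'0 K3) _.
    by rewrite mulrCA ler_piMr ?(ltW e4)// ler_pdivrMr// mul1r lerDl.
  have K1' : 4 / eps * (k + e1) + e / 8 = 4 / eps * k + e / 8 + e / 8.
    by rewrite mulrDr /e1 [_ * (_ / _)]mulrC divfK ?gt_eqF.
  move: K1; rewrite K1'; move: (W n * _) (4 / eps * k) K2 K3 => X Y.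
  by move: (`|M| * _ * _) (A' * _ * _) => Z T; lra.
Qed.

End one_sided.

Lemma log_slope_sub u (r0 s0 C : R) : r0 <= s0 -> log_slope u r0 C -> log_slope u s0 C.
Proof. by move=> rs us r sr r1; apply: us => //; exact: le_lt_trans sr. Qed.

Lemma log_slopeN u (r0 C : R) : log_slope u r0 C -> log_slope (fun r => - u r) r0 C.
Proof.
move=> us r r0r r1; have [Du H] := us r r0r r1; split; first exact: derivableN.
by rewrite derive1E deriveN//= -derive1E normrN.
Qed.

Lemma symbol_moments u F (delta C : R) : mu.-integrable `[0, 1] (EFin \o F) ->
  null_outside (fun r => 0 < r -> r < 1 -> r * u r = F r) ->
  0 <= delta -> delta < 1 -> 0 <= C -> log_slope u delta C ->
  derivative_semibounded u ->
  exists l (g tau : nat -> R), [/\ u r @[r --> (1 : R)^'-] --> l,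
    forall n, moment v u (2 * n + 1) / moment v (fun=> 1) (2 * n + 1) = l + g n,
    forall n, `|g n| <= tau n /\ `|g n - g n.+1| <= tau n - tau n.+1,
    exists B, forall n, tau n * ln (n%:R + 2) <= B &
    `|derive1 u r| * (1 - r) * ln (1 - r) ^+ 2 @[r --> (1 : R)^'-] --> 0 ->
    forall e, 0 < e -> exists N, forall n, (N <= n)%N -> tau n * ln (n%:R + 2) <= e].
Proof.
move=> iF uF d0 d1 C0 us sb.
have [l ll] := log_slope_limit d0 d1 C0 us.
have ul := log_limit_cvg d1 C0 ll.
have [g [tau [gE gt gk]]] : exists g tau : nat -> R, [/\
  forall n, moment v u (2 * n + 1) / moment v (fun=> 1) (2 * n + 1) = l + g n,
  forall n, `|g n| <= tau n /\ `|g n - g n.+1| <= tau n - tau n.+1 &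
  forall k r0, 0 <= k -> r0 < 1 ->
    (forall r, r0 < r -> r < 1 -> `|u r - l| <= k * inv_log r) ->
    forall e, 0 < e -> exists N, forall n, (N <= n)%N ->
      tau n * ln (n%:R + 2) <= 4 / eps * k + e].
  case: sb => [/limf_esup_bounded[M [r0 [r01 HM]]]|].
    have dm : Num.max delta r0 < 1 by rewrite gt_max d1.
    apply: (@one_sided_moments u F (Num.max delta r0) C l M) => //.
    - by rewrite le_max d0.
    - by apply: log_slope_sub us; rewrite le_max lexx.
    - by move=> r; rewrite gt_max => /andP[_]; exact: HM.
  (* A lower bound on u' is an upper bound on the derivative of - u. The case is reduced to - u,
     whose moments and limit change sign while [tau] is kept. *)
  have -> : (-oo < limf_einf (fun r => (derive1 u r)%:E) (1 : R)^'-)%E =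
      (limf_esup (EFin \o (fun r => - derive1 u r)%R) (1 : R)^'- < +oo)%E.
    have -> : limf_einf (fun r => (derive1 u r)%:E) (1 : R)^'- =
      (- limf_esup (EFin \o (fun r => - derive1 u r)%R) (1 : R)^'-)%E by [].
    by rewrite lteNr.
  move=> /limf_esup_bounded[M [r0 [r01 HM]]].
  have dm : Num.max delta r0 < 1 by rewrite gt_max d1.
  have iFN : mu.-integrable `[0, 1] (EFin \o (fun r => - F r)).
    by have := integrableN iF; apply: eq_integrable.
  have uFN : null_outside (fun r => 0 < r -> r < 1 -> r * - u r = - F r).
    have [N [mN N0 HN]] := uF; exists N; split => // r Nr r0' r1'.
    by rewrite mulrN HN.
  have dN : 0 <= Num.max delta r0 by rewrite le_max d0.
  have usN := log_slopeN (log_slope_sub (_ : delta <= Num.max delta r0) us).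
  have {}usN := usN ltac:(by rewrite le_max lexx).
  have HN r : Num.max delta r0 < r -> r < 1 -> derive1 (fun s => - u s) r <= M.
    rewrite gt_max => /andP[dr r0r] r1; have [Du _] := us r dr r1.
    by rewrite derive1E deriveN//= -derive1E HM.
  have ulN : - u r @[r --> (1 : R)^'-] --> - l by exact: cvgN.
  have [g [tau [gE gt gk]]] := one_sided_moments iFN uFN dN dm usN HN ulN.
  exists (fun n => - g n), tau; split => [n|n|k s0 k0 s01 Hk].
  - have mN : moment v (fun r => - u r) (2 * n + 1) = - moment v u (2 * n + 1).
      rewrite addn1 (moment_radial _ uFN) (moment_radial _ uF) /moment -mulN1r -RintegralZl//.
        by apply: eq_Rintegral => r _; ring.
      exact: moment_integrableM.
    have := gE n; rewrite mN mulNr => h.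
    by rewrite -[LHS]opprK h opprD opprK.
  - by have := gt n; rewrite -opprD !normrN.
  - by apply: gk k0 s01 _ => r sr r1; rewrite -opprD normrN; exact: Hk.
exists l, g, tau; split => //.
  have [N HN] := gk C delta C0 d1 ll 1 ltr01.
  exists (4 / eps * C + 1 + \sum_(i < N) `|tau i * ln (i%:R + 2)|) => n.
  have s0 : 0 <= \sum_(i < N) `|tau i * ln (i%:R + 2)| by exact: sumr_ge0.
  have c0 : 0 <= 4 / eps * C + 1 by rewrite addr_ge0// mulr_ge0// divr_ge0// ltW.
  have [Nn|nN] := leqP N n; first by apply: le_trans (HN n Nn) _; rewrite lerDl.
  apply: le_trans (ler_norm _) _.
  apply: (@le_trans _ _ (\sum_(i < N) `|tau i * ln (i%:R + 2)|)); last by rewrite lerDr.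
  by rewrite (bigD1 (Ordinal nN))//= lerDl; exact: sumr_ge0.
(* Chosen so that (4 / eps) k = e / 2; the other half of e is the additive error. *)
move=> small e e0; pose k : R := e * eps / 8.
have k0 : 0 < k by rewrite !divr_gt0// mulr_gt0.
have [d [d1' dd Hd]] : exists d, [/\ d < 1, delta <= d & forall r, d < r -> r < 1 ->
    `|derive1 u r| * (1 - r) * ln (1 - r) ^+ 2 <= k].
  have /cvgrPdist_lt/(_ _ k0)[d /= dd Hd] := small.
  exists (Num.max delta (1 - d)); split.
  - by rewrite gt_max d1 gtrBl.
  - by rewrite le_max lexx.
  - move=> r; rewrite gt_max => /andP[dr drr] r1; apply: le_trans (ler_norm _) _.
    have := Hd r _ r1; rewrite sub0r normrN => H; apply/ltW/H => /=.
    by rewrite ger0_norm ?subr_ge0 ?(ltW r1)//; move: drr; lra.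
have usk : log_slope u d k.
  move=> r dr r1; have [Du _] := us r (le_lt_trans dd dr) r1; split => //.
  have rp : 0 < r by apply: le_lt_trans dr; exact: le_trans dd.
  rewrite ler_pdivlMr; last first.
    apply: mulr_gt0; first by rewrite subr_gt0.
    by rewrite exprn_even_gt0//= lt_eqF// ln_1B_lt0.
  by rewrite mulrA; apply: Hd.
have d0' : 0 <= d by exact: le_trans dd.
have [N HN] := gk k d (ltW k0) d1' (log_slope_limit_le d0' (ltW k0) usk ul) (e / 2) (divr_gt0 e0 (ltr0Sn _ 1)).
exists N => n Nn; apply: le_trans (HN n Nn) _.
have -> : 4 / eps * k = e / 2 by rewrite /k; field; rewrite gt_eqF.
by rewrite -splitr.
Qed.

End symbol.

(** * Radial integrable symbols *)

Section expanding.
Variable R : realType.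
Notation mu := (@lebesgue_measure R).
Variable phi : measurableTypeR R -> measurableTypeR R.
Hypothesis mphi : measurable_fun setT phi.
Hypothesis exp_phi : forall r s : R, `|r - s| <= `|phi r - phi s|.

(** Lebesgue measure is the infimum over coverings by intervals ]a, b]. The preimage of such an
    interval has diameter at most b - a, hence fits in an interval of that length. *)
Lemma expanding_preimage (B : set (measurableTypeR R)) : measurable B ->
  (mu (phi @^-1` B) <= mu B)%E.
Proof.
move=> mB; rewrite {2}/lebesgue_measure /lebesgue_stieltjes_measure /measure_extension.
apply: le_ereal_inf_tmp => _ [A [mA BA] <-].
have mA' k : measurable (A k : set (measurableTypeR R)).
  by have [[a b] _ <-] := mA k; exact: measurable_itv.
have mpre (C : set (measurableTypeR R)) : measurable C -> measurable (phi @^-1` C).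
  by move=> mC; rewrite -[X in measurable X]setTI; exact: mphi.
have sub : phi @^-1` B `<=` \bigcup_k (phi @^-1` (A k)).
  by move=> r /BA[k _ Ak]; exists k.
have mpA k : measurable (phi @^-1` (A k)) by exact: mpre.
apply: le_trans (measure_sigma_subadditive mu mpA (mpre _ mB) sub) _.
apply: lee_nneseries => // k _ /=.
have [[a b] _ Ak] := mA k; rewrite -Ak /=.
have [[r0 r0S]|S0] := pselect (phi @^-1` `]a, b]%classic !=set0); last first.
  have -> : phi @^-1` `]a, b]%classic = set0.
    by rewrite -subset0 => r rS; apply: S0; exists r.
  by rewrite measure0; apply: wlength_itv_ge0 => x y.
have ab : a <= b by move: r0S; rewrite /= in_itv/= => /andP[/ltW h1 h2]; exact: le_trans h2.
rewrite wlength_itv_bnd//=.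
set S := phi @^-1` `]a, b]%classic.
have diam r s : S r -> S s -> r - (b - a) <= s.
  rewrite /S/= !in_itv/= => /andP[ar rb] /andP[as_ sb].
  have := exp_phi r s; have := ler_norm (r - s).
  have : `|phi r - phi s| <= b - a by rewrite ler_norml; lra.
  by lra.
have Slb : has_lbound S by exists (r0 - (b - a)) => s Ss; exact: diam.
apply: (@le_trans _ _ (mu `[inf S, inf S + (b - a)]%classic)).
  apply: le_measure; rewrite ?inE//; first exact: mpre.
  move=> r Sr /=; rewrite in_itv/= ge_inf//= -lerBlDr.
  by apply: lb_le_inf; [exists r0|move=> s Ss; exact: diam].
rewrite lebesgue_measure_itv/= lte_fin; case: ifPn => [_|_].
  by rewrite -EFinB lee_fin addrAC subrr add0r.
by rewrite lee_fin subr_ge0.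
Qed.

(** The left side is the integral of g against the push-forward of Lebesgue measure, a measure
    dominated by Lebesgue measure. *)
Lemma expanding_integral (g : measurableTypeR R -> \bar R) : measurable_fun setT g ->
  (forall r, 0 <= g r)%E -> (\int[mu]_r g (phi r) <= \int[mu]_r g r)%E.
Proof.
move=> mg g0.
have E := @ge0_integral_pushforward _ _ _ _ R phi mphi mu setT g measurableT mg (fun r _ => g0 r).
move: E; rewrite preimage_setT => <-.
by apply: ge0_le_measure_integral => // S mS; exact: expanding_preimage.
Qed.

End expanding.

Section planar.
Variable R : realType.
Notation mu := (@lebesgue_measure R).
Notation RR := (measurableTypeR R).
Implicit Types (x r s : R).

(* The radius r at a fixed abscissa x is sent to the ordinate y = sqrt (r^2 - x^2)
   of the point at distance r from 0, an expanding map; the values for the other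
   r and x only serve to make the map expanding everywhere. *)
Definition ordinate x r : R :=
  if (0 < x) && (x < r) then Num.sqrt (r ^+ 2 - x ^+ 2) else r - x.

Lemma ordinate_expanding x r s : `|r - s| <= `|ordinate x r - ordinate x s|.
Proof.
wlog sr : r s / s <= r.
  move=> H; have [|/ltW rs] := leP s r; first exact: H.
  by rewrite distrC [leRHS]distrC; exact: H.
suff : r - s <= ordinate x r - ordinate x s.
  move=> h; have h0 : 0 <= r - s by rewrite subr_ge0.
  by rewrite !ger0_norm// (le_trans h0).
have key a b : 0 < x -> x < a -> x <= b -> a <= b ->
    b - a <= Num.sqrt (b ^+ 2 - x ^+ 2) - Num.sqrt (a ^+ 2 - x ^+ 2).
  move=> x0 xa xb ab.
  have A0 : 0 < a ^+ 2 - x ^+ 2 by rewrite subr_gt0 ltrXn2r// ?nnegrE ltW// (lt_trans x0).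
  have a0 : 0 < a by exact: lt_trans xa.
  have b0 : 0 < b by exact: lt_le_trans ab.
  have B0 : 0 <= b ^+ 2 - x ^+ 2.
    by rewrite (le_trans (ltW A0))// lerD2r lerXn2r ?nnegrE ?(ltW a0) ?(ltW b0).
  have sa0 : 0 < Num.sqrt (a ^+ 2 - x ^+ 2) by rewrite sqrtr_gt0.
  have sb0 := sqrtr_ge0 (b ^+ 2 - x ^+ 2).
  have ea := sqr_sqrtr (ltW A0); have eb := sqr_sqrtr B0.
  move: (Num.sqrt (b ^+ 2 - _)) (Num.sqrt _) sa0 sb0 ea eb => sb sa sa0 sb0 ea eb.
  have saa : sa <= a by rewrite -(@ler_pXn2r _ 2) ?nnegrE ?(ltW sa0) ?(ltW a0)// ea gerBl sqr_ge0.
  have sbb : sb <= b by rewrite -(@ler_pXn2r _ 2) ?nnegrE ?(ltW b0)// eb gerBl sqr_ge0.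
  have ss0 : 0 < sb + sa by rewrite ltr_wpDl.
  rewrite -(ler_pM2r ss0).
  have -> : (sb - sa) * (sb + sa) = (b - a) * (b + a).
    have -> : (sb - sa) * (sb + sa) = sb ^+ 2 - sa ^+ 2 by ring.
    by rewrite ea eb; ring.
  by rewrite ler_wpM2l ?subr_ge0// lerD.
rewrite /ordinate; have [x0|x0] /= := ltP 0 x; last by lra.
have [xr|rx] := ltP x r; have [xs|sx] := ltP x s.
- exact: key x0 xs (ltW xr) sr.
- suff : r - x <= Num.sqrt (r ^+ 2 - x ^+ 2) by lra.
  have r0 := lt_trans x0 xr; have rx0 : 0 <= r - x by rewrite subr_ge0 ltW.
  rewrite -[leLHS](ger0_norm rx0) -sqrtr_sqr; apply: ler_wsqrtr.
  have -> : r ^+ 2 - x ^+ 2 = (r - x) * (r + x) by ring.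
  by rewrite expr2 ler_wpM2l// lerD2l; lra.
- by have := lt_le_trans xs sr; rewrite ltNge rx.
- by lra.
Qed.

Lemma measurable_ordinate : measurable_fun [set: RR * RR] (fun p : RR * RR => ordinate p.2 p.1 : RR).
Proof.
have m1 : measurable_fun [set: RR * RR] (fun p : RR * RR => p.1 : RR) by exact: measurable_fst.
have m2 : measurable_fun [set: RR * RR] (fun p : RR * RR => p.2 : RR) by exact: measurable_snd.
apply: measurable_fun_ifT => /=.
- by apply: measurable_and; apply: measurable_fun_ltr => //; exact: measurable_cst.
- apply: (@measurableT_comp _ _ _ _ _ _ (@Num.sqrt R)).
    by apply: continuous_measurable_fun; exact: sqrt_continuous.
  by apply: measurable_funB; apply: measurable_funX.
- exact: measurable_funB.
Qed.

Variable f : RR * RR -> R.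
Hypothesis mf : measurable_fun setT f.

(** For p = (r, x) with 0 < x < r, the value of f at the point of abscissa x and positive ordinate
    on the circle of radius r. Fixing r follows a circle, fixing x a vertical line. *)
Definition circle_fun (p : RR * RR) : R := f (p.2, ordinate p.2 p.1).

Lemma measurable_circle_fun : measurable_fun setT circle_fun.
Proof.
apply: (measurableT_comp mf); apply: measurable_fun_pair; first exact: measurable_snd.
exact: measurable_ordinate.
Qed.

Lemma circle_integral_le :
  (\int[mu]_x \int[mu]_r `|(circle_fun (r, x))%:E| <= \int[mu]_x \int[mu]_y `|(f (x, y))%:E|)%E.
Proof.
apply: ge0_le_integral => //.
- by move=> x _; exact: integral_ge0.
- have := @measurable_fun_fubini_tonelli_G _ _ _ _ R mu (fun p => `|(circle_fun p)%:E|%E).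
  apply => //; apply: measurableT_comp => //; apply/measurable_EFinP.
  exact: measurable_circle_fun.
- have := @measurable_fun_fubini_tonelli_F _ _ _ _ R mu (fun p => `|(f p)%:E|%E).
  by apply => //; apply: measurableT_comp => //; exact/measurable_EFinP.
move=> x _.
have mo : measurable_fun [set: RR] (ordinate x : RR -> RR).
  by have := measurableT_comp measurable_ordinate (@pair2_measurable _ _ RR RR x).
apply: (expanding_integral mo (ordinate_expanding x) (g := fun y => `|(f (x, y))%:E|%E)) => //.
apply: measurableT_comp => //; apply/measurable_EFinP.
exact: (measurableT_comp mf (pair1_measurable x)).
Qed.

End planar.

Section radial.
Variable R : realType.
Notation mu := (@lebesgue_measure R).
Notation RR := (measurableTypeR R).
Implicit Types (x r s : R).
Local Open Scope ereal_scope.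

Lemma abse_fine_le (x : \bar R) : `|(fine x)%:E| <= `|x|.
Proof. by case: x => [r| |] //=; rewrite leey. Qed.

Lemma integral_abs_null (k : RR -> \bar R) : measurable_fun setT k ->
  \int[mu]_x `|k x| = 0 -> null_outside (fun x => k x = 0).
Proof.
move=> mk k0; have [N [mN N0 HN]] := (ae_eq_integral_abs mu measurableT mk).1 k0.
exists N; split => // x Nx; apply: contrapT => kx; apply: Nx; apply: HN => /= H.
by apply: kx; exact: H.
Qed.

Lemma fubini_null (k : RR * RR -> R) : measurable_fun setT k ->
  \int[mu]_x \int[mu]_r `|(k (r, x))%:E| = 0 ->
  null_outside (fun r => null_outside (fun x => k (r, x) = 0%R)).
Proof.
move=> mk k0.
have mk' : measurable_fun setT (fun p => `|(k p)%:E|).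
  by apply: measurableT_comp => //; exact/measurable_EFinP.
have := @fubini_tonelli _ _ _ _ R mu mu _ mk' (fun p => abse_ge0 _).
rewrite /fubini_F /fubini_G k0 => k1.
have mF := @measurable_fun_fubini_tonelli_F _ _ _ _ R mu _ mk' (fun p => abse_ge0 _).
have [|N [mN N0 HN]] := integral_abs_null mF.
  rewrite -[RHS]k1; apply: eq_integral => r _.
  by rewrite gee0_abs//; exact: integral_ge0.
exists N; split => // r /HN kr0.
have mkr : measurable_fun [set: RR] (fun x : RR => (k (r, x))%:E).
  by apply/measurable_EFinP; exact: (measurableT_comp mk (pair1_measurable r)).
have [M [mM M0 HM]] := integral_abs_null mkr kr0.
by exists M; split => // x /HM[].
Qed.

(** The pairs (r, x) that parametrize the open quarter disc x, y > 0, where [ordinate] is the square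
    root. *)
Definition sector : set (RR * RR) := [set p | [/\ 0 < p.2, p.2 < p.1 & p.1 < 1]%R].

Lemma measurable_sector : measurable sector.
Proof.
have m1 : measurable_fun [set: RR * RR] (fun p : RR * RR => p.1 : RR) by exact: measurable_fst.
have m2 : measurable_fun [set: RR * RR] (fun p : RR * RR => p.2 : RR) by exact: measurable_snd.
have m3 : measurable_fun [set: RR * RR] (fun p : RR * RR => (p.1 - p.2)%R : RR).
  exact: measurable_funB.
have -> : sector = ((fun p : RR * RR => p.2 : RR) @^-1` `]0%R, +oo[ `&`
    (fun p : RR * RR => (p.1 - p.2)%R : RR) @^-1` `]0%R, +oo[) `&`
    (fun p : RR * RR => p.1 : RR) @^-1` `]-oo, 1%R[.
  apply/seteqP; split => p; rewrite /sector/= !in_itv/= !andbT subr_gt0.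
    by case.
  by move=> [[]].
by apply: measurableI; [apply: measurableI|]; rewrite -[X in measurable X]setTI;
  [apply: m2|apply: m3|apply: m1].
Qed.

(** For almost every r the function x -> f(x, sqrt(r^2 - x^2)) equals u(r) for almost every x of ]0,
    r[, so integrating over x gives r u(r): the factor r is the length of ]0, r[. Expanding maps
    give the integrability and carry the null set N to a null set of pairs (r, x). *)
Lemma radial_integrable (f : RR * RR -> R) (u : R -> R) (N : set (RR * RR)) :
  (@area R).-integrable setT (EFin \o f) -> measurable N -> @area R N = 0 ->
  (forall p, ~ N p -> (p.1 ^+ 2 + p.2 ^+ 2 < 1)%R ->
    f p = u (Num.sqrt (p.1 ^+ 2 + p.2 ^+ 2))) ->
  exists2 F : R -> R, mu.-integrable `[0%R, 1%R] (EFin \o F) &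
    null_outside (fun r => 0 < r -> r < 1 -> (r * u r)%R = F r)%R.
Proof.
move=> fi mN N0 fu.
have mf : measurable_fun setT f by have /integrableP[/measurable_EFinP] := fi.
have mcf := measurable_circle_fun mf.
have ic : (@area R).-integrable setT (EFin \o circle_fun f).
  apply/(integrable21ltyP mu mu); first exact/measurable_EFinP.
  apply: le_lt_trans (circle_integral_le mf) _.
  have mf' : measurable_fun setT (EFin \o f) by exact/measurable_EFinP.
  exact: ((integrable12ltyP mu mu mf').1 fi).
pose h p := (circle_fun f p * \1_sector p)%R.
have mh : measurable_fun setT h.
  by apply: measurable_funM => //; apply: measurable_indic; exact: measurable_sector.
have ih : (@area R).-integrable setT (EFin \o h).
  apply: le_integrable ic => //; first exact/measurable_EFinP.
  move=> p _ /=; rewrite lee_fin /h normrM ler_piMr// indicE.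
  by case: (_ \in _); rewrite ?normr1 ?normr0.
have iG := @integrable_fubini_F _ _ _ _ R mu mu _ ih.
pose F r := fine (fubini_F mu (EFin \o h) r).
exists F.
  have iFT : mu.-integrable setT (EFin \o F).
    apply: (le_integrable _ _ _ iG) => //.
      apply/measurable_EFinP; apply: measurableT_comp; first exact: fine_measurable.
      by have /integrableP[] := iG.
    by move=> r _; exact: abse_fine_le.
  by apply: (@integrableS _ RR R mu setT) => //; exact: measurable_itv.
have mg : measurable_fun [set: RR * RR] (\1_N : RR * RR -> R) by exact: measurable_indic.
have gle := circle_integral_le mg.
have g0 : \int[mu]_x \int[mu]_y `|((\1_N : RR * RR -> R) (x, y))%:E| = 0.
  have mg' : measurable_fun setT (fun p => `|((\1_N : RR * RR -> R) p)%:E|).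
    by apply: measurableT_comp => //; exact/measurable_EFinP.
  rewrite -(@fubini_tonelli1 _ _ _ _ R mu mu _ mg' (fun p => abse_ge0 _)).
  rewrite (eq_integral (fun p => ((\1_N : RR * RR -> R) p)%:E)); last first.
    by move=> p _; rewrite gee0_abs// lee_fin.
  by rewrite integral_indic// setIT.
have c0 : \int[mu]_x \int[mu]_r `|(circle_fun (\1_N : RR * RR -> R) (r, x))%:E| = 0.
  apply/eqP; rewrite eq_le -{1}g0 gle/=.
  by apply: integral_ge0 => x _; exact: integral_ge0.
have [M [mM M0 HM]] := fubini_null (measurable_circle_fun mg) c0.
exists M; split => // r Mr r0 r1; have [L [mL L0 HL]] := HM r Mr.
rewrite /F /fubini_F.
rewrite (@eq_integral_null _ _ R mu L setT _ (fun x => ((u r)%:E * (\1_(`]0%R, r[%classic) x)%:E)))//.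
  rewrite integralZl//; last exact: (integrable_indic_itv 0%R r false true).
  have mi : measurable (`]0%R, r[%classic : set RR) by exact: measurable_itv.
  rewrite integral_indic//.
  have lm : mu (`]0%R, r[%classic : set R) = r%:E.
    by rewrite lebesgue_measure_itv/= lte_fin r0 sube0.
  by rewrite setIT; transitivity (fine ((u r)%:E * r%:E)); [rewrite -EFinM/= mulrC|rewrite -lm].
move=> x _ /HL; rewrite /= /h /circle_fun /= -EFinM => xN; congr EFin.
have [/andP[x0 xr]|nx] := boolP ((0 < x) && (x < r))%R; last first.
  rewrite !indicE !memNset ?mulr0//=; last by move=> [x0 xr _]; move: nx; rewrite x0 xr.
  by rewrite in_itv/=; exact/negP.
rewrite !indicE !mem_set ?mulr1//=; last by rewrite in_itv/= x0.
move: xN; rewrite /ordinate x0 xr/= => xN.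
have e2 : (x ^+ 2 + Num.sqrt (r ^+ 2 - x ^+ 2) ^+ 2 = r ^+ 2)%R.
  by rewrite sqr_sqrtr ?subr_ge0 ?lerXn2r ?nnegrE ?(ltW x0) ?(ltW r0) ?(ltW xr)// addrC subrK.
rewrite fu /= ?e2; first by rewrite sqrtr_sqr gtr0_norm.
  by move=> Np; move: xN; rewrite indicE mem_set// => /eqP; rewrite oner_eq0.
by rewrite expr_lt1// ltW.
Qed.

End radial.

Section symbols.
Variable R : realType.
Notation mu := (@lebesgue_measure R).
Notation RR := (measurableTypeR R).

Lemma modulus_Complex (x y : R) : modulus (x +i* y) = Num.sqrt (x ^+ 2 + y ^+ 2).
Proof. by rewrite /modulus normc_def. Qed.

Lemma plane_discE (p : R * R) : plane_disc p <-> p.1 ^+ 2 + p.2 ^+ 2 < 1.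
Proof.
rewrite /plane_disc/= /unit_disc/= modulus_Complex -{1}sqrtr1 ltr_sqrt ?ltr01//.
Qed.

Lemma measurable_plane_disc : measurable (@plane_disc R : set (RR * RR)).
Proof.
have m1 : measurable_fun [set: RR * RR] (fun p : RR * RR => p.1 : RR) by exact: measurable_fst.
have m2 : measurable_fun [set: RR * RR] (fun p : RR * RR => p.2 : RR) by exact: measurable_snd.
have m3 : measurable_fun [set: RR * RR] (fun p : RR * RR => p.1 ^+ 2 + p.2 ^+ 2 : RR).
  by apply: measurable_funD; exact: measurable_funX.
have -> : @plane_disc R = (fun p : RR * RR => p.1 ^+ 2 + p.2 ^+ 2 : RR) @^-1` `]-oo, 1[.
  by apply/seteqP; split => p; rewrite /= in_itv/= => /plane_discE.
by rewrite -[X in measurable X]setTI; apply: m3.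
Qed.

(* proj is the real or the imaginary part *)
Lemma radial_symbol_integrable (a : R[i] -> R[i]) (proj : R[i] -> R) :
  (@area R).-integrable (@plane_disc R) (fun p => (proj (a (p.1 +i* p.2)))%:E) ->
  radial_symbol a ->
  exists2 F : R -> R, mu.-integrable `[0, 1] (EFin \o F) &
    null_outside (fun r => 0 < r -> r < 1 -> r * proj (a r%:C) = F r).
Proof.
move=> ai [N [mN N0 aN]]; pose f (p : RR * RR) := if `[< plane_disc p >] then proj (a (p.1 +i* p.2)) else 0.
apply: (@radial_integrable R f (fun r => proj (a r%:C)) N) => //.
  have := (integrable_mkcond _ measurable_plane_disc).1 ai.
  apply: eq_integrable => // p _; rewrite /patch /f /=.
  have [pD|pD] := pselect (plane_disc p).
    by rewrite mem_set// asboolT.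
  by rewrite memNset// asboolF.
move=> p Np p1; have pD : plane_disc p by exact/plane_discE.
rewrite /f asboolT// -modulus_Complex; congr proj.
by apply: contrapT => H; apply: Np; apply: aN => /= /(_ pD).
Qed.

End symbols.

(** * The operator *)

Section pser_linear.
Variable R : realType.
Implicit Types (c d : nat -> R[i]) (z : R[i]).

Lemma radius_combo (a b : R[i]) c d : radius_ge 1 c -> radius_ge 1 d ->
  radius_ge 1 (fun k => a * c k + b * d k).
Proof.
move=> rc rd s s0 s1; have [A HA] := rc s s0 s1; have [B HB] := rd s s0 s1.
exists (modulus a * A + modulus b * B) => k.
apply: (@le_trans _ _ ((modulus a * modulus (c k) + modulus b * modulus (d k)) * s ^+ k)).
  rewrite ler_wpM2r ?exprn_ge0 ?(ltW s0)// -!modulusM; exact: modulusD.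
by rewrite mulrDl -!mulrA lerD// ler_wpM2l ?modulus_ge0.
Qed.

Lemma psum_combo (a b : R[i]) c d n z :
  psum (fun k => a * c k + b * d k) n z = a * psum c n z + b * psum d n z.
Proof.
rewrite /psum !mulr_sumr -big_split/=; apply: eq_bigr => k _.
by rewrite mulrDl !mulrA.
Qed.

Lemma pser_combo (a b : R[i]) c d z : radius_ge 1 c -> radius_ge 1 d -> unit_disc z ->
  pser (fun k => a * c k + b * d k) z = a * pser c z + b * pser d z.
Proof.
move=> rc rd zD; have z1 : modulus z < 1 by exact: zD.
have [K [t [K0 t0 t1 Ht]]] := radius_tail rc z1 ltr01.
have [L [s [L0 s0 s1 Hs]]] := radius_tail rd z1 ltr01.
pose q := Num.max t s; have q0 : 0 <= q by rewrite le_max t0.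
have q1 : q < 1 by rewrite gt_max t1.
apply/esym/(@pser_unique R 1 _ _ _ (modulus a * K + modulus b * L) q) => //.
  exact: radius_combo.
move=> n; rewrite psum_combo.
have -> : a * pser c z + b * pser d z - (a * psum c n z + b * psum d n z) =
  a * (pser c z - psum c n z) + b * (pser d z - psum d n z) by ring.
apply: le_trans (modulusD _ _) _; rewrite !modulusM mulrDl -!mulrA; apply: lerD.
  rewrite ler_wpM2l ?modulus_ge0//; apply: le_trans (Ht z n (lexx _)) _.
  by rewrite ler_wpM2l// lerXn2r ?nnegrE// le_max lexx.
rewrite ler_wpM2l ?modulus_ge0//; apply: le_trans (Hs z n (lexx _)) _.
by rewrite ler_wpM2l// lerXn2r ?nnegrE// le_max lexx orbT.
Qed.

Lemma geometric_small (K t e : R) : 0 <= K -> 0 <= t -> t < 1 -> 0 < e ->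
  exists N : nat, forall n, (N <= n)%N -> K * t ^+ n < e.
Proof.
move=> K0 t0 t1 e0; have d0 : 0 < 1 - t by rewrite subr_gt0.
exists (Num.bound (K / (1 - t) / e)).+1 => n Nn.
have n0 : 0 < n%:R :> R by rewrite ltr0n (leq_trans _ Nn).
have H : K / (1 - t) / e < n%:R.
  apply: (@lt_trans _ _ (Num.bound (K / (1 - t) / e))%:R); last by rewrite ltr_nat.
  by rewrite archi_boundP// !divr_ge0// ltW.
rewrite -(ltr_pM2r n0) -mulrA [t ^+ n * _]mulrC.
apply: le_lt_trans (ler_wpM2l K0 (natr_mul_expr_le n t0 t1)) _.
by move: H; rewrite ltr_pdivrMr// [n%:R * e]mulrC.
Qed.

Lemma pser_cvg c z : radius_ge 1 c -> unit_disc z ->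
  series (fun n => c n * z ^+ n : R[i]^o) @ \oo --> (pser c z : R[i]^o).
Proof.
move=> rc z1; have [K [t [K0 t0 t1 Ht]]] := radius_tail rc z1 ltr01.
apply/cvg_modulusP => e e0; have [N HN] := geometric_small K0 t0 t1 e0.
exists N => // n /= Nn; rewrite modulusC; apply: le_lt_trans (HN n Nn).
by apply: le_trans (Ht z n (lexx _)); rewrite /series/= big_mkord.
Qed.

End pser_linear.

(** * The weighted space through Taylor coefficients *)

Section hinf.
Variable R : realType.
Variable v : weight R.
Implicit Types (h f : Hinf v) (z : R[i]) (c d g : nat -> R[i]) (tau : nat -> R).

Definition Hnorm h : R := sup (weighted_values v h).

Lemma Hinf_normE h : `|h| = (Hnorm h)%:C. Proof. by []. Qed.

Lemma Hinf_hol h : holomorphic_disc h.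
Proof. by have /set_mem[] := Hinf_funP h. Qed.

Lemma Hnorm_ub h z : unit_disc z -> modulus (h z) * v (modulus z)%:C <= Hnorm h.
Proof.
move=> zD; have /set_mem[_ ub _] := Hinf_funP h.
by apply: ub_le_sup => //; exists z.
Qed.

Lemma Hnorm_le h (K : R) :
  (forall z, unit_disc z -> modulus (h z) * v (modulus z)%:C <= K) -> Hnorm h <= K.
Proof.
move=> H; apply: ge_sup; last by move=> _ [z zD <-]; exact: H.
exists (modulus (h 0) * v (modulus (0 : R[i]))%:C); exists 0 => //.
by rewrite /unit_disc/= modulus0 ltr01.
Qed.

Lemma Hinf_circles h : forall rho : R, 0 < rho -> rho < 1 ->
  exists M, forall z, modulus z = rho -> modulus (h z) <= M.
Proof. exact: weighted_bounded_circles (Hnorm_ub h). Qed.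

Lemma Hcoef_radius h : radius_ge 1 (taylor_coef h).
Proof. exact: taylor_radius (Hinf_hol (h := h)) (Hinf_circles h). Qed.

Lemma Hinf_pser h z : unit_disc z -> h z = pser (taylor_coef h) z.
Proof. exact: taylor_pser (Hinf_hol (h := h)) (Hinf_circles h) z. Qed.

Lemma Hcoef_combo (a b : R[i]) h f k :
  taylor_coef (a *: h + b *: f) k = a * taylor_coef h k + b * taylor_coef f k.
Proof.
apply: (@taylor_coef_pser R 1 (fun k => a * taylor_coef h k + b * taylor_coef f k)) => //.
  exact: radius_combo (Hcoef_radius h) (Hcoef_radius f).
move=> z zD; rewrite pser_combo ?Hinf_pser//; try exact: Hcoef_radius.
by rewrite -!Hinf_pser.
Qed.

Lemma Hcoef_linear (b : R[i]) h f k :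
  taylor_coef (b *: h + f : Hinf v) k = b * taylor_coef h k + taylor_coef f k.
Proof.
have -> : taylor_coef (b *: h + f : Hinf v) k =
    taylor_coef (b *: (h : R[i]^o -> R[i]^o) + 1 *: (f : R[i]^o -> R[i]^o)) k.
  by congr (taylor_coef _ k); rewrite scale1r.
by rewrite Hcoef_combo mul1r.
Qed.

Lemma HcoefB h f k : taylor_coef (h - f : Hinf v) k = taylor_coef h k - taylor_coef f k.
Proof. by rewrite addrC -scaleN1r Hcoef_linear mulN1r addrC. Qed.

Definition disc_pser c : R[i]^o -> R[i]^o := fun z =>
  if `[< unit_disc z >] then pser c z else 0.

Lemma disc_pser_in c z : unit_disc z -> disc_pser c z = pser c z.
Proof. by move=> zD; rewrite /disc_pser asboolT. Qed.

Lemma disc_pser_Hinf c (K : R) : radius_ge 1 c ->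
  (forall z, unit_disc z -> modulus (pser c z) * v (modulus z)%:C <= K) ->
  disc_pser c \in Hinf_pred v.
Proof.
move=> rc cK; apply/mem_set; split.
- move=> z zD; apply/cdiffP; have [d Hd] := cdiff_pser rc zD; exists d.
  apply: (@cderiv_local R (pser c) _ z d (1 - modulus z)) Hd.
    by rewrite subr_gt0.
  move=> w wz; rewrite disc_pser_in// /unit_disc/= -(subrK z w).
  by apply: le_lt_trans (modulusD _ _) _; rewrite -ltrBrDr.
- by exists K => _ [z zD <-]; rewrite disc_pser_in//; exact: cK.
- by move=> z zD; rewrite /disc_pser asboolF.
Qed.

Lemma disc_pser_coef c k : radius_ge 1 c -> taylor_coef (disc_pser c) k = c k.
Proof.
by move=> rc; apply: (@taylor_coef_pser R 1) => // z zD; rewrite disc_pser_in.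
Qed.

Lemma Hinf_ext h f : (forall k, taylor_coef h k = taylor_coef f k) -> h = f.
Proof.
move=> hf; apply: val_inj; apply/funext => z /=.
have [zD|zD] := pselect (unit_disc z).
  by rewrite !Hinf_pser//; congr (pser _ z); apply/funext.
have /set_mem[_ _ h0] := Hinf_funP h; have /set_mem[_ _ f0] := Hinf_funP f.
by rewrite h0// f0.
Qed.

Lemma Hcoef_le h k (rho : R) : 0 < rho -> rho < 1 ->
  modulus (taylor_coef h k) * rho ^+ k * profile v rho <= 2 * Hnorm h.
Proof.
move=> rho0 rho1; have p0 := profile_gt0 v (ltW rho0) rho1.
rewrite -ler_pdivlMr// -mulrA; apply: (taylor_coef_le (Hinf_hol (h := h))) => //.
  exact: Hinf_circles.
move=> z zr; rewrite ler_pdivlMr//.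
have zD : unit_disc z by rewrite /unit_disc/= zr.
by have := Hnorm_ub h zD; rewrite weight_profile// zr.
Qed.

End hinf.

Section multiplier_operator.
Variable R : realType.
Variable v : weight R.
Hypothesis hB : condition_B v.
Implicit Types (h f : Hinf v) (z : R[i]) (c d g : nat -> R[i]) (tau : nat -> R).

Definition log_dominated g tau (E : R) :=
  dominated g tau /\ forall n, tau n * ln (n%:R + 2) <= E.

Lemma coef_operator_exists g tau (E : R) : log_dominated g tau E -> exists T : Hinf v -> Hinf v,
  forall h k, taylor_coef (T h) k = g k * taylor_coef h k.
Proof.
move=> [gt gE]; have [C C0 HC] := multiplier_bound hB.
have H h : exists f : Hinf v, forall k, taylor_coef f k = g k * taylor_coef h k.
  have rg : radius_ge 1 (fun k => g k * taylor_coef h k).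
    exact: dominated_radius gt (Hcoef_radius h).
  have Hb := HC E (Hnorm h) h g tau (Hinf_hol (h := h)) (@Hnorm_ub _ _ h) gt gE.
  exists (MkHinf (disc_pser_Hinf rg Hb)) => k; exact: disc_pser_coef.
by have [T HT] := choice H; exists T.
Qed.

Lemma coef_operator_norm : exists2 C : R, 0 < C & forall g tau (E : R) (f h : Hinf v),
  log_dominated g tau E -> (forall k, taylor_coef f k = g k * taylor_coef h k) ->
  Hnorm f <= C * E * Hnorm h.
Proof.
have [C C0 HC] := multiplier_bound hB; exists C => // g tau E f h [gt gE] fh.
apply: Hnorm_le => z zD; rewrite Hinf_pser//.
rewrite (_ : taylor_coef f = fun k => g k * taylor_coef h k); last exact/funext.
exact: (HC E (Hnorm h) h g tau (Hinf_hol (h := h)) (@Hnorm_ub _ _ h) gt gE).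
Qed.

Variables (l : R[i]) (gam : nat -> R[i]) (tau : nat -> R) (E : R).
Let g n := gam n - l.
Hypothesis gE : log_dominated g tau E.

Lemma multiplier_linear : exists T : {linear Hinf v -> Hinf v},
  (forall h k, taylor_coef (T h) k = gam k * taylor_coef h k) /\ bounded_operator T.
Proof.
have [S HS] := coef_operator_exists gE.
pose T h : Hinf v := l *: h + S h.
have Tc h k : taylor_coef (T h) k = gam k * taylor_coef h k.
  by rewrite /T Hcoef_linear HS /g -mulrDl addrC subrK.
have Tlin : linear T.
  move=> b h f; apply: Hinf_ext => k; rewrite Tc.
  by rewrite Hcoef_linear [RHS]Hcoef_linear !Tc; ring.
pose TL : {linear Hinf v -> Hinf v} := HB.pack T (GRing.isLinear.Build _ _ _ _ T Tlin).
exists TL; split; first exact: Tc.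
have [C C0 HC] := coef_operator_norm.
exists ((modulus l + C * E)%:C) => h.
apply: le_trans (ler_normD _ _) _; rewrite rmorphD mulrDl; apply: lerD.
  by rewrite normrZ modulusE.
by rewrite !Hinf_normE -rmorphM lecR; exact: HC gE (HS h).
Qed.

End multiplier_operator.

(** * Normal families along ultrafilters *)

Section ultrafilter.
Variables (Y : Type) (F : set_system Y).
Context {FU : UltraFilter F}.
Variable R : realType.

Lemma ultra_bounded_cvg (f : Y -> R) (M : R) : F [set y | `|f y| <= M] ->
  exists p, forall e : R, 0 < e -> F [set y | `|f y - p| < e].
Proof.
move=> FM.
have FM' : F (f @^-1` `[- M, M]%classic).
  rewrite (_ : _ @^-1` _ = [set y | `|f y| <= M])//.
  by apply/seteqP; split => y; rewrite /= in_itv/= ler_norml.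
have [p [_ pcl]] := @segment_compact R (- M) M (f @ F) (fmap_proper_filter f _) FM'.
exists p => e e0; have [//|nF] := in_ultra_setVsetC [set y | `|f y - p| < e] FU.
have /pcl : (f @ F) [set x | ~ `|x - p| < e] by [].
have pe : nbhs p (ball p e) by exact: nbhsx_ballx.
move=> /(_ _ pe) [x [/= h1]]; rewrite /ball/= distrC => h2.
by case: (h1 h2).
Qed.

Variable v : weight R.

(** A Montel theorem on coefficients: each Taylor coefficient converges along the ultrafilter, and
    uniform Cauchy estimates carry the norm bound to the limit. The finite weighted sums in the
    conclusion are those of [truncation_estimate]. *)
Lemma ball_limit (X : Y -> Hinf v) : F [set y | Hnorm (X y) <= 1] ->
  exists2 h : Hinf v, Hnorm h <= 1 & forall (w : nat -> R) n (e : R),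
    (forall k, 0 <= w k) -> 0 < e ->
    F [set y | \sum_(k < n) w k * modulus (taylor_coef (X y) k - taylor_coef h k) < e].
Proof.
move=> FX.
have cb (s : R) : 0 < s -> s < 1 -> exists2 A : R, 0 < A &
    forall h : Hinf v, Hnorm h <= 1 -> forall k, modulus (taylor_coef h k) * s ^+ k <= A.
  move=> s0 s1; have ps := profile_gt0 v (ltW s0) s1.
  exists (2 / profile v s) => [|h h1 k]; first by rewrite divr_gt0.
  by rewrite ler_pdivlMr//; apply: le_trans (Hcoef_le h k s0 s1) _; lra.
have h0 : 0 < 2^-1 :> R by rewrite invr_gt0.
have h1 : 2^-1 < 1 :> R by rewrite invf_lt1// ltr1n.
have [A A0 HA] := cb _ h0 h1.
have bk k : F [set y | modulus (taylor_coef (X y) k) <= A / 2^-1 ^+ k].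
  by apply: filterS FX => y /= Xy; rewrite ler_pdivlMr ?exprn_gt0//; exact: HA.
have Hre k : exists p : R, forall e : R, 0 < e ->
    F [set y | `|complex.Re (taylor_coef (X y) k) - p| < e].
  apply: (@ultra_bounded_cvg _ (A / 2^-1 ^+ k)).
  by apply: filterS (bk k) => y /=; apply: le_trans; exact: Re_le_modulus.
have Him k : exists p : R, forall e : R, 0 < e ->
    F [set y | `|complex.Im (taylor_coef (X y) k) - p| < e].
  apply: (@ultra_bounded_cvg _ (A / 2^-1 ^+ k)).
  by apply: filterS (bk k) => y /=; apply: le_trans; exact: Im_le_modulus.
have [p Hp] := choice Hre; have [q Hq] := choice Him.
pose c k := p k +i* q k.
have cl k (e : R) : 0 < e -> F [set y | modulus (taylor_coef (X y) k - c k) < e].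
  move=> e0; have e2 : 0 < e / 2 by rewrite divr_gt0.
  apply: filterS (filterI (Hp k _ e2) (Hq k _ e2)) => y /= [pe qe].
  apply: le_lt_trans (modulus_le_ReIm _) _.
  move: pe qe; rewrite /c; case: (taylor_coef _ _) => a b /=; lra.
have csum (w : nat -> R) n (e : R) : (forall k, 0 <= w k) -> 0 < e ->
    F [set y | \sum_(k < n) w k * modulus (taylor_coef (X y) k - c k) < e].
  move=> w0; elim: n e => [|n IH] e e0.
    by apply: filterS filterT => y _ /=; rewrite big_ord0.
  have e2 : 0 < e / 2 by rewrite divr_gt0.
  have w1 : 0 < w n + 1 by rewrite ltr_wpDl.
  apply: filterS (filterI (IH _ e2) (cl n _ (divr_gt0 e2 w1))) => y /= [H1 H2].
  rewrite big_ord_recr/=; have := modulus_ge0 (taylor_coef (X y) n - c n).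
  move: H2; rewrite ltr_pdivlMr//; move: (modulus _) (w n) (w0 n) => m W W0 H2 m0.
  by move: H1 H2; move: (\sum_(_ < _) _) => S; lra.
have cs (s : R) : 0 < s -> s < 1 -> exists2 A : R, 0 < A &
    (forall h : Hinf v, Hnorm h <= 1 -> forall k, modulus (taylor_coef h k) * s ^+ k <= A) /\
    forall k, modulus (c k) * s ^+ k <= A.
  move=> s0 s1; have [A' A'0 HA'] := cb s s0 s1; exists (A' + 1); first by rewrite addr_gt0.
  split=> [h Hh k|k]; first by apply: le_trans (HA' h Hh k) _; rewrite lerDl.
  have sk : 0 < s ^+ k by exact: exprn_gt0.
  have sk1 : s ^+ k <= 1 by rewrite exprn_ile1// ltW.
  have [y [/= y1 y2]] := @filter_ex _ F _ _ (filterI FX (cl k _ ltr01)).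
  have := HA' (X y) y1 k.
  have : modulus (c k) <= modulus (taylor_coef (X y) k) + 1.
    have -> : c k = taylor_coef (X y) k - (taylor_coef (X y) k - c k) by ring.
    by apply: le_trans (modulusB _ _) _; rewrite lerD2l ltW.
  move=> /(ler_wpM2r (ltW sk)); rewrite mulrDl mul1r.
  by move: (modulus _ * _) (modulus _ * _) => a b; lra.
have rc : radius_ge 1 c by move=> s s0 s1; have [A' _ [_ H]] := cs s s0 s1; exists A'.
have cK z : unit_disc z -> modulus (pser c z) * v (modulus z)%:C <= 1.
  rewrite /unit_disc/= => z1; have z0 := modulus_ge0 z.
  have vz : 0 < v (modulus z)%:C by rewrite weight_profile// profile_gt0.
  pose s := (modulus z + 1) / 2.
  have [zs s1] : (modulus z < s) * (s < 1) by exact: midf_lt.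
  have s0 : 0 < s by exact: le_lt_trans zs.
  have [A' A'0 [HX Hc]] := cs s s0 s1.
  pose t := modulus z / s.
  have t0 : 0 <= t by rewrite divr_ge0// ltW.
  have t1 : t < 1 by rewrite ltr_pdivrMr// mul1r.
  apply/ler_addgt0Pr => e e0.
  (* Three errors: the tail of the limit series, the tail of the series of [X y], and the difference
     of their partial sums. *)
  pose e1 := e / (3 * v (modulus z)%:C).
  have e10 : 0 < e1 by rewrite divr_gt0// mulr_gt0.
  have Q0 : 0 <= 2 * (A' / (1 - t)).
    by rewrite mulr_ge0// divr_ge0 ?(ltW A'0)// subr_ge0 ltW.
  have [n Hn] := geometric_small Q0 t0 t1 e10.
  have [y [/= y1 y2]] := @filter_ex _ F _ _ (filterI FX (csum (fun=> 1) n _ (fun=> ler01) e10)).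
  have b1 := pser_tail n s0 Hc (lexx _) zs.
  have b2 := pser_tail n s0 (HX _ y1) (lexx _) zs.
  have b3 : modulus (psum c n z - psum (taylor_coef (X y)) n z) <= e1.
    rewrite /psum -sumrB; apply: le_trans (modulus_sum _ _ _) _.
    apply: le_trans (ltW y2); apply: ler_sum => k _.
    rewrite -mulrBl modulusM modulusC mul1r ler_piMr ?modulus_ge0//.
    by rewrite modulusX exprn_ile1// ltW.
  have bn := Hn n (leqnn n).
  have Xz : modulus (pser (taylor_coef (X y)) z) * v (modulus z)%:C <= 1.
    by rewrite -Hinf_pser//; apply: le_trans (Hnorm_ub _ _) y1.
  have main : modulus (pser c z) <= modulus (pser (taylor_coef (X y)) z) + 3 * e1.
    set px := pser (taylor_coef (X y)) z; set sx := psum (taylor_coef (X y)) n z.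
    have -> : pser c z = (pser c z - psum c n z) + (psum c n z - sx) - (px - sx) + px by ring.
    apply: le_trans (modulusD _ _) _; rewrite addrC lerD2l.
    apply: le_trans (modulusB _ _) _.
    have := modulusD (pser c z - psum c n z) (psum c n z - sx).
    move: b1 b2 b3 bn; rewrite -/t -/px -/sx.
    move: (modulus _) (modulus _) (modulus _) (modulus _) (_ * t ^+ n) => *; lra.
  move: main => /(ler_wpM2r (ltW vz)) /le_trans; apply; rewrite mulrDl lerD//.
  by rewrite /e1 le_eqVlt; apply/orP; left; apply/eqP; field; rewrite gt_eqF.
exists (MkHinf (disc_pser_Hinf rc cK)).
  by apply: Hnorm_le => z zD /=; rewrite disc_pser_in//; exact: cK.
move=> w n e w0 e0; apply: filterS (csum w n e w0 e0) => y /=.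
by under eq_bigr do rewrite -(disc_pser_coef _ rc).
Qed.

End ultrafilter.

(** * Compactness of coefficient multipliers *)

Section compactness.
Variable R : realType.
Variable v : weight R.
Hypothesis hB : condition_B v.
Variables (gam : nat -> R[i]) (T : {linear Hinf v -> Hinf v}).
Hypothesis Tc : forall h k, taylor_coef (T h) k = gam k * taylor_coef h k.
Implicit Types (h f : Hinf v) (z : R[i]).

(* The multiplier frozen at the index N has a small norm, and differs from gam by
   finitely many coefficients. *)
Lemma truncation_estimate (tau : nat -> R) : dominated gam tau ->
  (forall e : R, 0 < e -> exists N, forall n, (N <= n)%N -> tau n * ln (n%:R + 2) <= e) ->
  forall e : R, 0 < e -> exists (N : nat) (w : nat -> R), (forall k, 0 <= w k) /\
    forall x h, Hnorm x <= 1 -> Hnorm h <= 1 ->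
      Hnorm (T (x - h)) <=
      e + \sum_(k < N) w k * modulus (taylor_coef x k - taylor_coef h k).
Proof.
move=> gt small e e0; have [C C0 HC] := multiplier_bound hB.
(* The factor 2 bounds the norm of x - h, both being in the unit ball. *)
have C20 : 0 < C * 2 by rewrite mulr_gt0.
have [N HN] := small (e / (C * 2)) (divr_gt0 e0 C20).
have [P P0 HP] := profile_bounded v.
(* Freezing [tau] together with [gam] preserves [dominated]: both are constant up to N. *)
pose gN k := gam (maxn k N); pose tN k := tau (maxn k N).
have dN : dominated gN tN.
  move=> n; rewrite /gN /tN; split; first by have [] := gt (maxn n N).
  have [Nn|nN] := leqP N n.
    by rewrite (maxn_idPl (leqW Nn)); have [] := gt n.
  by rewrite (maxn_idPr nN) !subrr modulus0.
have lE n : tN n * ln (n%:R + 2) <= e / (C * 2).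
  apply: le_trans (HN (maxn n N) (leq_maxr _ _)); rewrite /tN ler_wpM2l//.
    by have [+ _] := gt (maxn n N); apply: le_trans; exact: modulus_ge0.
  by rewrite ler_ln ?posrE ?ltr_wpDl// lerD2r ler_nat leq_maxl.
exists N, (fun k => modulus (gam k - gam N) * P); split.
  by move=> k; rewrite mulr_ge0 ?modulus_ge0// ltW.
move=> x h x1 h1; apply: Hnorm_le => z zD.
have xh z' : unit_disc z' -> modulus ((x - h : Hinf v) z') * v (modulus z')%:C <= 2.
  move=> zD'; have v0 : 0 <= v (modulus z')%:C.
    by rewrite weight_profile// profile_ge0// modulus_ge0.
  have -> : (x - h : Hinf v) z' = x z' - h z' by [].
  apply: le_trans (ler_wpM2r v0 (modulusB _ _)) _; rewrite mulrDl.
  have := le_trans (Hnorm_ub x zD') x1; have := le_trans (Hnorm_ub h zD') h1.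
  by move: (_ * _) (_ * _) => a b; lra.
have main := HC _ 2 (x - h : Hinf v) gN tN (Hinf_hol (h := x - h)) xh dN lE z zD.
set d := taylor_coef (x - h : Hinf v) in main.
have rd : radius_ge 1 d := Hcoef_radius _.
pose r k : R[i] := if (k < N)%N then (gam k - gam N) * d k else 0.
have rr : radius_ge 1 r.
  move=> s s0 s1; have [A HA] := rd s s0 s1.
  have A0 : 0 <= A.
    by apply: le_trans (HA 0%N); rewrite mulr_ge0 ?modulus_ge0// exprn_ge0// ltW.
  exists (\sum_(k < N) modulus (gam k - gam N) * A) => k; rewrite /r; case: ifPn => kN.
    rewrite (bigD1 (Ordinal kN))//= modulusM -mulrA ler_wpDr//.
      by apply: sumr_ge0 => i _; rewrite mulr_ge0 ?modulus_ge0.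
    by rewrite ler_wpM2l ?modulus_ge0.
  by rewrite modulus0 mul0r; apply: sumr_ge0 => i _; rewrite mulr_ge0 ?modulus_ge0.
have z1 : modulus z < 1 by exact: zD.
have vz : 0 <= v (modulus z)%:C.
  by rewrite weight_profile// profile_ge0// modulus_ge0.
have rE : pser r z = psum r N z.
  apply/esym/(@pser_unique R 1 _ _ _ (\sum_(k < N) modulus (r k) * 2 ^+ N) 2^-1) => //.
  - by rewrite invf_lt1// ltr1n.
  - move=> n; have [Nn|nN] := leqP N n.
      have -> : psum r n z = psum r N z.
        rewrite /psum -(subnKC Nn) big_split_ord/= [X in _ + X]big1 ?addr0// => i _.
        by rewrite /r ltnNge leq_addr/= mul0r.
      rewrite subrr modulus0 mulr_ge0 ?exprn_ge0 ?invr_ge0// sumr_ge0// => i _.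
      by rewrite mulr_ge0 ?modulus_ge0// exprn_ge0.
    have -> : psum r N z - psum r n z = \sum_(i < N - n) r (n + i)%N * z ^+ (n + i).
      rewrite /psum -[in X in X - _](subnKC (ltnW nN)) big_split_ord/=.
      by rewrite addrAC subrr add0r.
    apply: (@le_trans _ _ (\sum_(k < N) modulus (r k))).
      rewrite -[in leRHS](subnKC (ltnW nN)) big_split_ord/= ler_wpDl//.
        by apply: sumr_ge0 => i _; exact: modulus_ge0.
      apply: le_trans (modulus_sum _ _ _) _; apply: ler_sum => i _.
      by rewrite modulusM ler_piMr ?modulus_ge0// modulusX exprn_ile1 ?modulus_ge0// ltW.
    rewrite mulr_suml; apply: ler_sum => i _; rewrite -mulrA ler_peMr ?modulus_ge0//.
    have e2 : (2 : R) ^+ n <= 2 ^+ N by rewrite ler_eXn2l ?ltr1n// ltnW.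
    by rewrite exprVn ler_pdivlMr ?mul1r// exprn_gt0.
have TE : T (x - h : Hinf v) z = pser (fun k => gN k * d k) z + psum r N z.
  have := pser_combo 1 1 (dominated_radius dN rd) rr zD; rewrite !mul1r -rE Hinf_pser// => <-.
  congr (pser _ z); apply/funext => k; rewrite Tc -/d !mul1r /r /gN; case: ltnP => kN.
    by rewrite mulrBl addrCA subrr addr0.
  by rewrite addr0.
rewrite TE; apply: le_trans (ler_wpM2r vz (modulusD _ _)) _; rewrite mulrDl lerD//.
  apply: le_trans main _; rewrite le_eqVlt; apply/orP; left; apply/eqP.
  by field; rewrite gt_eqF.
apply: (@le_trans _ _ ((\sum_(k < N) modulus (r k)) * P)).
  apply: ler_pM; rewrite ?modulus_ge0//; last first.
    by rewrite weight_profile// HP ?modulus_ge0// ltW.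
  apply: le_trans (modulus_sum _ _ _) _; apply: ler_sum => i _.
  by rewrite modulusM ler_piMr ?modulus_ge0// modulusX exprn_ile1 ?modulus_ge0// ltW.
rewrite mulr_suml; apply: ler_sum => k _.
by rewrite /r ltn_ord modulusM mulrAC /d HcoefB.
Qed.

(** The image of the closed ball is itself compact: preimages chosen along an ultrafilter converge
    coefficientwise to some h of the ball, and [truncation_estimate] upgrades this to norm
    convergence of the images to T h. *)
Lemma compact_of_small (tau : nat -> R) : dominated gam tau ->
  (forall e : R, 0 < e -> exists N, forall n, (N <= n)%N -> tau n * ln (n%:R + 2) <= e) ->
  compact_operator T.
Proof.
move=> gt small; rewrite /compact_operator.
set TB := [set T x | x in _].
suff cT : compact TB by exact: compact_precompact (@norm_hausdorff _ _) cT.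
rewrite compact_ultra => F FU FTB.
have Hx y : exists x : Hinf v, TB y -> Hnorm x <= 1 /\ T x = y.
  have [[x /= x1 xy]|nTB] := pselect (TB y); last by exists 0.
  by exists x => _; split => //; move: x1; rewrite Hinf_normE lecR.
have [X HX] := choice Hx.
have FX : F [set y | Hnorm (X y) <= 1] by apply: filterS FTB => y /HX[].
have [h h1 Hh] := ball_limit FX.
exists (T h); split.
  by exists h => //=; rewrite Hinf_normE lecR.
apply/cvgrPdist_lt => e e0.
have [e' e'E e'0] : exists2 e' : R, e = e'%:C & 0 < e'.
  exists (complex.Re e); first by case: e e0 => a b; rewrite ltcE/= => /andP[/eqP-> _].
  by case: e e0 => a b; rewrite ltcE/= => /andP[_].
have e20 : 0 < e' / 2 by rewrite divr_gt0.
have [N [w [w0 HT]]] := truncation_estimate gt small e20.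
apply: filterS (filterI FTB (Hh w N _ w0 e20)) => y /= [yT ys].
have [Xy1 Xy] := HX y yT.
rewrite -[X in T h - X]Xy distrC -linearB Hinf_normE e'E ltcR.
by apply: le_lt_trans (HT _ _ Xy1 h1) _; move: ys; lra.
Qed.

Lemma compact_limit (l : R[i]) :
  (forall e : R, 0 < e -> exists N, forall n, (N <= n)%N -> modulus (gam n - l) < e) ->
  compact_operator T -> l = 0.
Proof.
move=> gl; rewrite /compact_operator; set TB := [set T x | x in _].
rewrite precompactE => cT.
have [rho peak _] := hB.
(* The exponent is n + 1 because peaks exist only for positive exponents. Dividing by the peak value
   of r^(n+1) v(r) gives norm at most 1. *)
have mono n : exists x : Hinf v, Hnorm x <= 1 /\
    forall k, taylor_coef x k = if k == n.+1 then
      ((rho n.+1%:R ^+ n.+1 * profile v (rho n.+1%:R))^-1)%:C else 0.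
  have n0 : 0 < n.+1%:R :> R by rewrite ltr0n.
  have rn := rho_gt0 peak n0; have pn := profile_rho peak n0.
  set M : R := rho n.+1%:R ^+ n.+1 * _.
  have M0 : 0 < M by rewrite mulr_gt0// exprn_gt0.
  pose c k : R[i] := if k == n.+1 then (M^-1)%:C else 0.
  have rc : radius_ge 1 c.
    move=> s s0 s1; exists M^-1 => k; rewrite /c; case: eqP => _.
      rewrite modulus_real gtr0_norm ?invr_gt0// ler_piMr ?invr_ge0 ?(ltW M0)//.
      by rewrite exprn_ile1 ?(ltW s0) ?(ltW s1).
    by rewrite modulus0 mul0r invr_ge0 ltW.
  have cE z : unit_disc z -> pser c z = (M^-1)%:C * z ^+ n.+1.
    rewrite /unit_disc/= => z1.
    apply/esym/(@pser_unique R 1 _ _ _ (M^-1 * 2 ^+ n.+1) 2^-1) => //.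
      by rewrite invf_lt1// ltr1n.
    have cn m : psum c m z = if (n.+1 < m)%N then (M^-1)%:C * z ^+ n.+1 else 0.
      elim: m => [|m IH]; first by rewrite /psum big_ord0.
      rewrite /psum big_ord_recr/= -/(psum c m z) IH /c ltnS.
      by case: (ltngtP n.+1 m) => [h|h|->]; rewrite ?mul0r ?addr0 ?add0r.
    move=> m; rewrite cn; case: ltnP => mn.
      by rewrite subrr modulus0 !mulr_ge0 ?exprn_ge0 ?invr_ge0 ?(ltW M0).
    rewrite subr0 modulusM modulus_real gtr0_norm ?invr_gt0// -mulrA.
    rewrite ler_wpM2l ?invr_ge0 ?(ltW M0)//; apply: (@le_trans _ _ 1).
      by rewrite modulusX exprn_ile1 ?modulus_ge0// ltW.
    by rewrite exprVn ler_pdivlMr ?exprn_gt0// mul1r ler_eXn2l// ltr1n.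
  have cK z : unit_disc z -> modulus (pser c z) * v (modulus z)%:C <= 1.
    move=> zD; rewrite cE// weight_profile// modulusM modulus_real gtr0_norm ?invr_gt0//.
    rewrite -mulrA mulrC ler_pdivrMr// mul1r modulusX.
    have [_ /(_ (modulus z))] := peak _ n0.
    rewrite modulus_ge0 ltW//= => /(_ isT).
    by rewrite !powR_mulrn ?modulus_ge0// ltW.
  exists (MkHinf (disc_pser_Hinf rc cK)); split.
    by apply: Hnorm_le => z zD /=; rewrite disc_pser_in//; exact: cK.
  by move=> k; rewrite (disc_pser_coef k rc).
have [e He] := choice mono.
have sep n m : n != m -> modulus (gam n.+1) <= 2 * Hnorm (T (e n) - T (e m) : Hinf v).
  move=> nm; have n0 : 0 < n.+1%:R :> R by rewrite ltr0n.
  have rn := rho_gt0 peak n0; have pn := profile_rho peak n0.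
  have := Hcoef_le (T (e n) - T (e m) : Hinf v) n.+1 rn (rho_lt1 peak n0).
  rewrite HcoefB !Tc (He n).2 (He m).2 eqxx eqSS (negbTE nm) mulr0 subr0.
  set M : R := rho n.+1%:R ^+ n.+1 * _.
  have M0 : 0 < M by rewrite mulr_gt0// exprn_gt0.
  rewrite -mulrA -/M modulusM modulus_real gtr0_norm ?invr_gt0// divfK// gt_eqF//.
apply: contrapT => l0; have ml : 0 < modulus l by rewrite modulus_gt0; apply/eqP.
(* Two images within |l| / 8 of a cluster point are within |l| / 4 of each other, so [sep] gives
   |gam| <= |l| / 2, incompatible with |gam - l| < |l| / 8. *)
have d0 : 0 < modulus l / 8 by rewrite divr_gt0.
have [N HN] := gl _ d0.
pose S (n : nat) : Hinf v := T (e n).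
have SF : (S @ \oo) (closure TB).
  exists 0%N => // n _; apply: subset_closure; exists (e n) => //=.
  by rewrite Hinf_normE lecR; have [] := He n.
have [p [_ pcl]] := cT (S @ \oo) _ SF.
have pB : nbhs p (ball p ((modulus l / 8)%:C : R[i])).
  by apply: nbhsx_ballx; rewrite ltcR.
have near k : exists2 n, (k <= n)%N & Hnorm (p - S n : Hinf v) < modulus l / 8.
  have Sk : (S @ \oo) (S @` [set n | (k <= n)%N]) by exists k => // n /= kn; exists n.
  have [x [[n /= kn <-]]] := pcl _ _ Sk pB.
  by rewrite -ball_normE/= Hinf_normE ltcR => H; exists n.
have [n Nn Hn] := near N; have [m nm Hm] := near n.+1.
have := sep n m (negbT (ltn_eqF nm)).
have : Hnorm (S n - S m : Hinf v) <= modulus l / 8 + modulus l / 8.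
  have -> : S n - S m = (p - S m) - (p - S n) by rewrite [RHS]addrC opprB addrA subrK.
  rewrite -lecR rmorphD -!Hinf_normE; apply: le_trans (ler_normB _ _) _.
  by rewrite lerD// Hinf_normE lecR ltW.
have := HN n.+1 (leqW Nn).
have : modulus l <= modulus (gam n.+1 - l) + modulus (gam n.+1).
  have {1}-> : l = gam n.+1 - (gam n.+1 - l) by ring.
  by apply: le_trans (modulusB _ _) _; rewrite addrC.
move=> h1 h2 h3 h4.
have {}h4 : modulus (gam n.+1) <= 2 * Hnorm (S n - S m : Hinf v) := h4.
move: h1 h2 h3 h4 ml; move: (Hnorm (S n - S m : Hinf v)) (modulus (gam n.+1 - l)).
by move: (modulus l) (modulus (gam n.+1)) => L b D a; lra.
Qed.

End compactness.

Theorem theorem1p4 (R : realType) (v : weight R) (a : R[i] -> R[i])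
    (hB : condition_B v)
    (hv : exists2 eps : R, 0 < eps & moment_ratio_bounded v eps)
    (aL1 : L1_disc a) (arad : radial_symbol a)
    (delta : R) (hdelta : 0 < delta < 1)
    (dre : differentiable_co (re_symbol a) delta)
    (dim : differentiable_co (im_symbol a) delta)
    (sre : derivative_semibounded (re_symbol a))
    (sim : derivative_semibounded (im_symbol a))
    (C : R) (hC : 0 < C)
    (hder : forall r, delta < r < 1 ->
       modulus (symbol_derivative a r) <= C / ((1 - r) * ln (1 - r) ^+ 2)) :
  exists T : {linear Hinf v -> Hinf v},
    [/\ is_toeplitz a T,
        bounded_operator T
      & modulus (symbol_derivative a r) * (1 - r) * ln (1 - r) ^+ 2
          @[r --> 1^'-] --> 0 ->
        (compact_operator T <->
         (a r%:C : R[i]^o) @[r --> (1 : R)^'-] --> (0 : R[i]^o))].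
Proof.
have [eps eps0 ratio] := hv; have /andP[d0 d1] := hdelta.
have [iRe iIm] := aL1.
have [Fr iFr uFr] := radial_symbol_integrable iRe arad.
have [Fi iFi uFi] := radial_symbol_integrable iIm arad.
have slr : log_slope (re_symbol a) delta C.
  move=> r dr r1; have rin : delta < r < 1 by rewrite dr.
  split; first by apply: (proj1 dre).
  by apply: le_trans (hder r rin); exact: (Re_le_modulus (symbol_derivative a r)).
have sli : log_slope (im_symbol a) delta C.
  move=> r dr r1; have rin : delta < r < 1 by rewrite dr.
  split; first by apply: (proj1 dim).
  by apply: le_trans (hder r rin); exact: (Im_le_modulus (symbol_derivative a r)).
have [lr [gr [tr [cr Er dr [Br HBr] sr]]]] :=
  symbol_moments eps0 ratio iFr uFr (ltW d0) d1 (ltW hC) slr sre.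
have [li [gi [ti [ci Ei di [Bi HBi] si]]]] :=
  symbol_moments eps0 ratio iFi uFi (ltW d0) d1 (ltW hC) sli sim.
pose l := lr +i* li; pose gam := multiplier v a; pose tau n := tr n + ti n.
have gamE n : gam n - l = gr n +i* gi n.
  rewrite /gam /multiplier; have := Er n; have := Ei n.
  have m0 := moment_gt0 v (2 * n + 1).
  move: (moment v (re_symbol a) _) (moment v (im_symbol a) _) m0 => X Y.
  move: (moment v _ _) => m m0 hX hY.
  have -> : (X +i* Y) / m%:C = (X / m) +i* (Y / m).
    apply: (@mulIf _ m%:C); first by rewrite -modulus_eq0 modulus_real normr_eq0 gt_eqF.
    rewrite divfK; last by rewrite -modulus_eq0 modulus_real normr_eq0 gt_eqF.
    apply/eqP; rewrite eq_complex/= !mulr0 subr0 add0r !divfK ?eqxx// ?gt_eqF//.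
  rewrite hX hY /l; apply/eqP; rewrite eq_complex/=.
  by rewrite addrAC subrr add0r addrAC subrr add0r !eqxx.
have dom : dominated (fun n => gam n - l) tau.
  move=> n; have [r1 r2] := dr n; have [i1 i2] := di n; split.
    by rewrite gamE; apply: le_trans (modulus_le_ReIm _) _; exact: lerD.
  rewrite !gamE; apply: le_trans (modulus_le_ReIm _) _ => /=.
  by rewrite /tau opprD addrACA; exact: lerD.
have lE : log_dominated (fun n => gam n - l) tau (Br + Bi).
  by split => // n; rewrite /tau mulrDl lerD.
have [T [Tc Tb]] := multiplier_linear hB lE.
exists T; split => //.
  move=> h z zD; rewrite Hinf_pser//.
  rewrite (_ : taylor_coef (T h) = fun k => gam k * taylor_coef h k); last exact/funext.
  apply: pser_cvg => //; rewrite -(_ : taylor_coef (T h) = fun k => gam k * taylor_coef h k).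
    exact: Hcoef_radius.
  exact/funext.
move=> small.
have smallc (u : R -> R) (f : R -> R[i]) : (forall r, `|derive1 u r| <= modulus (f r)) ->
    modulus (f r) * (1 - r) * ln (1 - r) ^+ 2 @[r --> (1 : R)^'-] --> 0 ->
    `|derive1 u r| * (1 - r) * ln (1 - r) ^+ 2 @[r --> (1 : R)^'-] --> 0.
  move=> uf f0; apply: (squeeze_cvgr _ (cvg_cst 0) f0); near=> r.
  have r1 : 0 <= 1 - r by rewrite subr_ge0 ltW//; near: r; exact: nbhs_left_lt.
  have l0 : 0 <= ln (1 - r) ^+ 2 by exact: sqr_ge0.
  apply/andP; split; first by rewrite mulr_ge0// mulr_ge0.
  by rewrite ler_wpM2r// ler_wpM2r.
have smr := sr (smallc _ _ (fun r => Re_le_modulus (symbol_derivative a r)) small).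
have smi := si (smallc _ _ (fun r => Im_le_modulus (symbol_derivative a r)) small).
have smt (e : R) : 0 < e -> exists N, forall n, (N <= n)%N -> tau n * ln (n%:R + 2) <= e.
  move=> e0; have e2 : 0 < e / 2 by rewrite divr_gt0.
  have [N HN] := smr _ e2; have [M HM] := smi _ e2.
  exists (maxn N M) => n; rewrite geq_max => /andP[nN nM].
  by rewrite /tau mulrDl [e]splitr lerD ?HN ?HM.
(* The symbol tends to the l that was split off from the multiplier, so both sides of the
   equivalence amount to l = 0. *)
have al : (a r%:C : R[i]^o) @[r --> (1 : R)^'-] --> (l : R[i]^o).
  apply/cvg_modulusP => e e0; have e2 : 0 < e / 2 by rewrite divr_gt0.
  near=> r; apply: le_lt_trans (modulus_le_ReIm _) _; rewrite [e]splitr.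
  have h1 : `|re_symbol a r - lr| < e / 2.
    by rewrite distrC; near: r; exact: cvgr_dist_lt.
  have h2 : `|im_symbol a r - li| < e / 2.
    by rewrite distrC; near: r; exact: cvgr_dist_lt.
  move: h1 h2; rewrite /re_symbol /im_symbol /l; case: (a r%:C) => x y /= h1 h2.
  exact: ltrD.
split=> [cT|a0].
  suff l0 : l = 0 by rewrite -l0.
  apply: (compact_limit hB Tc _ cT) => e e0.
  have l2 : 0 < ln 2 :> R by rewrite ln_gt0// ltr1n.
  have [N HN] := smt (e / 2 * ln 2) (mulr_gt0 (divr_gt0 e0 (ltr0Sn _ 1)) l2).
  exists N => n Nn; have [h1 _] := dom n.
  have t0 : 0 <= tau n by apply: le_trans (h1); exact: modulus_ge0.
  apply: le_lt_trans h1 _.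
  apply: (@le_lt_trans _ _ (e / 2)); last by rewrite gtr_pMr// invf_lt1// ltr1n.
  rewrite -(ler_pM2r l2); apply: le_trans (HN n Nn).
  by rewrite ler_wpM2l// ler_ln ?posrE ?ltr_wpDl// lerDr.
have l0 : l = 0.
  have H : hausdorff_space R[i]^o by exact: norm_hausdorff.
  exact: (cvg_unique H al a0).
apply: (compact_of_small hB Tc _ smt).
by have := dom; rewrite l0; congr dominated; apply/funext => n; rewrite subr0.
Unshelve. all: by end_near. Qed.
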